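(* Let $G$ be a simple connected cubic graph on $2n$ vertices. Then $\operatorname{PerMat}(G) \le m_n$, and moreover, equality holds if and only if $G$ is isomorphic to one of the graphs in the family $M_n$. In particular, for $n \ge 6$ we have the sharp bound $$\operatorname{PerMat}(G) \le 4 f_{n-1},$$ where $f_n$ denotes the $n$th Fibonacci number.
   Context: Graphs are finite. $\operatorname{PerMat}(G)$ denotes the number of perfect matchings of $G$ (for a cubic graph this equals the number of $2$-factors, via complements). A simple cubic graph on $2n$ vertices has $n\ge 2$. Fibonacci numbers: $f_0=0$, $f_1=1$, $f_n=f_{n-1}+f_{n-2}$. The numbers $m_n$ ($n\ge 2$): $m_2=3$, $m_3=6$, $m_4=9$, $m_5=13$, and $m_n=4f_{n-1}$ for $n\ge 6$. The families $M_n$ ($n\ge 2$) of simple connected cubic graphs on $2n$ vertices: - $M_2=\{K_4\}$; - $M_3=\{K_{3,3}\}$; - $M_4$ consists of the single graph $K_{4,4}$ with a perfect matching removed; - $M_5$ consists of the single graph that is the Möbius ladder on $10$ vertices (vertices $x_1,\dots,x_{10}$, edges $x_ix_{i+1}$ and $x_ix_{i+5}$, indices modulo $10$); - $M_6$ consists of two graphs: the circular ladder on $12$ vertices (vertices $x_1,\dots,x_6,y_1,\dots,y_6$, edges $x_iy_i$, $x_ix_{i+1}$, $y_iy_{i+1}$, indices modulo $6$), and the graph $L_6$; - for $n\ge 7$, $M_n=\{L_n\}$. Here, for $n\ge 6$, $L_n$ is ''the ladder graph with $K_{3,3}$ inserted at both ends'': it has the $2n$ vertices $p_1,\dots,p_{n-4}$,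 $q_1,\dots,q_{n-4}$, $a,b,c,d$, $a',b',c',d'$ and the edges $p_ip_{i+1}$, $q_iq_{i+1}$ for $1\le i\le n-5$; the rungs $p_iq_i$ for $2\le i\le n-5$; the edges $p_1a,\ p_1c,\ q_1b,\ q_1d,\ ab,\ bc,\ cd,\ da$ at one end; and the edges $p_{n-4}a',\ p_{n-4}c',\ q_{n-4}b',\ q_{n-4}d',\ a'b',\ b'c',\ c'd',\ d'a'$ at the other end. (So each end is a copy of $K_{3,3}$ with one edge, $p_1q_1$ respectively $p_{n-4}q_{n-4}$, removed.) *)

(* Defs.v *)
From mathcomp Require Import all_boot.

Set Implicit Arguments.
Unset Strict Implicit.
Unset Printing Implicit Defensive.

Record sgraph := SGraph {
  vertex :> finType;
  edge : rel vertex;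
  edge_sym : symmetric edge;
  edge_irr : irreflexive edge }.

Arguments edge {s} : rename.

Definition cubic (G : sgraph) : Prop :=
  forall x : G, #|[set y | edge x y]| = 3.

Definition connected (G : sgraph) : Prop :=
  0 < #|G| /\ forall x y : G, connect edge x y.

Definition isomorphic (G H : sgraph) : Prop :=
  exists f : G -> H, bijective f /\ forall x y, edge (f x) (f y) = edge x y.

Definition edge_set (G : sgraph) : {set {set G}} :=
  [set [set x; y] | x in G, y in G & edge x y].

Definition perfect_matching (G : sgraph) (M : {set {set G}}) : bool :=
  (M \subset edge_set G) && [forall v, #|[set e in M | v \in e]| == 1].

Definition PerMat (G : sgraph) : nat :=
  #|[set M : {set {set G}} | perfect_matching M]|.

Fixpoint fib (n : nat) : nat :=
  match n with
  | 0 => 0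
  | 1 => 1
  | (k.+1 as k1).+1 => fib k1 + fib k
  end.

(* Only meaningful for 2 <= n: no simple connected cubic graph has fewer than
   four vertices. *)
Definition max_permat (n : nat) : nat :=
  match n with
  | 2 => 3
  | 3 => 6
  | 4 => 9
  | 5 => 13
  | _ => 4 * fib n.-1
  end.

Section Undirected.

Variables (T : finType) (arc : rel T).

Definition sym_closure : rel T := fun x y => arc x y || arc y x.

Lemma sym_closure_sym : symmetric sym_closure.
Proof. by move=> x y; rewrite /sym_closure orbC. Qed.

Lemma sym_closure_irr : irreflexive arc -> irreflexive sym_closure.
Proof. by move=> arc_irr x; rewrite /sym_closure arc_irr. Qed.

Definition undirected (arc_irr : irreflexive arc) : sgraph :=
  SGraph sym_closure_sym (sym_closure_irr arc_irr).

End Undirected.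

Lemma succ_mod_neq (n : nat) (i : 'I_n) : 1 < n -> (i == i.+1 %% n :> nat) = false.
Proof.
move=> n_gt1; apply/negbTE/eqP => eq_i.
have := ltn_ord i; rewrite leq_eqVlt => /orP [/eqP iSn | lt_iS].
  by move: eq_i n_gt1; rewrite iSn modnn => i0; rewrite -iSn i0.
by move: eq_i; rewrite modn_small // => /eqP; rewrite ltn_eqF.
Qed.

Definition K4_arc : rel 'I_4 := fun x y => x != y.

Lemma K4_arc_irr : irreflexive K4_arc.
Proof. by move=> x; rewrite /K4_arc eqxx. Qed.

Definition K4 : sgraph := undirected K4_arc_irr.

Definition K33_arc : rel (bool * 'I_3) := fun x y => x.1 != y.1.

Lemma K33_arc_irr : irreflexive K33_arc.
Proof. by move=> x; rewrite /K33_arc eqxx. Qed.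

Definition K33 : sgraph := undirected K33_arc_irr.

(* K_{4,4} minus the perfect matching formed by the pairs (false, i), (true, i) *)
Definition K44_minus_matching_arc : rel (bool * 'I_4) :=
  fun x y => (x.1 != y.1) && (x.2 != y.2).

Lemma K44_minus_matching_arc_irr : irreflexive K44_minus_matching_arc.
Proof. by move=> x; rewrite /K44_minus_matching_arc eqxx. Qed.

Definition K44_minus_matching : sgraph := undirected K44_minus_matching_arc_irr.

Definition mobius_ladder10_arc : rel 'I_10 :=
  fun x y => (y == x.+1 %% 10 :> nat) || (y == (x + 5) %% 10 :> nat).

Lemma mobius_ladder10_arc_irr : irreflexive mobius_ladder10_arc.
Proof. by case; do 10?[case=> //]. Qed.

Definition mobius_ladder10 : sgraph := undirected mobius_ladder10_arc_irr.

(* (false, i) is the vertex x_i and (true, i) is the vertex y_i *)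
Definition circular_ladder12_arc : rel (bool * 'I_6) :=
  fun u v => if u.1 == v.1 then v.2 == u.2.+1 %% 6 :> nat else u.2 == v.2.

Lemma circular_ladder12_arc_irr : irreflexive circular_ladder12_arc.
Proof.
by move=> [s i]; rewrite /circular_ladder12_arc eqxx /= succ_mod_neq.
Qed.

Definition circular_ladder12 : sgraph := undirected circular_ladder12_arc_irr.

(* The ladder with K_{3,3} inserted at both ends, for 6 <= n.
   Rails: inl (false, i) is p_{i+1} and inl (true, i) is q_{i+1}, i < n - 4.
   Ends: inr (false, k) is a, b, c, d and inr (true, k) is a', b', c', d' for
   k = 0, 1, 2, 3; each end is a 4-cycle whose even vertices are joined to the
   extreme p and whose odd vertices are joined to the extreme q. *)
Definition ladderK33_vertex (n : nat) : finType :=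
  ((bool * 'I_(n - 4)) + (bool * 'I_4))%type.

Definition ladderK33_arc (n : nat) : rel (ladderK33_vertex n) :=
  fun u v =>
  match u, v with
  | inl (s, i), inl (t, j) =>
      if s == t then j == i.+1 :> nat
      else (i == j) && (0 < i < n - 5)
  | inl (s, i), inr (t, k) =>
      (i == (if t then n - 5 else 0) :> nat) && (odd k == s)
  | inr (s, k), inr (t, l) => (s == t) && (l == k.+1 %% 4 :> nat)
  | inr _, inl _ => false
  end.

Lemma ladderK33_arc_irr (n : nat) : irreflexive (@ladderK33_arc n).
Proof.
case=> [[s i] | [s k]] /=; rewrite eqxx /=; last by rewrite succ_mod_neq.
by rewrite ltn_eqF.
Qed.

Definition ladderK33 (n : nat) : sgraph := undirected (@ladderK33_arc_irr n).

Inductive extremal : nat -> sgraph -> Prop :=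
  | extremal2 : extremal 2 K4
  | extremal3 : extremal 3 K33
  | extremal4 : extremal 4 K44_minus_matching
  | extremal5 : extremal 5 mobius_ladder10
  | extremal6 : extremal 6 circular_ladder12
  | extremal_ladder n of 6 <= n : extremal n (ladderK33 n).

(* Main.v *)
Require Import Defs.
From mathcomp Require Import all_boot.
From mathcomp Require Import zify.

Set Implicit Arguments.
Unset Strict Implicit.
Unset Printing Implicit Defensive.

(** Strong induction on n. For n <= 5 all cubic graphs are enumerated. For n >= 6
    the graph is reduced by deleting a few vertices and reconnecting their
    neighbours by new edges, so that the perfect matchings are counted by those of
    smaller cubic graphs.
    - An edge v x that is a bridge or whose v lies on no 4-cycle, and a triangle,
      give at most (3/2) m_{n-1} < m_n.
    - K33 minus an edge leaves a piece S0 attached by two edges at c and d. Peeling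
      rungs off S0 gives, for the numbers X, Y of perfect matchings of S0 and of
      S0 - c - d, the bound f_{j+3} X + f_{j+2} Y <= 2 f_{k+j+2} where |S0| = 2k,
      with equality only for a ladder that ends in K33 minus an edge.
    - A 4-cycle x1 x2 x3 x4 with outer neighbours y_i reduces to the cubic graphs
      G - x3 - x4 + x1 y4 + x2 y3 and G - x1 - x2 - x3 - x4 + y1 y4 + y2 y3, hence
      m_{n-1} + m_{n-2} = m_n for n >= 8. Equality would make the first one L_{n-1},
      one of whose ends survives in G. For n = 6, 7 the triangle-free cubic graphs
      with every vertex on a 4-cycle are enumerated. *)

(** * Perfect matchings of induced subgraphs *)

(** A graph is a relation [e] on a fixed type, restricted to a vertex set [S]. Deletion changes only
    [S] and a new edge only [e], so all reduced graphs live on one type and the induction hypothesis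
    quantifies over [e] and [S]. The factor 3/2 comes from the two ways of reconnecting the
    neighbours at an edge v x: together they count every matching of G, those through v x twice.
    Summing over the three edges at v gives 4 PerMat(G) <= 6 m_{n-1}. A reconnection may disconnect
    the graph. Then G splits into two pieces, each attached by two edges, and the product of their
    bounds must stay below m_n. This fails for K33, as 6 * 6 = 36 exceeds m_7 = 32; so K33 minus an
    edge has to be settled beforehand, by a sharper estimate with Fibonacci weights. The recursion
    m_n = m_{n-1} + m_{n-2} starts only at n = 8: m_5 + m_4 = 22 exceeds m_6 = 20, and m_6 + m_5 =
    33 exceeds m_7 = 32. This is why 4-cycles need an enumeration for n = 6 and 7. From n = 8 on,
    the only extremal graph that the equality case meets is a ladder. *)

Section Matchings.

Variable T : finType.
Implicit Types (e : rel T) (S C : {set T}) (l r : seq T).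

Definition simple e := symmetric e /\ irreflexive e.

Definition is_edge e (B : {set T}) :=
  [exists x, exists y, e x y && (B == [set x; y])].

Lemma is_edgeP e B :
  reflect (exists x y, e x y /\ B = [set x; y]) (is_edge e B).
Proof.
apply: (iffP existsP) => [[x /existsP [y /andP [exy /eqP ->]]]|].
  by exists x, y.
by case=> x [y [exy ->]]; exists x; apply/existsP; exists y; rewrite exy eqxx.
Qed.

(** Matchings as partitions of [S] into edges: inserting or removing an edge is then adding or
    removing a block. *)
Definition pmset e S :=
  [set M : {set {set T}} | partition M S & [forall B in M, is_edge e B]].

Definition pm e S := #|pmset e S|.

Lemma pm_set0 e : pm e set0 = 1.
Proof.
rewrite /pm (_ : pmset e set0 = [set set0]) ?cards1 //.
apply/setP=> M; rewrite !inE partition_set0.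
case: eqVneq => //= ->.
by apply/forallP=> B; rewrite inE.
Qed.

Lemma pm_congr e e' S :
  {in S &, forall x y, e x y = e' x y} -> pm e S = pm e' S.
Proof.
move=> ee'; apply: eq_card => M; rewrite !inE.
apply: andb_id2l => partM; apply: eq_forallb => B.
apply: implyb_id2l => BM.
have BS : B \subset S.
  by rewrite -(cover_partition partM); apply: (bigcup_max B).
apply/is_edgeP/is_edgeP => -[x [y [exy Bxy]]]; exists x, y; split=> //;
  have [xS yS] : x \in S /\ y \in S
    by split; apply: (subsetP BS); rewrite Bxy !inE eqxx ?orbT.
- by rewrite -ee'.
- by rewrite ee'.
Qed.

Lemma pmsetU e S v u M : simple e -> v \in S -> u \in S -> e v u ->
  M \in pmset e (S :\ v :\ u) ->
  [set v; u] |: M \in pmset e S /\ [set v; u] \notin M.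
Proof.
move=> [esym eirr] vS uS evu; rewrite !inE => /andP [partM /forallP edgM].
have vNM : [set v; u] \notin M.
  apply/negP => vuM; have : v \in cover M.
    by apply/bigcupP; exists [set v; u]; rewrite // !inE eqxx.
  by rewrite (cover_partition partM) !inE eqxx andbF.
split=> //; apply/andP; split.
  have -> : S = [set v; u] :|: (S :\ v :\ u).
    apply/setP=> x; rewrite !inE.
    have [->|_] := eqVneq x v; first by rewrite vS.
    by have [->|_] := eqVneq x u; rewrite ?uS.
  apply: partitionU1 => //.
    by apply/set0Pn; exists v; rewrite !inE eqxx.
  rewrite disjoints_subset; apply/subsetP => x; rewrite !inE.
  by case/orP => ->; rewrite ?andbF.
apply/forallP=> B; apply/implyP; rewrite !inE => /orP [/eqP ->|BM].
  by apply/is_edgeP; exists v, u.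
by have := edgM B; rewrite BM.
Qed.

Lemma pmsetD e S v u M : simple e -> e v u ->
  M \in pmset e S -> [set v; u] \in M ->
  M :\ [set v; u] \in pmset e (S :\ v :\ u).
Proof.
move=> [esym eirr] evu; rewrite !inE => /andP [partM /forallP edgM] vuM.
apply/andP; split.
  have -> : S :\ v :\ u = S :\: [set v; u].
    by apply/setP=> x; rewrite !inE negb_or; case: (x == u); case: (x == v).
  exact: partitionD1.
apply/forallP=> B; apply/implyP; rewrite !inE => /andP [_ BM].
by have := edgM B; rewrite BM.
Qed.

(** Matchings are classified by the partner [u] of [v]; inserting the block {v, u} is a bijection
    from the matchings of S - v - u onto the class of [u]. *)
Lemma pm_rec e S v : simple e -> v \in S ->
  pm e S = \sum_(u in S | e v u) pm e (S :\ v :\ u).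
Proof.
move=> simp vS; have [esym eirr] := simp.
(* The partner of [v] in [M]; the default [v] never occurs for a matching of [S]. *)
pose p (M : {set {set T}}) := odflt v [pick u | [set v; u] \in M].
have pP M : M \in pmset e S ->
    [/\ [set v; p M] \in M, p M \in S, e v (p M)
      & forall u, [set v; u] \in M -> u = p M].
  move=> MS; have := MS; rewrite !inE => /andP [partM /forallP edgM].
  have vM : v \in cover M by rewrite (cover_partition partM).
  have [u vuM] : exists u, [set v; u] \in M.
    have BM := pblock_mem vM; have := edgM (pblock M v).
    rewrite BM => /is_edgeP [x [y [exy Bxy]]].
    have : v \in pblock M v by rewrite mem_pblock.
    rewrite {1}Bxy !inE => /orP [/eqP vx|/eqP vy].
      by exists y; rewrite vx -Bxy.
    by exists x; rewrite vy setUC -Bxy.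
  have vpM : [set v; p M] \in M.
    by rewrite /p; case: pickP => [w //|/(_ u)]; rewrite vuM.
  have evp : e v (p M).
    have := edgM [set v; p M]; rewrite vpM => /is_edgeP [x [y [exy Bxy]]].
    have xy : x != y by apply: contraTneq exy => ->; rewrite eirr.
    have : v \in [set x; y] by rewrite -Bxy !inE eqxx.
    have : p M \in [set x; y] by rewrite -Bxy !inE eqxx orbT.
    have : x \in [set v; p M] by rewrite Bxy !inE eqxx.
    have : y \in [set v; p M] by rewrite Bxy !inE eqxx orbT.
    rewrite !inE => yB xB pB vB.
    case/orP: vB => /eqP vE; case/orP: pB => /eqP pE; last 1 first.
    - by move: xB; rewrite vE pE orbb (negbTE xy).
    - by move: yB; rewrite vE pE orbb eq_sym (negbTE xy).
    - by rewrite vE pE.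
    - by rewrite vE pE esym.
  split=> //.
    rewrite -(cover_partition partM); apply/bigcupP.
    by exists [set v; p M]; rewrite // !inE eqxx orbT.
  move=> w vwM.
  have trivM : trivIset M by case/and3P: partM.
  have : [set v; w] = [set v; p M].
    by rewrite -(def_pblock trivM vwM (x := v)) ?inE ?eqxx //
               -(def_pblock trivM vpM (x := v)) ?inE ?eqxx.
  move=> E; have : w \in [set v; p M] by rewrite -E !inE eqxx orbT.
  rewrite !inE => /orP [/eqP wv|/eqP //].
  have : p M \in [set v; w] by rewrite E !inE eqxx orbT.
  by rewrite wv !inE orbb => /eqP ->.
rewrite {1}/pm -sum1_card (partition_big p (fun u => (u \in S) && e v u)) /=;
  last by move=> M /pP [_ -> ->].
apply: eq_bigr => u /andP [uS evu].
rewrite sum1dep_card /pm.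
rewrite -(card_in_imset (D := pmset e (S :\ v :\ u))
           (f := fun M => [set v; u] |: M)); last first.
  move=> M1 M2 /(pmsetU simp vS uS evu) [_ n1] /(pmsetU simp vS uS evu) [_ n2] E.
  by rewrite -(setU1K n1) E setU1K.
apply: eq_card => M; rewrite !inE; apply/idP/imsetP.
  case/andP => MS /eqP pM.
  have MS' : M \in pmset e S by rewrite inE.
  have [vpM _ _ _] := pP M MS'; rewrite pM in vpM.
  exists (M :\ [set v; u]); last by rewrite setD1K.
  exact: pmsetD.
case=> M' M'S ->; have [MS _] := pmsetU simp vS uS evu M'S.
have := MS; rewrite inE => -> /=.
have [_ _ _ U] := pP _ MS; rewrite eq_sym; apply/eqP/U.
by rewrite !inE eqxx.
Qed.

End Matchings.

(** * Degrees, cuts, parity and deletion in graphs on a vertex subset *)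

Section Graphs.

Variable T : finType.
Implicit Types (e : rel T) (S C : {set T}) (l r : seq T).

Definition deg e S x := #|[set y in S | e x y]|.

Definition cubic_on e S := forall x, x \in S -> deg e S x = 3.

(** Within [S], the set [C] is a union of components; it may also contain vertices outside [S]. *)
Definition closed_in e S C :=
  forall x y, x \in S -> y \in S -> e x y -> (x \in C) = (y \in C).

(** Connectedness through cuts instead of paths: after a reconnection one only has to follow on
    which side of [C] the neighbours of the deleted vertices lie. *)
Definition connected_on e S := forall C, closed_in e S C ->
  forall x y, x \in S -> y \in S -> (x \in C) = (y \in C).

(** No cut consists of the single edge a b: if no other edge crosses [C], then a b does not cross it
    either. *)
Definition bridgeless e S := forall a b C, a \in S -> b \in S -> e a b ->
  (forall x y, x \in S -> y \in S -> e x y ->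
     ~ (x = a /\ y = b) -> ~ (x = b /\ y = a) -> (x \in C) = (y \in C)) ->
  (a \in C) = (b \in C).

Definition add a b e : rel T :=
  fun x y => [|| e x y, (x == a) && (y == b) | (x == b) && (y == a)].

Lemma simple_add a b e : a != b -> simple e -> simple (add a b e).
Proof.
move=> ab [esym eirr]; split=> [x y|x]; rewrite /add.
  by rewrite esym orbC [in RHS]orbC [in RHS](orbC (_ && _)) !(andbC (y == _)).
rewrite eirr /=; apply/norP; split; apply/negP => /andP [/eqP -> ];
  by rewrite ?(negbTE ab) // eq_sym (negbTE ab).
Qed.

Lemma deg_add a b e S x : a != b -> ~~ e a b -> symmetric e -> a \in S -> b \in S ->
  deg (add a b e) S x = deg e S x + (x == a) + (x == b).
Proof.
move=> ab eab esym aS bS.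
have dj y : ~~ e x y -> y \in S -> #|[set z in S | e x z || (z == y)]| = (deg e S x).+1.
  move=> exy yS; rewrite (cardsD1 y) !inE yS eqxx orbT add1n; congr _.+1.
  apply: eq_card => z; rewrite !inE.
  by have [->|] := eqVneq z y; rewrite ?(negbTE exy) ?andbF ?orbF.
have [xa|xa] := eqVneq x a.
  rewrite xa (negbTE ab) addn0 addn1 -xa -(dj b) ?xa //.
  by apply: eq_card => z; rewrite !inE /add eqxx (negbTE ab) /= orbF.
have [xb|xb] := eqVneq x b.
  rewrite xb addn0 addn1 -xb -(dj a) ?xb 1?esym //.
  by apply: eq_card => z; rewrite !inE /add eqxx [b == a]eq_sym (negbTE ab) /=.
rewrite !addn0; apply: eq_card => z.
by rewrite !inE /add (negbTE xa) (negbTE xb) !orbF.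
Qed.

Lemma deg_setD e S r x : uniq r -> all (mem S) r ->
  deg e S x = deg e (S :\: [set z in r]) x + \sum_(z <- r) e x z.
Proof.
move=> ur rS; have -> : \sum_(z <- r) e x z = #|[set y in r | e x y]|.
  rewrite -sum1dep_card big_mkcondr /= (big_uniq _ ur) /=.
  by apply: eq_bigr => z _; case: (e x z).
rewrite addnC /deg -(cardsID [set z in r] [set y in S | e x y]); congr (_ + _).
  apply: eq_card => z; rewrite !inE; case: (boolP (z \in r)) => [zr|_].
    by have /= -> := allP rS z zr; rewrite andbT.
  by rewrite !andbF.
by apply: eq_card => z; rewrite !inE andbA.
Qed.

Lemma even_degsum e C : simple e -> ~~ odd (\sum_(x in C) deg e C x).
Proof.
move=> [esym eirr]; have [m] := ubnP #|C|; elim: m C => // m IH C lt_m.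
have [->|[x xC]] := set_0Vmem C; first by rewrite big_set0.
have CE y : deg e C y = deg e (C :\ x) y + e y x.
  rewrite (@deg_setD e C [:: x]) /= ?xC // big_seq1; congr (deg _ _ _ + _).
  by apply/setP => z; rewrite !inE.
have := IH (C :\ x); rewrite (cardsD1 x C) xC in lt_m => /(_ lt_m) IHx.
rewrite (big_setD1 x) //= (eq_bigr _ (fun y _ => CE y)) big_split /= CE eirr addn0.
have -> : \sum_(y in C :\ x) e y x = deg e (C :\ x) x.
  rewrite /deg -sum1dep_card big_mkcondr /=.
  by apply: eq_bigr => z _; rewrite esym; case: (e x z).
by rewrite addnCA oddD (negbTE IHx) addnn odd_double.
Qed.

(** The degree sum over [C] is 3 |C|, and edges inside [C] contribute an even number to it; what
    remains is the number of edges leaving [C]. *)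
Lemma handshake e S C : simple e -> cubic_on e S -> C \subset S ->
  odd (\sum_(x in C) deg e (S :\: C) x) = odd #|C|.
Proof.
move=> simp cub /subsetP CS.
have : \sum_(x in C) deg e S x = #|C| * 3.
  by rewrite (eq_bigr (fun=> 3)) ?sum_nat_const // => x /CS /cub.
rewrite (eq_bigr (fun x => deg e C x + deg e (S :\: C) x)) => [|x xC].
  rewrite big_split /=; have := even_degsum C simp.
  move: (\sum_(x in C) deg e C x) (\sum_(x in C) _) #|C|; lia.
rewrite {1}/deg -(cardsID C); congr (_ + _); apply: eq_card => y; rewrite !inE.
  by have := CS y; case: (y \in C) => [->|]; rewrite ?andbT ?andbF.
by rewrite andbA.
Qed.

Lemma cardsD2 e S v u : simple e -> v \in S -> u \in S -> e v u ->
  #|S| = #|S :\ v :\ u|.+2.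
Proof.
move=> simp vS uS evu; have uv : u \in S :\ v.
  by rewrite !inE uS andbT; apply: contraTneq evu => ->; rewrite simp.2.
by rewrite (cardsD1 v) vS [in LHS](cardsD1 u (S :\ v)) uv.
Qed.

Lemma pm_odd e S : simple e -> odd #|S| -> pm e S = 0.
Proof.
move=> simp; have [m] := ubnP #|S|; elim: m S => // m IH S lt_m oS.
have [S0|[v vS]] := set_0Vmem S; first by rewrite S0 cards0 in oS.
rewrite (pm_rec simp vS) big1 // => u /andP [uS evu].
have E := cardsD2 simp vS uS evu.
by apply: IH; move: lt_m oS; rewrite E; lia.
Qed.

Lemma pm_closed e S C : simple e -> C \subset S -> closed_in e S C ->
  pm e S = pm e C * pm e (S :\: C).
Proof.
move=> simp; have [m] := ubnP #|C|; elim: m S C => // m IH S C lt_m CS cl.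
have [C0|[v vC]] := set_0Vmem C.
  by rewrite C0 pm_set0 mul1n setD0.
have vS := subsetP CS v vC.
rewrite (pm_rec simp vS) (pm_rec simp vC) big_distrl /=.
have -> : \sum_(u in S | e v u) pm e (S :\ v :\ u) =
          \sum_(u in C | e v u) pm e (S :\ v :\ u).
  apply: eq_bigl => u; case evu: (e v u); rewrite ?andbF // !andbT.
  apply/idP/idP => [uS|/(subsetP CS) //].
  by rewrite -(cl v u).
apply: eq_bigr => u /andP [uC evu].
rewrite (IH (S :\ v :\ u) (C :\ v :\ u)).
- congr (_ * pm e _); apply/setP => z; rewrite !inE.
  have [->|_] := eqVneq z v; first by rewrite vC !andbF.
  by have [->|_] := eqVneq z u; rewrite ?uC.
- by rewrite (cardsD2 simp vC uC evu) in lt_m; lia.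
- by do 2!apply: setSD.
move=> x y; rewrite !inE => /andP [-> /andP [-> xS]] /andP [-> /andP [-> yS]].
by move=> /(cl _ _ xS yS).
Qed.

Lemma pm_odd_closed e S C : simple e -> C \subset S -> closed_in e S C ->
  odd #|C| -> pm e S = 0.
Proof. by move=> simp CS cl oC; rewrite (pm_closed simp CS cl) pm_odd. Qed.

(* With the value 0 for a list that is not a duplicate-free list of vertices,
   coincidences among the vertices of l need no case analysis. *)
Definition q e S l := if uniq l && all (mem S) l then pm e (S :\: [set x in l]) else 0.

Lemma q_nil e S : q e S [::] = pm e S.
Proof. by rewrite /q /=; congr pm; apply/setP=> x; rewrite !inE. Qed.

Lemma q_perm e S l1 l2 : perm_eq l1 l2 -> q e S l1 = q e S l2.
Proof.
move=> p12; rewrite /q (perm_uniq p12) (perm_all _ p12).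
by case: ifP => // _; congr pm; apply/setP=> x; rewrite !inE (perm_mem p12).
Qed.

Lemma q_perm_idx e S x l (p : seq nat) : perm_eq p (iota 0 (size l)) ->
  q e S [seq nth x l i | i <- p] = q e S l.
Proof.
move=> pl; apply: q_perm; rewrite -[X in perm_eq _ X](take_size l).
by rewrite -(map_nth_iota0 x (leqnn _)) perm_map.
Qed.

Lemma q_rec e S l v : simple e -> v \in S -> v \notin l ->
  q e S l = \sum_(u in S | e v u) q e S (v :: u :: l).
Proof.
move=> simp vS vl; rewrite /q.
case: ifP => [/andP [ul lS]|ul]; last first.
  rewrite big1 // => u _; case: ifP => // /= /andP [/andP [_ /andP [_ ul']] /and3P [_ _ lS]].
  by rewrite ul' lS in ul.
have vSl : v \in S :\: [set x in l] by rewrite !inE vl.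
rewrite (pm_rec simp vSl) big_mkcond [RHS]big_mkcond /=; apply: eq_bigr => u _.
rewrite !inE ul lS vS andbT andbT.
have [uS|] := boolP (u \in S); rewrite ?andbF //= !andbT.
have [evu|] := boolP (e v u); rewrite ?andbF //= !andbT.
rewrite (negbTE vl) orbF (_ : v == u = false) /=; last first.
  by apply: contraTF evu => /eqP ->; rewrite simp.2.
case: (u \in l) => //=; congr pm; apply/setP=> x; rewrite !inE !negb_or.
by rewrite -!andbA andbCA.
Qed.

(** Split by whether the new edge is used. If an endpoint lies outside [S] or in [l], the second
    term is 0 by the default value of [q], so no membership has to be assumed. *)
Lemma q_add a b e S l : simple e -> a != b -> ~~ e a b ->
  q (add a b e) S l = q e S l + q e S (a :: b :: l).
Proof.
move=> simp ab eab; have simp' := simple_add ab simp.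
have congr_q l' : [|| a \notin S, b \notin S, a \in l' | b \in l'] ->
    q (add a b e) S l' = q e S l'.
  move=> abl; rewrite /q; case: ifP => // _; apply: pm_congr => x y.
  rewrite !inE => /andP [xl xS] /andP [yl yS]; rewrite /add.
  have [xa|_] := eqVneq x a; have [yb|_] := eqVneq y b;
  have [xb|_] := eqVneq x b; have [ya|_] := eqVneq y a;
  rewrite ?andbF ?andbT ?orbF //; subst; move: abl;
  by rewrite ?xS ?yS ?(negbTE xl) ?(negbTE yl).
have [abl|] := boolP [|| a \notin S, b \notin S, a \in l | b \in l].
  rewrite congr_q // [X in _ + X]/q ifF ?addn0 //=.
  by case/or4P: abl => [/negbTE E|/negbTE E|E|E]; rewrite !inE E ?orbT ?andbF.
rewrite !negb_or !negbK => /and4P [aS bS al bl].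
rewrite (q_rec simp' aS al) (q_rec simp aS al) (bigD1 b) /=; last first.
  by rewrite bS /add !eqxx orbT.
rewrite addnC congr_q ?inE ?eqxx ?orbT //; congr (_ + _).
apply: eq_big => [u|u _]; last by rewrite congr_q // inE eqxx !orbT.
rewrite /add eqxx (negbTE ab) /= orbF.
by have [->|ub] := eqVneq u b; rewrite ?(negbTE eab) ?andbF ?orbF ?andbT.
Qed.

Lemma q_setD e S r l : uniq r -> all (mem S) r ->
  q e (S :\: [set x in r]) l = q e S (r ++ l).
Proof.
move=> ur rS; rewrite /q cat_uniq all_cat ur rS /=.
have -> : ~~ has (mem r) l && uniq l && all (mem S) l =
          uniq l && all (mem (S :\: [set x in r])) l.
  rewrite [in LHS](andbC (~~ _)) -andbA; congr (_ && _).
  rewrite -all_predC -all_predI; apply: eq_all => x /=.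
  by rewrite !inE.
case: ifP => // _; congr pm; apply/setP=> x; rewrite !inE mem_cat negb_or.
by rewrite -andbA andbCA.
Qed.

Lemma pm_setD e S r : uniq r -> all (mem S) r ->
  pm e (S :\: [set x in r]) = q e S r.
Proof. by move=> ur rS; rewrite -q_nil q_setD // cats0. Qed.

Lemma pm_add2 e S r a b c d : simple e -> uniq r -> all (mem S) r ->
  a != b -> ~~ e a b -> c != d -> ~~ add a b e c d ->
  pm (add c d (add a b e)) (S :\: [set x in r]) =
  q e S r + q e S (r ++ [:: a; b]) + q e S (r ++ [:: c; d])
  + q e S (r ++ [:: a; b; c; d]).
Proof.
move=> simp ur rS ab eab cd ecd.
have simp' := simple_add ab simp.
by rewrite -q_nil q_add // !q_add // !q_setD // cats0 addnA.
Qed.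

Definition nb e S v a b c :=
  [/\ v \in S, [&& a \in S, b \in S & c \in S], uniq [:: a; b; c]
    & forall x, x \in S -> e v x = (x \in [:: a; b; c])].

Lemma nb_ex e S v : cubic_on e S -> v \in S -> exists a b c, nb e S v a b c.
Proof.
move=> cub vS; have := cub v vS; rewrite /deg.
set N := [set y in S | e v y] => N3.
have := enum_uniq N; have := mem_enum N; move: N3; rewrite cardE.
case: (enum N) => [|a [|b [|c [|? ?]]]] // _ mE uE; exists a, b, c.
have inN x : x \in [:: a; b; c] -> x \in S by rewrite mE !inE => /andP [].
split=> //; first by rewrite !inN ?inE ?eqxx ?orbT.
by move=> x xS; rewrite mE !inE xS.
Qed.

Lemma nb_rot e S v a b c : nb e S v a b c -> nb e S v b c a.
Proof.
case=> vS /and3P [aS bS cS] u E; split=> //; first by rewrite aS bS cS.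
  move: u; rewrite /= !inE (eq_sym b a) (eq_sym c a).
  by case: (a == b); case: (a == c); case: (b == c).
by move=> x xS; rewrite (E x xS) !inE orbC orbA.
Qed.

Lemma nb_swap e S v a b c : nb e S v a b c -> nb e S v b a c.
Proof.
case=> vS /and3P [aS bS cS] u E; split=> //; first by rewrite aS bS cS.
  move: u; rewrite /= !inE (eq_sym b a).
  by case: (a == b); case: (a == c); case: (b == c).
by move=> x xS; rewrite (E x xS) !inE orbCA.
Qed.

Lemma nb_ex1 e S v a : cubic_on e S -> v \in S -> a \in S -> e v a ->
  exists b c, nb e S v a b c.
Proof.
move=> cub vS aS; have [x [y [z n]]] := nb_ex cub vS.
have [_ _ _ E] := n; rewrite E // !inE => /or3P [] /eqP ->.
- by exists y, z.
- by exists z, x; apply: nb_rot.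
- by exists x, y; do 2!apply: nb_rot.
Qed.

Lemma nb_ex2 e S v a b : cubic_on e S -> v \in S -> a \in S -> b \in S ->
  a != b -> e v a -> e v b -> exists c, nb e S v a b c.
Proof.
move=> cub vS aS bS ab eva evb; have [x [y n]] := nb_ex1 cub vS aS eva.
have [_ _ _ E] := n; move: evb; rewrite E // !inE eq_sym (negbTE ab) /=.
case/orP => /eqP ->; first by exists y.
by exists x; apply: nb_rot; apply: nb_swap.
Qed.

Lemma q_nb e S l v a b c : simple e -> nb e S v a b c -> v \notin l ->
  q e S l = q e S (v :: a :: l) + q e S (v :: b :: l) + q e S (v :: c :: l).
Proof.
move=> simp [vS /and3P [aS bS cS] u E] vl; rewrite (q_rec simp vS vl).
rewrite (eq_bigl (fun u => u \in [:: a; b; c])) => [|x].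
  by rewrite -(big_uniq _ u) /= !big_cons big_nil /= addn0 addnA.
have [xS|xS] := boolP (x \in S); first by rewrite E.
by apply/esym; apply: contraNF xS; rewrite !inE => /or3P [] /eqP ->.
Qed.

(** As [a], [b], [c] are distinct, adjacency becomes a sum of indicators; so the edges lost by
    deleting vertices can be balanced linearly against the new ones. *)
Lemma nb_sum e S v a b c x : nb e S v a b c -> symmetric e -> x \in S ->
  e x v = (x == a) + (x == b) + (x == c) :> nat.
Proof.
case=> _ _ u E esym xS; rewrite esym E // !inE.
have dj y z : y != z -> ~~ ((x == y) && (x == z)).
  by apply: contra => /andP [/eqP <- /eqP <-].
move: u (dj a b) (dj a c) (dj b c); rewrite /= !inE; lia.
Qed.

End Graphs.

(** * Fibonacci numbers and inequalities between the m_n *)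

Lemma fibSS n : fib n.+2 = fib n.+1 + fib n.
Proof. by []. Qed.

Lemma fib_gt0 n : 0 < fib n.+1.
Proof.
suff : 0 < fib n.+1 /\ 0 < fib n.+2 by case.
by elim: n => // n [IH1 IH2]; split=> //; rewrite (fibSS n.+1) addn_gt0 IH2.
Qed.

Lemma fib_add a b : fib (a + b).+1 = fib a.+1 * fib b.+1 + fib a * fib b.
Proof.
suff : fib (a + b).+1 = fib a.+1 * fib b.+1 + fib a * fib b /\
       fib (a + b).+2 = fib a.+2 * fib b.+1 + fib a.+1 * fib b by case.
elim: a => [|a [IH1 IH2]].
  by rewrite -[fib 1]/1 -[fib 2]/1 -[fib 0]/0 add0n fibSS; lia.
rewrite addSn; split; first exact: IH2.
by rewrite fibSS IH2 IH1 !fibSS; lia.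
Qed.

Lemma max_permat_fib n : 6 <= n -> max_permat n = 4 * fib n.-1.
Proof. by case: n => [|[|[|[|[|[|n]]]]]]. Qed.

Lemma max_permatD n : 6 <= n ->
  max_permat n.+2 = max_permat n.+1 + max_permat n.
Proof.
case: n => // n n6; rewrite !max_permat_fib //; try lia.
by rewrite -[n.+1.+2.-1]/n.+2 -[n.+1.+1.-1]/n.+1 fibSS mulnDr.
Qed.

Lemma fib_lt n : 2 <= n -> fib n < fib n.+1.
Proof.
case: n => [|[|n]] // _; rewrite (fibSS n.+1) -[X in X < _]addn0 ltn_add2l.
exact: fib_gt0.
Qed.

Lemma fib_le_double n : fib n.+2 <= 2 * fib n.+1.
Proof. by case: n => // n; rewrite (fibSS n.+1) (fibSS n); lia. Qed.

(** This makes every bound (3/2) m_{n-1} strict; n = 6 is tight, with 39 < 40. *)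
Lemma max_permat_pred n : 6 <= n -> 3 * max_permat n.-1 < 2 * max_permat n.
Proof.
case: n => [|[|[|[|[|[|[|n]]]]]]] // _.
rewrite !max_permat_fib // -[n.+3.+4.-1]/n.+2.+4 -[n.+2.+4.-1]/n.+1.+4.
have := @fib_lt n.+3 isT; rewrite (fibSS n.+4) (fibSS n.+3); lia.
Qed.

(** Needed when a cube without a vertex is contracted to a single vertex. *)
Lemma max_permat_pred3 n : 6 <= n -> 3 * max_permat (n - 3) < max_permat n.
Proof.
case: n => [|[|[|[|[|[|[|[|[|n]]]]]]]]] // _.
rewrite !max_permat_fib; try lia.
rewrite -[n.+1.+4.+4.-1]/n.+4.+4 (_ : (_ - 3).-1 = n.+1.+4); last by lia.
have := fib_gt0 n.+3; rewrite (fibSS n.+2.+4) (fibSS n.+1.+4) (fibSS n.+4); lia.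
Qed.

(* Cubic graphs on six vertices other than K33 have fewer than six perfect matchings. *)
Definition max_permat_noK33 n := if n == 3 then 5 else max_permat n.

(** For the two pieces left when both ends of an edge are deleted. For a, b >= 6 compare 4 f_{a-1}
    f_{b-1} with f_{a+b} = f_{a+1} f_b + f_a f_{b-1}: since consecutive Fibonacci numbers grow by a
    factor of at least 3/2 here, the latter is at least (15/4 + 3/2) f_{a-1} f_{b-1}. *)
Lemma max_permat_mul a b : 2 <= a -> 2 <= b -> 6 <= (a + b).+1 ->
  max_permat_noK33 a * max_permat_noK33 b < max_permat (a + b).+1.
Proof.
wlog: a b / a <= b => [W a2 b2 ab|].
  by case: (leqP a b) => [|/ltnW] H; [|rewrite mulnC addnC]; apply: W => //; lia.
move=> le_ab a2 b2 ab.
rewrite (max_permat_fib ab) /=.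
have [b6|b6] := ltnP 5 b; last first.
  by case: b b2 b6 le_ab ab => [|[|[|[|[|[|b]]]]]] // _ _;
     case: a a2 => [|[|[|[|[|[|a]]]]]].
case: b b2 b6 le_ab ab => // b _ b5 le_ab ab; rewrite addnS fib_add.
rewrite {2}/max_permat_noK33 ifF; last by lia.
rewrite max_permat_fib //=.
case: b b5 le_ab ab => // b b5 le_ab ab.
have gt0 := fib_gt0 b; have gt1 := fib_gt0 b.-1; rewrite prednK in gt1; last by lia.
have F1 := fibSS b.
have F0 : fib b.+1 <= 2 * fib b.
  by case: b b5 {le_ab ab gt0 gt1 F1} => // b _; apply: fib_le_double.
have [a6|a6] := ltnP 5 a; last first.
  move: F0 F1 gt0 gt1 {le_ab ab}.
  move: (fib b.+2) (fib b.+1) (fib b) => x2 x1 x0 F0 F1 gt0 gt1.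
  by case: a a2 a6 => [|[|[|[|[|[|a]]]]]] // _ _; rewrite /max_permat_noK33 /=; lia.
rewrite /max_permat_noK33 ifF; last by lia.
rewrite max_permat_fib //.
case: a a2 a6 {le_ab ab} => // [[|a]] // _ a5.
have gt0' := fib_gt0 a; have gt1' := fib_gt0 a.-1; rewrite prednK in gt1'; last by lia.
have F1' := fibSS a.
have F0' : fib a.+1 <= 2 * fib a.
  by case: a a5 {gt0' gt1' F1'} => // a _; apply: fib_le_double.
rewrite -[a.+2.-1]/a.+1; move: F0 F1 F0' F1' gt0 gt1 gt0' gt1'.
move: (fib b.+2) (fib b.+1) (fib b) (fib a.+2) (fib a.+1) (fib a).
by move=> x2 x1 x0 y2 y1 y0; nia.
Qed.

(** * Expansion at a gadget *)

(* Vertices of a gadget and of its surroundings are numbered by nat, those of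
   the gadget first; rows lists the neighbours of the gadget vertices from i on.
   expand enumerates the ways of covering the gadget that extend the deletion
   of l. *)
Fixpoint expand (rows : seq (seq nat)) (i : nat) (l : seq nat) : seq (seq nat) :=
  match rows with
  | [::] => [:: l]
  | row :: rows' =>
      if i \in l then expand rows' i.+1 l
      else flatten [seq expand rows' i.+1 [:: i, u & l] | u <- row & u \notin l]
  end.

Section Reductions.

Variable T : finType.
Implicit Types (e : rel T) (S C R : {set T}) (r : seq T) (l : seq nat).

Fixpoint rows_nb e S (env : nat -> T) i (rows : seq (seq nat)) : Prop :=
  match rows with
  | [::] => True
  | row :: rows' => match row with
      | [:: a; b; c] => nb e S (env i) (env a) (env b) (env c)
      | _ => False
      end /\ rows_nb e S env i.+1 rows'
  end.

Definition qsum e S (env : nat -> T) (L : seq (seq nat)) :=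
  sumn [seq q e S (map env l) | l <- L].

(** Only gadget vertices must differ from all others. Two outer vertices may coincide: a deletion
    list containing both has [q] equal to 0. *)
Lemma q_expand e S (env : nat -> T) rows i l : simple e ->
  (forall j k, i <= j < i + size rows -> j != k -> env j != env k) ->
  rows_nb e S env i rows -> q e S (map env l) = qsum e S env (expand rows i l).
Proof.
move=> simp; elim: rows i l => [|row rows IH] i l inj /=.
  by rewrite /qsum /= addn0.
have inj' j k : i.+1 <= j < i.+1 + size rows -> j != k -> env j != env k.
  by move=> ji; apply: inj => /=; lia.
have inj_i k : i != k -> env i != env k by apply: inj => /=; lia.
move: {inj} inj_i; case: row => [|a [|b [|c [|? ?]]]] //= inj_i [] // nbi nbs.
case: ifP => il; first exact: IH.
have el : env i \notin map env l.
  apply/mapP => -[k kl eik]; have : i != k by apply: contraFneq il => ->.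
  by move=> /inj_i; rewrite eik eqxx.
have qu u : (if u \notin l then qsum e S env (expand rows i.+1 [:: i, u & l]) else 0)
   = q e S (env i :: env u :: map env l).
  case: ifP => [_|/negbFE ul]; first by rewrite -IH.
  by rewrite /q /= (map_f env ul) /= andbF.
rewrite (q_nb simp nbi el) -!qu /qsum.
by case: (a \in l); case: (b \in l); case: (c \in l);
  rewrite //= ?map_cat ?sumn_cat ?cats0 ?addn0 ?add0n ?addnA.
Qed.

(* The final sorting makes equal deletions syntactically equal. *)
Lemma gadget_expand e S gs t ts rows l : simple e ->
  uniq gs -> all (fun x => x \notin gs) (t :: ts) -> size rows <= size gs ->
  rows_nb e S (nth t (gs ++ ts)) 0 rows ->
  q e S (map (nth t (gs ++ ts)) l) =
  qsum e S (nth t (gs ++ ts)) [seq sort leq l' | l' <- expand rows 0 l].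
Proof.
move=> simp ugs tgs sz nbs; rewrite (q_expand _ simp _ nbs) => [|j k jr jk].
  rewrite /qsum -map_comp; congr sumn; apply: eq_map => l' /=.
  by apply/q_perm/perm_map; rewrite perm_sym perm_sort.
have jgs : j < size gs by apply: leq_trans sz; case/andP: jr.
rewrite nth_cat jgs.
(* A number past the end of the list denotes the default [t], which also lies outside the gadget. *)
have [kgs|kgs] := ltnP k (size (gs ++ ts)); last first.
  rewrite [X in _ != X]nth_default //.
  by apply: contraTneq (mem_nth t jgs) => ->; case/andP: tgs.
rewrite nth_cat; case: ifP => kg; first by rewrite nth_uniq.
have kts : k - size gs < size ts by rewrite size_cat in kgs; lia.
apply: contraTneq (mem_nth t jgs) => ->; case/andP: tgs => _ /allP; apply.
exact: mem_nth.
Qed.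

Definition cubic_graph e S n :=
  [/\ simple e, cubic_on e S, connected_on e S & #|S| = n.*2].

Lemma closed_add a b e S C : a \in S -> b \in S ->
  closed_in (add a b e) S C -> closed_in e S C /\ (a \in C) = (b \in C).
Proof.
move=> aS bS cl; split=> [x y xS yS exy|]; apply: cl => //;
  by rewrite /add ?exy // !eqxx /= orbT.
Qed.

(** Extended by the constant [k] on [R], the set [C] becomes closed in the connected graph on
    [S]. *)
Lemma closed_const e S R C (k : bool) : symmetric e -> R \subset S -> connected_on e S ->
  closed_in e (S :\: R) C ->
  (forall x z, x \in S :\: R -> z \in R -> e x z -> (x \in C) = k) ->
  {in S :\: R &, forall x y, (x \in C) = (y \in C)}.
Proof.
move=> esym RS conn cl kP x y xS yS.
pose C' := [set x | if x \in R then k else x \in C].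
have cl' : closed_in e S C'.
  move=> u v uS vS euv; rewrite !inE.
  case: ifP => uR; case: ifP => vR //.
  - by rewrite (kP v u) // ?inE ?vR // esym.
  - by rewrite (kP u v) // inE uR.
  - by apply: cl; rewrite // inE ?uR ?vR.
have := conn C' cl' x y; move: xS yS; rewrite !inE.
by move=> /andP [/negbTE -> ->] /andP [/negbTE -> ->]; apply.
Qed.

(** Reconnection after deleting [R] preserves connectedness as soon as the new edges force all
    neighbours of [R] onto one side of every cut. *)
Lemma connected_const e S R e' : symmetric e -> R \subset S -> connected_on e S ->
  (forall C, closed_in e' (S :\: R) C ->
     closed_in e (S :\: R) C /\ exists k : bool,
     forall x z, x \in S :\: R -> z \in R -> e x z -> (x \in C) = k) ->
  connected_on e' (S :\: R).
Proof.
move=> esym RS conn H C /H [cl [k kP]] x y xS yS.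
exact: (closed_const esym RS conn cl kP).
Qed.

Lemma cubic_add2 e S r a b c d : simple e -> cubic_on e S -> uniq r -> all (mem S) r ->
  a \in S :\: [set z in r] -> b \in S :\: [set z in r] -> a != b -> ~~ e a b ->
  c \in S :\: [set z in r] -> d \in S :\: [set z in r] -> c != d -> ~~ add a b e c d ->
  (forall x, x \in S :\: [set z in r] ->
     \sum_(z <- r) e x z = (x == a) + (x == b) + (x == c) + (x == d)) ->
  cubic_on (add c d (add a b e)) (S :\: [set z in r]).
Proof.
move=> simp cub ur rS aS bS ab eab cS dS cd ecd sumr x xS.
have simp' := simple_add ab simp.
rewrite (deg_add _ cd ecd simp'.1 cS dS).
rewrite (deg_add _ ab eab simp.1 aS bS).
have xS' : x \in S by move: xS; rewrite inE => /andP [].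
have {}cub := cub x xS'; rewrite (deg_setD e x ur rS) (sumr x xS) in cub.
by rewrite -cub -?addnA.
Qed.

Lemma card_setD_seq S r : uniq r -> all (mem S) r ->
  #|S :\: [set z in r]| = #|S| - size r.
Proof.
move=> ur rS; rewrite -(card_uniqP ur) cardsD; congr (_ - _).
apply: eq_card => x; rewrite !inE; apply: andb_idl => xr.
exact: (allP rS).
Qed.

End Reductions.

(** Evaluates the enumeration in an instance of [gadget_expand], leaving an explicit sum of [q]
    terms; several such sums are then compared by linear arithmetic. *)
Ltac expand_gadget E :=
  rewrite /qsum in E;
  match type of E with context [expand ?a ?b ?c] =>
    let L := eval vm_compute in [seq sort leq l' | l' <- expand a b c] in
    change [seq sort leq l' | l' <- expand a b c] with L in E end;
  rewrite /= ?addn0 in E.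

(** * Enumeration of small cubic graphs *)

Notation row rows a := (nth [::] rows a).

Fixpoint combs k (s : seq nat) : seq (seq nat) :=
  match k, s with
  | 0, _ => [:: [::]]
  | _.+1, [::] => [::]
  | k'.+1, x :: s' => [seq x :: t | t <- combs k' s'] ++ combs k s'
  end.

Lemma combsP t s : subseq t s -> t \in combs (size t) s.
Proof.
elim: s t => [|x s IH] [|y t] //= .
case: eqP => [->|_] sub; rewrite mem_cat.
  by apply/orP; left; apply/mapP; exists t; rewrite ?IH.
by rewrite (IH _ sub) orbT.
Qed.

(* The graph on nat with adjacency lists rows, restricted to s. *)
Fixpoint count_pm (rows : seq (seq nat)) fuel (s : seq nat) : nat :=
  if s is v :: s' then
    if fuel is f.+1 then
      sumn [seq count_pm rows f (rem u s') | u <- s' & u \in row rows v]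
    else 0
  else 1.

(** Backtracking: [pi] lists the images of the vertices 0, 1, ... of [hrows] chosen so far. The
    recursive call sits under [if] because call-by-value evaluation of [&&] would not prune. *)
Fixpoint iso_search (hrows rows : seq (seq nat)) N fuel (pi : seq nat) : bool :=
  if size pi == N then true else
  if fuel is f.+1 then
    has (fun c => if
           (c \notin pi) && all (fun a => ((size pi \in row hrows a) == (c \in row rows (nth 0 pi a)))
                      && ((a \in row hrows (size pi)) == (nth 0 pi a \in row rows c)))
             (iota 0 (size pi))
         then iso_search hrows rows N f (rcons pi c) else false) (iota 0 N)
  else false.

Definition no_triangle_at (rows : seq (seq nat)) i :=
  all (fun a => all (fun b => b \notin row rows a) (row rows i)) (row rows i).

Definition in_C4_at (rows : seq (seq nat)) v :=
  all (fun p => p < size rows) (row rows v) ==>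
  has (fun p => has (fun p' => (p != p') &&
    has (fun w => (w != v) && (w \in row rows p')) (row rows p))
    (row rows v)) (row rows v).

(* Pruning test after the treatment of the last row: no triangle, and every
   vertex with completely known surroundings lies on a 4-cycle. *)
Definition good_rows (rows : seq (seq nat)) :=
  let i := (size rows).-1 in
  no_triangle_at rows i && all (fun v => (v < size rows) ==> in_C4_at rows v) (i :: row rows i).

(* Breadth-first generation of all connected cubic graphs on N vertices: the
   vertices 0, ..., m - 1 are known, rows lists the neighbours of the first ones. *)
Fixpoint search (prune : bool) (leaf : seq (seq nat) -> bool) N fuel rows m : bool :=
  let i := size rows in
  if (if prune then ~~ good_rows rows else false) then true
  (* All known vertices have been treated. If there are fewer than [N] of them, they form a
     component and no connected graph on [N] vertices arises. *)
  else if i == m then if m == N then leaf rows else true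
  else if fuel is f.+1 then
    let known := [seq a <- iota 0 i | i \in row rows a] in
    let open := [seq j <- iota i.+1 (m - i.+1) |
                 count (fun r => j \in r) rows < 3] in
    (* Vertex [i] keeps its [known] neighbours, takes [k] of the later vertices that are not yet
       saturated, and its [r] other neighbours are new. *)
    all (fun k => let r := 3 - size known - k in
      if m + r <= N then
        all (fun D => search prune leaf N f
               (rcons rows (known ++ D ++ iota m r)) (m + r)) (combs k open)
      else true) (iota 0 (4 - size known))
  else false.

Definition rows_of (h : nat -> nat -> bool) N :=
  [seq [seq b <- iota 0 N | h a b] | a <- iota 0 N].

Definition K4_rows := rows_of (fun a b => a != b) 4.
Definition K33_rows := rows_of (fun a b => (a < 3) != (b < 3)) 6.
Definition K44_rows := rows_of (fun a b => ((a < 4) != (b < 4)) && (a %% 4 != b %% 4)) 8.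
Definition mobius_rows := rows_of (fun a b =>
  [|| b == a.+1 %% 10, b == (a + 5) %% 10, a == b.+1 %% 10 | a == (b + 5) %% 10]) 10.
Definition circular_rows := rows_of (fun a b =>
  if (a < 6) == (b < 6) then (b %% 6 == (a %% 6).+1 %% 6) || (a %% 6 == (b %% 6).+1 %% 6)
  else a %% 6 == b %% 6) 12.
(* In L_6 the ends are 0..3 and 8..11, and p_1, q_1, p_2, q_2 are 4, 5, 6, 7. *)
Definition ladder6_rows := rows_of (fun a b =>
  let arc a b :=
    if (a < 4) && (b < 4) || (7 < a) && (7 < b) then b %% 4 == (a %% 4).+1 %% 4
    else if (3 < b) && (b < 6) then (a < 4) && (odd a == odd b)
    else if (5 < a) && (a < 8) then (7 < b) && (odd a == odd b)
    else (3 < a) && (a < 6) && (b == a + 2) in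
  arc a b || arc b a) 12.

(** The last conjunct says that at most [x] perfect matchings avoid a given edge. With x = 2 f_n
    this is the extra information that [end_numeric] requires for small pieces. *)
Definition leaf_small n hrows x (rows : seq (seq nat)) :=
  let N := n.*2 in
  let p := count_pm rows N (iota 0 N) in
  [&& p <= max_permat n, (if p == max_permat n then iso_search hrows rows N N [::] else true)
    & all (fun a => all (fun b =>
        p <= x + count_pm rows N (rem b (rem a (iota 0 N)))) (row rows a)) (iota 0 N)].

Definition leaf_C4 n (rows : seq (seq nat)) :=
  let N := n.*2 in
  let p := count_pm rows N (iota 0 N) in
  if p < max_permat n then true else if (n == 6) && (p == max_permat 6) then
    if iso_search circular_rows rows N N [::] then true
    else iso_search ladder6_rows rows N N [::]
  else false.

Definition search_small n hrows x :=
  search false (leaf_small n hrows x) n.*2 n.*2 [::] 1.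

(* Starts from the 4-cycle 0, 1, 4, 2. *)
Definition search_C4 n :=
  search true (leaf_C4 n) n.*2 n.*2 [:: [:: 1; 2; 3]; [:: 0; 4; 5]] 6.

Lemma search2 : search_small 2 K4_rows (2 * fib 2).
Proof. by vm_compute. Qed.

Lemma search3 : search_small 3 K33_rows (2 * fib 3).
Proof. by vm_compute. Qed.

Lemma search4 : search_small 4 K44_rows (2 * fib 4).
Proof. by vm_compute. Qed.

Lemma search5 : search_small 5 mobius_rows (2 * fib 5).
Proof. by vm_compute. Qed.

Lemma search_C4_6 : search_C4 6.
Proof. by vm_compute. Qed.

Lemma search_C4_7 : search_C4 7.
Proof. by vm_compute. Qed.

(** * Soundness of the enumeration *)

Section SearchSound.

Variables (T : finType) (e : rel T) (S : {set T}) (x0 : T).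
Hypotheses (simp : simple e).
Implicit Types (l : seq T) (rows : seq (seq nat)).

Definition triangle_free :=
  forall x y z, x \in S -> y \in S -> z \in S -> e x y -> e x z -> ~~ e y z.

Definition in_C4 v := exists x y w,
  [/\ x \in S, y \in S & w \in S] /\
  [/\ x != y, w != v, e v x, e v y & e x w && e y w].

(** The invariant of the search: [l] gives the vertices of the actual graph behind the numbers, and
    each row is a full neighbourhood. *)
Definition labelled l rows :=
  [/\ uniq l, all (mem S) l, size rows <= size l &
   forall a, a < size rows -> [/\ uniq (row rows a), all (fun b => b < size l) (row rows a)
     & forall x, x \in S -> e (nth x0 l a) x = (x \in map (nth x0 l) (row rows a))]].

Lemma labelled_mem l rows a : labelled l rows -> a < size l -> nth x0 l a \in S.
Proof. by case=> _ /allP lS _ _ al; apply/lS/mem_nth. Qed.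

Lemma labelled_edge l rows a b : labelled l rows -> a < size rows -> b < size l ->
  e (nth x0 l a) (nth x0 l b) = (b \in row rows a).
Proof.
move=> lab ar bl; have [ul lS sz H] := lab; have [u bnd E] := H a ar.
rewrite E ?(labelled_mem lab) //; apply/mapP/idP => [[b' b'r /eqP]|br]; last by exists b.
by rewrite nth_uniq // ?(allP bnd) // => /eqP ->.
Qed.

Lemma good_rows_labelled l rows : triangle_free -> {in S, forall v, in_C4 v} ->
  labelled l rows -> 0 < size rows -> good_rows rows.
Proof.
move=> tri C4 lab r0; have [ul lS sz H] := lab; have [esym eirr] := simp.
have lti : (size rows).-1 < size rows by lia.
apply/andP; split.
  apply/allP => a ai; apply/allP => b bi; apply/negP => ba.
  have [ar|ar] := ltnP a (size rows); last by rewrite nth_default in ba.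
  have [_ /allP bnd _] := H _ lti.
  have al := bnd _ ai; have bl := bnd _ bi.
  have il := leq_trans lti sz.
  have := tri (nth x0 l (size rows).-1) (nth x0 l a) (nth x0 l b).
  by rewrite !(labelled_mem lab) ?(labelled_edge lab) // ai bi ba => /(_ isT isT isT isT isT).
apply/allP => v _; apply/implyP => vr; apply/implyP => /allP nbr.
have [_ /allP bnd E] := H _ vr; have vl := leq_trans vr sz.
have [x [y [w [[xS yS wS] [xy wv evx evy /andP [exw eyw]]]]]] := C4 _ (labelled_mem lab vl).
have [p pr xE] : exists2 p, p \in row rows v & x = nth x0 l p.
  by apply/mapP; rewrite -E.
have [p' p'r yE] : exists2 p, p \in row rows v & y = nth x0 l p.
  by apply/mapP; rewrite -E.
have pR := nbr _ pr; have p'R := nbr _ p'r.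
have [_ /allP bndp Ep] := H _ pR.
have [w' w'r wE] : exists2 p', p' \in row rows p & w = nth x0 l p'.
  by apply/mapP; rewrite -Ep // -xE.
apply/hasP; exists p => //; apply/hasP; exists p' => //.
apply/andP; split; first by apply: contraNneq xy => pp; rewrite xE yE pp.
apply/hasP; exists w' => //; rewrite -(labelled_edge lab) ?bndp // -wE -yE eyw andbT.
by apply: contraNneq wv => wv; rewrite wE wv.
Qed.

Hypotheses (cub : cubic_on e S) (conn : connected_on e S).

(** [W] collects the neighbours of vertex [i] not met before, and [D] those met but numbered after
    [i]. The order within [W] is arbitrary, since the search does not distinguish new vertices. *)
Lemma labelled_step l rows (i := size rows) :
  labelled l rows -> i < size l ->
  let known := [seq a <- iota 0 i | i \in row rows a] in
  let open := [seq j <- iota i.+1 (size l - i.+1) |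
                 count (fun r => j \in r) rows < 3] in
  exists W D, [/\ labelled (l ++ W) (rcons rows (known ++ D ++ iota (size l) (size W))),
    subseq D open & size known + size D + size W = 3].
Proof.
move=> lab il known open; have [ul lS sz H] := lab; have [esym eirr] := simp.
set v := nth x0 l i; have vS : v \in S := labelled_mem lab il.
pose W := enum [set x in S | e v x & x \notin l].
pose D := [seq j <- iota i.+1 (size l - i.+1) | e v (nth x0 l j)].
have known_lt a : a \in known -> a < i by rewrite mem_filter mem_iota; lia.
have known_e a : a < i -> (a \in known) = e v (nth x0 l a).
  by move=> ai; rewrite mem_filter mem_iota add0n ai !andbT esym (labelled_edge lab).
have D_lt a : a \in D -> i < a < size l by rewrite mem_filter mem_iota; lia.
have uW : uniq (l ++ W).
  rewrite cat_uniq ul enum_uniq andbT /=; apply/hasPn => x.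
  by rewrite mem_enum inE => /and3P [].
have WS : all (mem S) (l ++ W).
  rewrite all_cat lS /=; apply/allP => x; rewrite mem_enum inE => /and3P [xS _ _].
  exact: xS.
have nthW a : a < size l -> nth x0 (l ++ W) a = nth x0 l a.
  by move=> al; rewrite nth_cat al.
set r := known ++ D ++ iota (size l) (size W).
have ur : uniq r.
  rewrite !cat_uniq !filter_uniq ?iota_uniq //= andbT; apply/andP; split.
    apply/hasPn => a; rewrite mem_cat => /orP [/D_lt|]; rewrite ?mem_iota => ai;
      apply/negP => /known_lt; lia.
  by apply/hasPn => a; rewrite mem_iota => ai; apply/negP => /D_lt; lia.
have r_lt : all (fun b => b < size (l ++ W)) r.
  apply/allP => a; rewrite !mem_cat size_cat => /or3P [/known_lt|/D_lt|]; first lia.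
    by lia.
  by rewrite mem_iota; lia.
have rE x : x \in S -> e v x = (x \in map (nth x0 (l ++ W)) r).
  move=> xS; apply/idP/mapP => [evx|[a + ->]].
    have [xl|xl] := boolP (x \in l); last first.
      have xW : x \in W by rewrite mem_enum inE xS evx xl.
      exists (size l + index x W); last first.
        by rewrite nth_cat ltnNge leq_addr /= addKn nth_index.
      by rewrite !mem_cat mem_iota leq_addr ltn_add2l index_mem xW !orbT.
    have jl : index x l < size l by rewrite index_mem.
    have xE := nth_index x0 xl.
    exists (index x l); last by rewrite nthW.
    rewrite !mem_cat; have [ji|ij|ji] := ltngtP (index x l) i.
    - by rewrite known_e // xE evx.
    - by rewrite (_ : _ \in D) ?orbT // mem_filter xE evx mem_iota ij subnKC.
    - by move: evx; rewrite -xE ji eirr.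
  rewrite !mem_cat => /or3P [ak|aD|].
  - have ai := known_lt _ ak; rewrite nthW -?known_e //; exact: ltn_trans ai il.
  - by have := D_lt _ aD; move: aD; rewrite mem_filter => /andP [eva _] /andP [_ al]; rewrite nthW.
  rewrite mem_iota => /andP [la aW]; rewrite nth_cat ltnNge la /=.
  have : nth x0 W (a - size l) \in W by apply: mem_nth; rewrite ltn_subLR.
  by rewrite mem_enum inE => /and3P [].
have sz3 : size r = 3.
  rewrite -(cub vS) -(size_map (nth x0 (l ++ W))) -(card_uniqP _); last first.
    rewrite map_inj_in_uniq // => a b ar br /eqP.
    by rewrite nth_uniq ?(allP r_lt) // => /eqP.
  apply: eq_card => x; rewrite inE; have [xS|xS] := boolP (x \in S); first by rewrite rE.
  apply: contraNF xS => /mapP [a ar ->]; apply: (allP WS); apply: mem_nth.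
  exact: (allP r_lt).
exists W, D; split; last by rewrite -sz3 !size_cat size_iota addnA.
- split=> //; first by rewrite size_rcons size_cat; lia.
  move=> a; rewrite size_rcons ltnS leq_eqVlt => /orP [/eqP ->|ai].
    rewrite nth_rcons ltnn eqxx; split=> // x xS.
    by rewrite nthW // rE.
  rewrite nth_rcons ai; have [u bnd E] := H a ai; split=> //.
    by apply: sub_all bnd => b bl; rewrite size_cat ltn_addr.
  move=> x xS; rewrite nthW ?(leq_trans ai) // E //; congr (_ \in _).
  by apply/eq_in_map => b /(allP bnd) bl; rewrite nthW.
rewrite (_ : D = [seq j <- open | e v (nth x0 l j)]) ?filter_subseq //.
rewrite /open -filter_predI; apply: eq_in_filter => j; rewrite mem_iota => ji /=.
symmetry; apply: andb_idr => evj; rewrite ltnNge; apply/negP => c3.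
have jl : j < size l by move: ji; rewrite subnKC // => /andP [].
have jS := labelled_mem lab jl.
(* Three treated neighbours together with the current vertex would give [j] degree at least 4. *)
pose s := [seq a <- iota 0 i | j \in row rows a].
have szs : size s = count (fun r => j \in r) rows.
  rewrite size_filter -[in RHS](mkseq_nth [::] rows) /mkseq count_map.
  by apply: eq_count.
have s_lt a : a \in s -> a < i by rewrite mem_filter mem_iota => /andP [_ /andP []].
have us : uniq (map (nth x0 l) (rcons s i)).
  rewrite map_inj_in_uniq.
    by rewrite rcons_uniq filter_uniq ?iota_uniq // andbT; apply/negP => /s_lt; rewrite ltnn.
  have lt a : a \in rcons s i -> a < size l.
    by rewrite mem_rcons inE => /orP [/eqP -> //|/s_lt ai]; apply: ltn_trans il.
  by move=> a b /lt al /lt bl /eqP; rewrite nth_uniq // => /eqP.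
have : size (map (nth x0 l) (rcons s i)) <= deg e S (nth x0 l j).
  rewrite /deg -(card_uniqP us); apply/subset_leq_card/subsetP => x.
  case/mapP => a; rewrite mem_rcons inE => /orP [/eqP -> ->|]; first by rewrite inE vS esym.
  move=> asx ->; have ai := s_lt _ asx.
  rewrite inE esym (labelled_edge lab) // (labelled_mem lab) ?(ltn_trans ai) //.
  by move: asx; rewrite mem_filter => /andP [].
by rewrite cub // size_map size_rcons szs ltnNge c3.
Qed.

Lemma labelled_full l rows : labelled l rows -> 0 < size l -> size rows = size l ->
  size l = #|S|.
Proof.
move=> lab l0 szE; have [ul lS sz H] := lab.
have cl x y : x \in S -> y \in S -> e x y -> x \in l -> y \in l.
  move=> xS yS exy xl; have xr : index x l < size rows by rewrite szE index_mem.
  have [_ bnd E] := H _ xr; move: exy; rewrite -(nth_index x0 xl) E //.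
  by case/mapP => b /(allP bnd) bl ->; apply: mem_nth.
have clS : closed_in e S [set x in l].
  move=> x y xS yS exy; rewrite !inE; apply/idP/idP; apply: cl => //.
  by rewrite simp.1.
rewrite -(card_uniqP ul); apply: eq_card => x; apply/idP/idP => [|xS].
  exact: (allP lS).
have x0l : nth x0 l 0 \in l by apply: mem_nth.
by have := conn clS xS (allP lS _ x0l); rewrite !inE x0l.
Qed.

(** The given graph selects a branch of the search at every step through [labelled_step]; that
    branch is never pruned and ends in a leaf where the whole graph is labelled. *)
Lemma search_sound (prune : bool) leaf fuel l rows :
  (prune -> forall l' rows', labelled l' rows' -> 0 < size rows' -> good_rows rows') ->
  0 < size l -> (prune -> 0 < size rows) ->
  labelled l rows -> search prune leaf #|S| fuel rows (size l) ->
  exists l' rows', [/\ labelled l' rows', size rows' = #|S|, size l' = #|S| & leaf rows'].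
Proof.
move=> Hp; elim: fuel l rows => [|fuel IH] l rows l0 pr lab.
all: rewrite [search _ _ _ _ _ _]/=.
all: have -> : (if prune then ~~ good_rows rows else false) = false
  by clear -Hp pr lab; case: prune Hp pr => // Hp pr; rewrite (Hp isT _ _ lab (pr isT)).
  case: eqP => // szE; have szS := labelled_full lab l0 szE.
  by rewrite szS eqxx => lf; exists l, rows; rewrite szE szS.
case: eqP => [szE|/eqP szN].
  have szS := labelled_full lab l0 szE.
  by rewrite szS eqxx => lf; exists l, rows; rewrite szE szS.
have [ul lS sz H] := lab.
have il : size rows < size l by rewrite ltn_neqAle szN.
have [W [D [lab' subD sz3]]] := labelled_step lab il.
have Dk : size D \in iota 0 (4 - size [seq a <- iota 0 (size rows) | size rows \in row rows a]).
  by rewrite mem_iota; lia.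
move=> /allP /(_ _ Dk); have -> : 3 - size [seq a <- iota 0 (size rows) | size rows \in row rows a]
  - size D = size W by lia.
rewrite -size_cat ifT; last first.
  have [ulW lWS _ _] := lab'; rewrite -(card_uniqP ulW); apply: subset_leq_card.
  by apply/subsetP => x; apply: (allP lWS).
move=> /allP /(_ _ (combsP subD)); apply: IH => //.
  by rewrite size_cat; lia.
by rewrite size_rcons.
Qed.

Lemma pm_labelled l rows s fuel : labelled l rows -> size rows = size l ->
  uniq s -> all (fun a => a < size l) s -> size s <= fuel ->
  pm e [set x in map (nth x0 l) s] = count_pm rows fuel s.
Proof.
move=> lab szE; have [ul lS _ H] := lab.
elim: fuel s => [|fuel IH] [|v s] us sl szs //.
- by rewrite /= -(pm_set0 e); congr pm; apply/setP => x; rewrite !inE.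
- by rewrite /= -(pm_set0 e); congr pm; apply/setP => x; rewrite !inE.
rewrite /=; set f := nth x0 l.
have vin : f v \in [set x in map f (v :: s)] by rewrite !inE eqxx.
have finj : {in gtn (size l) &, injective f}.
  by move=> a b al bl /eqP; rewrite nth_uniq // => /eqP.
have [vs us'] : v \notin s /\ uniq s by case/andP: us.
have [vl sl'] : v < size l /\ all (fun a => a < size l) s by case/andP: sl.
have memf a t : all (fun a => a < size l) t -> a < size l -> (f a \in map f t) = (a \in t).
  move=> tl al; apply/mapP/idP => [[b bt /finj E]|]; last by exists a.
  by rewrite E // inE // (allP tl).
rewrite (pm_rec simp vin) sumnE big_map big_filter.
rewrite (eq_bigl (fun x => (x \in map f s) && e (f v) x)); last first.
  move=> x; rewrite !inE; have [->|//] := eqVneq x (f v).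
  by rewrite simp.2 !andbF.
have uf : uniq (map f s).
  rewrite map_inj_in_uniq // => a b as_ bs; apply: finj; rewrite inE.
    exact: (allP sl').
  exact: (allP sl').
rewrite big_mkcondr /= -(big_uniq _ uf) big_map -big_mkcond /=.
rewrite [LHS]big_seq_cond [RHS]big_seq_cond; apply: eq_big => u.
  apply: andb_id2l => us2; have [_ _ E] := H _ (leq_trans vl (eq_leq (esym szE))).
  by rewrite (labelled_edge lab) ?szE //; apply: (allP sl').
case/andP => us2 evu; rewrite -IH.
- congr pm; apply/setP => x; rewrite !inE.
  apply/idP/mapP => [/and3P [xu xv /orP [/eqP xE|]]|].
  - by rewrite xE eqxx in xv.
  - case/mapP => a as_ xE; exists a => //; rewrite mem_rem_uniq // inE as_ andbT.
    by apply: contraNneq xu => <-; apply/eqP.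
  case=> a; rewrite mem_rem_uniq // inE => /andP [au as_] ->.
  have al := allP sl' _ as_; have ul' := allP sl' _ us2.
  rewrite (map_f f as_) orbT andbT; apply/andP; split.
    by apply: contraNneq au => /finj ->.
  by apply: contraNneq vs => /finj <-.
- exact: rem_uniq.
- by apply/allP => a /mem_rem; apply: (allP sl').
by rewrite size_rem // (leq_trans (leq_pred _)).
Qed.

End SearchSound.

Lemma pm_imset (T T' : finType) (e : rel T) (e' : rel T') (f : T' -> T) (A : {set T'}) :
  simple e -> simple e' -> injective f -> (forall x y, e (f x) (f y) = e' x y) ->
  pm e (f @: A) = pm e' A.
Proof.
move=> simp simp' inj ef; have [m] := ubnP #|A|; elim: m A => // m IH A lt_m.
have [->|[v vA]] := set_0Vmem A; first by rewrite imset0 !pm_set0.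
have fvA : f v \in f @: A by apply: imset_f.
rewrite (pm_rec simp fvA) (pm_rec simp' vA).
rewrite (eq_bigl (fun u => u \in f @: [set u in A | e' v u])); last first.
  move=> u; apply/andP/imsetP => [[/imsetP [w wA ->]]|[w]].
    by rewrite ef => evw; exists w; rewrite // inE wA.
  by rewrite inE => /andP [wA evw] ->; rewrite ef imset_f.
rewrite big_imset => [|x y _ _ /inj] //=; apply: eq_big => [u|u]; first by rewrite inE.
rewrite inE => /andP [uA evu]; rewrite -IH; last by rewrite (cardsD2 simp' vA uA evu) in lt_m; lia.
congr pm; apply/setP => x; rewrite !inE.
apply/idP/imsetP => [/and3P [xu xv /imsetP [w wA xw]]|[w]].
  exists w; rewrite // !inE wA andbT; apply/andP.
  by split; [apply: contraNneq xu | apply: contraNneq xv]; rewrite xw => ->.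
rewrite !inE => /and3P [wu wv wA] ->; rewrite imset_f // andbT.
by apply/andP; split; rewrite (inj_eq inj).
Qed.

Section Extremal.

Variable T : finType.
Implicit Types (e : rel T) (S : {set T}).

Definition iso_onto e S (H : sgraph) := exists f : H -> T,
  [/\ injective f, S = [set f x | x in H] & forall x y, e (f x) (f y) = edge x y].

Definition ext e S n := exists2 H, extremal n H & iso_onto e S H.

End Extremal.

(** * Adjacency lists of the extremal graphs *)

Definition coded (H : sgraph) hrows N := exists lab : H -> nat,
  [/\ injective lab, forall x, lab x < N, #|H| = N
    & forall x y, edge x y = (lab y \in row hrows (lab x))].

Lemma coded_K4 : coded K4 K4_rows 4.
Proof.
exists (@nat_of_ord 4); split=> //; [exact: val_inj | by rewrite card_ord |].
by move=> [[|[|[|[|x]]]] ?] [[|[|[|[|y]]]] ?].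
Qed.

Lemma bool_ord_lab k : injective (fun x : bool * 'I_k => x.1 * k + x.2).
Proof.
move=> [a i] [b j] /=; have := ltn_ord i; have := ltn_ord j => jk ik.
case: a b => [] [] /=; rewrite ?mul0n ?mul1n ?add0n.
- by move/addnI/val_inj => ->.
- by move=> H; move: jk; rewrite -H ltnNge leq_addr.
- by move=> H; move: ik; rewrite H ltnNge leq_addr.
- by move/val_inj => ->.
Qed.

Lemma bool_ord_lt k (x : bool * 'I_k) : x.1 * k + x.2 < k.*2.
Proof. by case: x => [[] i] /=; have := ltn_ord i; lia. Qed.

Lemma card_bool_ord k : #|{: bool * 'I_k}| = k.*2.
Proof. by rewrite card_prod card_bool card_ord mul2n. Qed.

Lemma coded_K33 : coded K33 K33_rows 6.
Proof.
exists (fun x : bool * 'I_3 => x.1 * 3 + x.2); split.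
- exact: (@bool_ord_lab 3).
- exact: (@bool_ord_lt 3).
- exact: (card_bool_ord 3).
by move=> [[] [[|[|[|x]]] ?]] [[] [[|[|[|y]]] ?]].
Qed.

Lemma coded_K44 : coded K44_minus_matching K44_rows 8.
Proof.
exists (fun x : bool * 'I_4 => x.1 * 4 + x.2); split.
- exact: (@bool_ord_lab 4).
- exact: (@bool_ord_lt 4).
- exact: (card_bool_ord 4).
by move=> [[] [[|[|[|[|x]]]] ?]] [[] [[|[|[|[|y]]]] ?]].
Qed.

Lemma coded_mobius : coded mobius_ladder10 mobius_rows 10.
Proof.
exists (@nat_of_ord 10); split=> //; [exact: val_inj | by rewrite card_ord |].
by move=> [[|[|[|[|[|[|[|[|[|[|x]]]]]]]]]] ?] [[|[|[|[|[|[|[|[|[|[|y]]]]]]]]]] ?].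
Qed.

Lemma coded_circular : coded circular_ladder12 circular_rows 12.
Proof.
exists (fun x : bool * 'I_6 => x.1 * 6 + x.2); split.
- exact: (@bool_ord_lab 6).
- exact: (@bool_ord_lt 6).
- exact: (card_bool_ord 6).
by move=> [[] [[|[|[|[|[|[|x]]]]]] ?]] [[] [[|[|[|[|[|[|y]]]]]] ?]].
Qed.

Lemma coded_ladder6 : coded (ladderK33 6) ladder6_rows 12.
Proof.
exists (fun x : ladderK33_vertex 6 => match x with
  | inl (s, i) => 4 + 2 * i + s
  | inr (s, k) => s * 8 + k
  end); split.
- case=> [[s [i ilt]]|[s [i ilt]]] [[t [j jlt]]|[t [j jlt]]] /= E.
  + have [st ij] : s = t /\ i = j by move: E; case: s; case: t => /=; lia.
    by rewrite st; have -> : Ordinal ilt = Ordinal jlt by apply: val_inj.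
  + by move: E; move: ilt jlt => /=; case: s; case: t => /=; lia.
  + by move: E; move: ilt jlt => /=; case: s; case: t => /=; lia.
  + have [st ij] : s = t /\ i = j by move: E; case: s; case: t => /=; lia.
    by rewrite st; have -> : Ordinal ilt = Ordinal jlt by apply: val_inj.
- by case=> [[[] [i ilt]]|[[] [i ilt]]] /=; move: ilt => /=; lia.
- by rewrite card_sum !card_bool_ord.
by move=> [[[] [[|[|x]] ?]]|[[] [[|[|[|[|x]]]] ?]]] [[[] [[|[|y]] ?]]|[[] [[|[|[|[|y]]]] ?]]].
Qed.

(** * From successful searches to statements about graphs *)

Section Base.

Variable T : finType.
Implicit Types (e : rel T) (S : {set T}).

Lemma iso_search_sound hrows rows N fuel pi :
  (forall a, a \notin row hrows a) -> (forall a, a \notin row rows a) ->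
  iso_search hrows rows N fuel pi -> uniq pi -> all (fun c => c < N) pi ->
  (forall a b, a < size pi -> b < size pi ->
    (b \in row hrows a) = (nth 0 pi b \in row rows (nth 0 pi a))) ->
  exists pi', [/\ size pi' = N, uniq pi', all (fun c => c < N) pi' &
    forall a b, a < N -> b < N ->
    (b \in row hrows a) = (nth 0 pi' b \in row rows (nth 0 pi' a))].
Proof.
move=> irrh irr; elim: fuel pi => [|fuel IH] pi /=.
  by case: eqP => // szN _ u lt H; exists pi; split=> // a b; rewrite -szN; apply: H.
case: eqP => [szN _ u lt H|_]; first by exists pi; split=> // a b; rewrite -szN; apply: H.
case/hasP => c; rewrite mem_iota add0n => /andP [_ cN].
case: ifP => // /andP [cpi /allP ok] rec u lt H.
apply: IH rec _ _ _; rewrite ?rcons_uniq ?cpi // ?all_rcons ?cN //.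
have {}ok a : a < size pi ->
    (size pi \in row hrows a) = (c \in row rows (nth 0 pi a)) /\
    (a \in row hrows (size pi)) = (nth 0 pi a \in row rows c).
  by move=> al; have := ok a; rewrite mem_iota add0n al => /(_ isT) /andP [/eqP -> /eqP ->].
move=> a b; rewrite size_rcons !ltnS !nth_rcons (leq_eqVlt a) (leq_eqVlt b).
have [->|_] := eqVneq a (size pi); have [->|_] := eqVneq b (size pi);
  rewrite ?ltnn ?eqxx //=.
- by rewrite (negbTE (irrh _)) (negbTE (irr _)).
- by move=> _ bl; rewrite bl (ok b bl).2.
- by move=> al _; rewrite al (ok a al).1.
by move=> al bl; rewrite al bl H.
Qed.

Lemma coded_iso e S x0 l rows (H : sgraph) hrows N : simple e ->
  (forall a, a \notin row hrows a) -> coded H hrows N ->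
  labelled e S x0 l rows -> size rows = #|S| -> size l = #|S| -> #|S| = N ->
  iso_search hrows rows N N [::] -> iso_onto e S H.
Proof.
move=> simp irrh [lab [labI labN HN edgeE]] labl szr szl SN.
have [ul lS _ _] := labl.
have irr a : a \notin row rows a.
  have [ar|ar] := ltnP a (size rows); last by rewrite nth_default.
  by rewrite -(labelled_edge labl) ?simp.2 // szl -szr.
move=> /(iso_search_sound irrh irr) [] // pi [szpi upi piN piE].
have nthpi a : a < N -> nth 0 pi a < N by move=> aN; apply: (allP piN); rewrite mem_nth ?szpi.
pose f x := nth x0 l (nth 0 pi (lab x)).
have fI : injective f.
  move=> x y /eqP; rewrite nth_uniq ?szl ?SN ?nthpi // nth_uniq ?szpi //.
  by move=> /eqP /labI.
exists f; split=> //.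
  apply/esym/eqP; rewrite eqEcard card_imset // HN SN leqnn andbT.
  apply/subsetP => _ /imsetP [x _ ->]; apply: (allP lS); apply: mem_nth.
  by rewrite szl SN nthpi.
by move=> x y; rewrite (labelled_edge labl) ?szr ?szl ?SN ?nthpi // edgeE piE.
Qed.

Lemma pm_coded (H : sgraph) hrows N : coded H hrows N -> size hrows = N ->
  all (fun r => uniq r && all (fun b => b < N) r) hrows ->
  pm edge [set: H] = count_pm hrows N (iota 0 N).
Proof.
case=> lab [labI labN HN edgeE] szh ok.
have simp : simple (@edge H) by split; [exact: edge_sym | exact: edge_irr].
have [N0|N0] := posnP N.
  have -> : [set: H] = set0 by apply/eqP; rewrite -cards_eq0 cardsT HN N0.
  by rewrite pm_set0 N0.
have [x0 _] : exists x : H, x \in H by apply/card_gt0P; rewrite HN.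
pose g a := odflt x0 [pick x | lab x == a].
have labS : map lab (enum H) =i iota 0 N.
  have u : uniq (map lab (enum H)) by rewrite map_inj_uniq ?enum_uniq.
  have sub : {subset map lab (enum H) <= iota 0 N}.
    by move=> _ /mapP [x _ ->]; rewrite mem_iota add0n labN.
  by apply: (uniq_min_size u sub _).2; rewrite size_map size_iota -cardE HN.
have gK a : a < N -> lab (g a) = a.
  move=> aN; rewrite /g; case: pickP => [x /eqP //|no].
  have : a \in map lab (enum H) by rewrite labS mem_iota add0n.
  by case/mapP => x _ aE; have := no x; rewrite aE eqxx.
have gE x : g (lab x) = x by apply: labI; apply: gK.
pose l := map g (iota 0 N).
have nl a : a < N -> nth x0 l a = g a.
  by move=> aN; rewrite (nth_map 0) ?size_iota // nth_iota ?add0n.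
have szl : size l = N by rewrite size_map size_iota.
have labl : labelled edge [set: H] x0 l hrows.
  split; rewrite ?szl ?szh //.
  - rewrite map_inj_in_uniq ?iota_uniq // => a b; rewrite !mem_iota !add0n => aN bN gab.
    by rewrite -(gK a) // gab gK.
  - by apply/allP => x _ /=; rewrite inE.
  move=> a aN; have ah : a < size hrows by rewrite szh.
  have /andP [ur bnd] := allP ok _ (mem_nth [::] ah).
  split=> // x _; rewrite nl // edgeE gK //; apply/idP/mapP => [xr|[b br ->]].
    by exists (lab x); rewrite // nl ?gE.
  by rewrite nl ?gK // (allP bnd).
rewrite -(pm_labelled simp labl) ?szl ?iota_uniq ?size_iota //.
  congr pm; apply/setP => x; rewrite !inE; apply/esym/mapP; exists (lab x).
    by rewrite mem_iota add0n labN.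
  by rewrite nl ?gE.
by apply/allP => a; rewrite mem_iota add0n.
Qed.

Lemma rows_irr hrows : all (fun a => a \notin row hrows a) (iota 0 (size hrows)) ->
  forall a, a \notin row hrows a.
Proof.
move=> /allP H a; have [aN|aN] := ltnP a (size hrows); last by rewrite nth_default.
by apply: H; rewrite mem_iota add0n.
Qed.

Lemma labelled_full_mem e S x0 l rows : labelled e S x0 l rows -> size l = #|S| ->
  S =i l.
Proof.
case=> ul lS _ _ szl x; apply/idP/idP; last exact: (allP lS).
apply: contraTT => xl; apply/negP => xS.
have : #|x |: [set y in l]| <= #|S|.
  by apply/subset_leq_card/subsetP => y; rewrite !inE => /orP [/eqP ->|/(allP lS)].
by rewrite cardsU1 inE xl cardsE (card_uniqP ul) szl ltnn.
Qed.

Lemma count_pm_labelled e S x0 l rows : simple e -> labelled e S x0 l rows ->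
  size rows = #|S| -> size l = #|S| ->
  pm e S = count_pm rows #|S| (iota 0 #|S|) /\
  forall a b, a < #|S| -> b < #|S| -> a != b ->
  pm e (S :\ nth x0 l a :\ nth x0 l b) = count_pm rows #|S| (rem b (rem a (iota 0 #|S|))).
Proof.
move=> simp labl szr szl; have [ul lS _ _] := labl.
have inS := labelled_full_mem labl szl.
have mapl : map (nth x0 l) (iota 0 #|S|) = l by rewrite -szl map_nth_iota0 // take_size.
split; first rewrite -(pm_labelled simp labl) ?iota_uniq ?szr ?szl ?size_iota //.
- by rewrite mapl; congr pm; apply/setP => x; rewrite inE inS.
- by apply/allP => a; rewrite mem_iota add0n.
move=> a b aS bS ab.
have ua : uniq (rem a (iota 0 #|S|)) by rewrite rem_uniq ?iota_uniq.
have bR : b \in rem a (iota 0 #|S|).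
  by rewrite mem_rem_uniq ?iota_uniq // inE eq_sym ab mem_iota add0n.
rewrite -(@pm_labelled _ _ _ _ simp _ _ (rem b (rem a (iota 0 #|S|))) _ labl).
- congr pm; apply/setP => x; rewrite !inE inS -{3}mapl.
  apply/and3P/mapP => [[xb xa /mapP [c cS xc]]|[c]].
    exists c => //; rewrite mem_rem_uniq // inE mem_rem_uniq ?iota_uniq // inE cS andbT.
    by apply/andP; split; [apply: contraNneq xb => <- | apply: contraNneq xa => <-]; apply/eqP.
  rewrite mem_rem_uniq // inE mem_rem_uniq ?iota_uniq // inE => /and3P [cb ca cS] ->.
  have cl : c < #|S| by move: cS; rewrite mem_iota add0n.
  by split; rewrite ?nth_uniq ?szl // map_f.
- by rewrite szr szl.
- exact: rem_uniq.
- by apply/allP => c /mem_rem /mem_rem; rewrite mem_iota add0n szl.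
by rewrite size_rem // size_rem ?mem_iota ?size_iota //; lia.
Qed.

Lemma small_case n hrows x (H : sgraph) e S :
  extremal n H -> coded H hrows n.*2 -> (forall a, a \notin row hrows a) ->
  search_small n hrows x -> 0 < n -> cubic_graph e S n ->
  [/\ pm e S <= max_permat n, pm e S = max_permat n -> ext e S n
    & forall a b, a \in S -> b \in S -> e a b -> pm e S <= x + pm e (S :\ a :\ b)].
Proof.
move=> extH codH irrh srch n0 [simp cub conn SN].
have /card_gt0P [v vS] : 0 < #|S| by rewrite SN double_gt0.
have lab0 : labelled e S v [:: v] [::] by split; rewrite //= vS.
have := @search_sound _ e S v simp cub conn false (leaf_small n hrows x) n.*2
  [:: v] [::] (fun H : false => False_ind _ (notF H)) isT
  (fun H : false => False_ind _ (notF H)) lab0.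
rewrite SN => /(_ srch) [l [rows [labl szr szl /and3P [le_m iso xb]]]].
rewrite -SN in szr szl; have [pmE pmabE] := count_pm_labelled simp labl szr szl.
rewrite SN in pmE pmabE; rewrite -pmE in le_m iso xb; split=> //.
  move=> pmm; rewrite pmm eqxx in iso; exists H => //.
  exact: (coded_iso simp irrh codH labl szr szl SN iso).
have [ul lS _ _] := labl.
have inl y : y \in S -> exists2 c, c < n.*2 & y = nth v l c.
  rewrite (labelled_full_mem labl szl) => yl; exists (index y l); rewrite ?nth_index //.
  by rewrite -SN -szl index_mem.
move=> _ _ /inl [a aN ->] /inl [b bN ->].
rewrite (labelled_edge labl) ?szr ?szl ?SN // => ba.
have ab : a != b.
  apply: contraTneq ba => ->; rewrite -(labelled_edge labl) ?simp.2 // ?szr ?szl SN //.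
rewrite pmabE //.
have := allP xb a; rewrite mem_iota add0n => /(_ aN) /allP /(_ b ba).
by [].
Qed.

Lemma C4_case n e S : search_C4 n -> 0 < n -> cubic_graph e S n ->
  triangle_free e S -> {in S, forall v, in_C4 e S v} ->
  pm e S < max_permat n \/ n = 6 /\ pm e S = max_permat 6 /\ ext e S 6.
Proof.
move=> srch n0 [simp cub conn SN] tri C4; have [esym eirr] := simp.
have /card_gt0P [v vS] : 0 < #|S| by rewrite SN double_gt0.
have [x [y [w [[xS yS wS] [xy wv evx evy /andP [exw eyw]]]]]] := C4 v vS.
have [z nv] := nb_ex2 cub vS xS yS xy evx evy.
have exv : e x v by rewrite esym.
have vw : v != w by rewrite eq_sym.
have [u nx] := nb_ex2 cub xS vS wS vw exv exw.
have [_ /and3P [_ _ zS] uv Ev] := nv; have [_ /and3P [_ _ uS] ux Ex] := nx.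
(* Triangle-freeness separates the neighbours of [x] from those of [v], so the six starting vertices
   are distinct. *)
have Nv t : t \in S -> e v t -> ~~ e x t by move=> tS; apply: tri.
have lab0 : labelled e S v [:: v; x; y; z; w; u] [:: [:: 1; 2; 3]; [:: 0; 4; 5]].
  have vN t : e v t -> v != t by apply: contraTneq => <-; rewrite eirr.
  have evz : e v z by rewrite Ev // !inE eqxx !orbT.
  have exu : e x u by rewrite Ex // !inE eqxx !orbT.
  have NvN t t' : t \in S -> t' \in S -> e v t -> e x t' -> t != t'.
    by move=> tS t'S evt ext; apply: contraTneq (Nv t tS evt) => ->; rewrite ext.
  have [ux1 ux2] : v != u /\ w != u by move: ux; rewrite /= !inE !negb_or => /and3P [/andP [_ ->] ->].
  have [uv1 uv2] : x != z /\ y != z by move: uv; rewrite /= !inE !negb_or => /and3P [/andP [_ ->] ->].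
  have evx' := evx; have evy' := evy.
  have [vx vy vz] : [/\ v != x, v != y & v != z] by split; apply: vN.
  have [xw xu] : x != w /\ x != u by split; apply: NvN.
  have [yw yu] : y != w /\ y != u by split; apply: NvN.
  have [zw zu] : z != w /\ z != u by split; apply: NvN.
  split=> //=.
  - by rewrite !inE !negb_or; do ?[apply/andP; split].
  - by rewrite vS xS yS zS wS uS.
  by case=> [|[|a]] //= _.
have := @search_sound _ e S v simp cub conn true (leaf_C4 n) n.*2
  [:: v; x; y; z; w; u] [:: [:: 1; 2; 3]; [:: 0; 4; 5]]
  (fun _ l rows lab r0 => good_rows_labelled simp tri C4 lab r0) isT (fun=> isT) lab0.
rewrite SN => /(_ srch) [l [rows [labl szr szl]]].
rewrite -SN in szr szl; have [pmE _] := count_pm_labelled simp labl szr szl.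
rewrite SN in pmE; rewrite /leaf_C4 -pmE; case: ifP => [|_]; first by left.
case: ifP => // /andP [/eqP n6 /eqP pm6] iso; right; split=> //; split=> //.
move: iso; rewrite n6 in SN *; case: ifP => [iso _|_ iso].
  exists circular_ladder12; first exact: extremal6.
  apply: (coded_iso simp _ coded_circular labl szr szl SN iso).
  exact: rows_irr.
exists (ladderK33 6); first exact: extremal_ladder.
apply: (coded_iso simp _ coded_ladder6 labl szr szl SN iso).
exact: rows_irr.
Qed.

End Base.

Lemma pm_small (H : sgraph) n : extremal n H -> n <= 5 ->
  pm edge [set: H] = max_permat n.
Proof.
case=> //.
- by rewrite (pm_coded coded_K4).
- by rewrite (pm_coded coded_K33).
- by rewrite (pm_coded coded_K44).
- by rewrite (pm_coded coded_mobius).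
by move=> m m6 m5; have := leq_trans m6 m5.
Qed.

Lemma pm_circular : pm edge [set: circular_ladder12] = max_permat 6.
Proof. by rewrite (pm_coded coded_circular). Qed.

Section SmallCases.

Variable T : finType.
Implicit Types (e : rel T) (S : {set T}).

Lemma small_cases n e S : 2 <= n <= 5 -> cubic_graph e S n ->
  [/\ pm e S <= max_permat n, pm e S = max_permat n -> ext e S n
    & forall a b, a \in S -> b \in S -> e a b ->
      pm e S <= 2 * fib n + pm e (S :\ a :\ b)].
Proof.
case: n => [|[|[|[|[|[|n]]]]]] // _.
- apply: (small_case extremal2 coded_K4 _ search2) => //; exact: rows_irr.
- apply: (small_case extremal3 coded_K33 _ search3) => //; exact: rows_irr.
- apply: (small_case extremal4 coded_K44 _ search4) => //; exact: rows_irr.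
- apply: (small_case extremal5 coded_mobius _ search5) => //; exact: rows_irr.
Qed.

Lemma C4_case67 n e S : 6 <= n <= 7 -> cubic_graph e S n ->
  triangle_free e S -> {in S, forall v, in_C4 e S v} ->
  pm e S <= max_permat n /\ (pm e S = max_permat n -> ext e S n).
Proof.
move=> n67 G tri C4.
have [lt|[n6 [pmE extG]]] : pm e S < max_permat n \/ n = 6 /\ pm e S = max_permat 6 /\ ext e S 6.
- have : n = 6 \/ n = 7 by lia.
  case=> ne; rewrite ne in G *.
    exact: (C4_case search_C4_6 isT G tri C4).
  exact: (C4_case search_C4_7 isT G tri C4).
- by split; [exact: ltnW | move=> E; rewrite E ltnn in lt].
by rewrite n6 pmE; split.
Qed.

Lemma cubic_graph_ge2 n e S : cubic_graph e S n -> 0 < #|S| -> 2 <= n.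
Proof.
case=> simp cub _ SN /card_gt0P [v vS].
have := cub v vS; rewrite /deg => d3.
have : #|v |: [set y in S | e v y]| <= #|S|.
  by apply/subset_leq_card/subsetP => x; rewrite !inE => /orP [/eqP ->|/andP []].
by rewrite cardsU1 inE simp.2 andbF d3 SN; lia.
Qed.

End SmallCases.

(** * Pieces attached by two edges *)

Section Ends.

Variable T : finType.
Implicit Types (e : rel T) (S C : {set T}).

Lemma nb_edges e S v a b c : nb e S v a b c -> [/\ e v a, e v b & e v c].
Proof.
by case=> vS /and3P [aS bS cS] _ E; rewrite !E // !inE !eqxx ?orbT.
Qed.

Lemma nb_in e S v a b c : nb e S v a b c -> [/\ v \in S, a \in S, b \in S & c \in S].
Proof. by case=> vS /and3P []. Qed.

Lemma nb_neq e S v a b c : simple e -> nb e S v a b c ->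
  [/\ v != a, v != b, v != c, a != b & a != c] /\ b != c.
Proof.
move=> simp n; have [eva evb evc] := nb_edges n; have [_ _ u _] := n.
have neq x : e v x -> v != x by apply: contraTneq => <-; rewrite simp.2.
move: u; rewrite /= !inE !negb_or => /and3P [/andP [ab ac] bc _].
by split=> //; split=> //; apply: neq.
Qed.

Lemma nb_cases e S v a b c x : nb e S v a b c -> x \in S -> e v x ->
  [\/ x = a, x = b | x = c].
Proof.
case=> _ _ _ E xS; rewrite E // !inE.
by case/or3P => /eqP ->; [constructor 1 | constructor 2 | constructor 3].
Qed.

Lemma deg_nb e S S0 v a b c : nb e S v a b c -> S0 \subset S ->
  deg e S0 v = (a \in S0) + (b \in S0) + (c \in S0).
Proof.
case=> vS _ u E /subsetP S0S; rewrite /deg.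
transitivity (\sum_(x <- [:: a; b; c]) (x \in S0)); last first.
  by rewrite !big_cons big_nil addn0 addnA.
rewrite -sum1dep_card (big_uniq _ u) /= big_mkcond [RHS]big_mkcond /=.
apply: eq_bigr => x _; case xS0 : (x \in S0) => /=; last by case: ifP.
by rewrite E ?S0S //; case: ifP.
Qed.

Lemma pm_add e S a b : simple e -> a != b -> ~~ e a b -> a \in S -> b \in S ->
  pm (add a b e) S = pm e S + pm e (S :\ a :\ b).
Proof.
move=> simp ab eab aS bS; rewrite -q_nil q_add // q_nil; congr (_ + _).
rewrite /q /= inE ab aS bS /=; congr pm; apply/setP => x; rewrite !inE negb_or.
by rewrite andbCA andbA.
Qed.

(* p, a, b, c, d, q with the 4-cycle a b c d, p joined to a, c and q to b, d:
   a K33 from which the edge p q is removed. *)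
Definition K33e_on e p q a b c d :=
  [/\ [/\ e a b, e b c, e c d & e d a], [/\ e p a, e p c, e q b & e q d]
    & uniq [:: p; q; a; b; c; d]].

Definition K33e e S := exists p q a b c d,
  K33e_on e p q a b c d /\ all (mem S) [:: p; q; a; b; c; d].

Lemma K33_minus_edge e S p q : simple e -> p != q -> ~~ e p q -> p \in S -> q \in S ->
  iso_onto (add p q e) S K33 -> exists a b c d,
  K33e_on e p q a b c d /\ S = [set x in [:: p; q; a; b; c; d]].
Proof.
move=> simp pq epq pS qS [f [fI SE fE]].
have simp' := simple_add pq simp.
have [[s i] fp] : exists u, p = f u.
  by move: pS; rewrite SE => /imsetP [u _ ->]; exists u.
have [[t j] fq] : exists u, q = f u.
  by move: qS; rewrite SE => /imsetP [u _ ->]; exists u.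
have st : t = ~~ s.
  have := fE (s, i) (t, j); rewrite -fp -fq /add !eqxx orbT.
  by rewrite /edge /= /sym_closure /K33_arc /=; case: s t {fp fq} => [] [].
have others (k : 'I_3) : exists k1 k2 : 'I_3, [/\ k1 != k, k2 != k, k1 != k2
    & forall l, [|| l == k, l == k1 | l == k2]].
  case: k => [[|[|[|k]]] // ?];
  [exists (inord 1), (inord 2) | exists (inord 0), (inord 2) | exists (inord 0), (inord 1)];
  by rewrite -!val_eqE /= !inordK //; split=> // -[[|[|[|l]]] // ?]; rewrite -!val_eqE /= !inordK.
have [i1 [i2 [i1i i2i i12 iall]]] := others i.
have [j1 [j2 [j1j j2j j12 jall]]] := others j.
have fneq u v : u != v -> f u != f v by rewrite inj_eq.
have K33E u v : edge (s := K33) u v = (u.1 != v.1).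
  by rewrite /edge /= /sym_closure /K33_arc (eq_sym v.1) orbb.
have ef u v : u.1 != v.1 -> ~~ ((u == (s, i)) && (v == (t, j))) ->
    ~~ ((u == (t, j)) && (v == (s, i))) -> e (f u) (f v).
  move=> uv n1 n2; have := fE u v; rewrite K33E uv /add fp fq !(inj_eq fI).
  by rewrite (negbTE n1) (negbTE n2) !orbF.
exists (f (t, j1)), (f (s, i1)), (f (t, j2)), (f (s, i2)); split; last first.
  rewrite SE fp fq; apply/setP => x; rewrite !inE; apply/imsetP/idP; last first.
    by do 5?[case/orP]; move=> /eqP ->; eexists.
  case=> -[u k] _ ->; have [->|us] := eqVneq u s.
    by case/or3P: (iall k) => /eqP ->; rewrite eqxx ?orbT.
  have -> : u = t by rewrite st; case: u s us {fp fq st ef} => [] [].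
  by case/or3P: (jall k) => /eqP ->; rewrite eqxx ?orbT.
have tsF : (t == s) = false by rewrite st; case: (s).
have stF : (s == t) = false by rewrite eq_sym.
split.
- by split; apply: ef => /=; rewrite ?tsF ?stF // !xpair_eqE ?tsF ?stF ?eqxx /=
    ?(negbTE i1i) ?(negbTE i2i) ?(negbTE j1j) ?(negbTE j2j) ?andbF.
- by rewrite fp fq; split; apply: ef => /=; rewrite ?tsF ?stF // !xpair_eqE ?tsF ?stF ?eqxx /=
    ?(negbTE i1i) ?(negbTE i2i) ?(negbTE j1j) ?(negbTE j2j) ?andbF.
rewrite fp fq -[_ :: _]/(map f [:: (s, i); (t, j); (t, j1); (s, i1); (t, j2); (s, i2)]).
rewrite map_inj_uniq //= !inE !xpair_eqE ?tsF ?stF ?eqxx /=.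
rewrite ![i == _]eq_sym ![j == _]eq_sym (negbTE i1i) (negbTE i2i) (negbTE j1j) (negbTE j2j).
by rewrite (negbTE i12) (negbTE j12).
Qed.

(* The ladder with K33 inserted at one end: g false and g true are the rails. *)
Definition tail e S c d r := exists (g : bool -> nat -> T) (h : 'I_4 -> T),
  [/\ g false 0 = c, g true 0 = d,
      forall x, x \in S -> (exists s i, i < r /\ x = g s i) \/ exists k, x = h k
    & [/\ forall s i, i.+1 < r -> e (g s i) (g s i.+1),
      forall i, i.+1 < r -> e (g false i) (g true i),
      forall s (k : 'I_4), odd k = s -> e (g s r.-1) (h k)
    & forall k l : 'I_4, l = k.+1 %% 4 :> nat -> e (h k) (h l)]].

Lemma tail_K33e e S p q a b c d : simple e -> K33e_on e p q a b c d ->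
  S = [set x in [:: p; q; a; b; c; d]] -> tail e S p q 1.
Proof.
move=> simp [[ab bc cd da] [pa pc qb qd] _] ->.
exists (fun s _ => if s then q else p), (fun k : 'I_4 => nth p [:: a; b; c; d] k).
split=> //.
  move=> x; rewrite !inE orbA => /orP [/orP [] /eqP ->|].
  - by left; exists false, 0.
  - by left; exists true, 0.
  move=> xabcd; right.
  have xin : x \in [:: a; b; c; d] by rewrite !inE.
  have lt4 : index x [:: a; b; c; d] < 4 by rewrite index_mem.
  by exists (Ordinal lt4); rewrite nth_index.
split=> //.
  by move=> s [[|[|[|[|k]]]] // ?] /= <-.
by move=> [[|[|[|[|k]]]] // ?] [[|[|[|[|l]]]] // ?].
Qed.

Lemma tail_step e S c d c' d' r : 0 < r -> e c d -> e c c' -> e d d' ->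
  tail e (S :\ c :\ d) c' d' r -> tail e S c d r.+1.
Proof.
move=> r0 ecd ecc edd [g [h [gc gd cover [rail rung last cyc]]]].
exists (fun s i => if i is i'.+1 then g s i' else if s then d else c), h.
split=> //.
  move=> x xS; have [->|xc] := eqVneq x c; first by left; exists false, 0.
  have [->|xd] := eqVneq x d; first by left; exists true, 0.
  have [|[s [i [ir ->]]]|[k ->]] := cover x; first by rewrite !inE xc xd.
    by left; exists s, i.+1.
  by right; exists k.
split=> //.
- by move=> [] [|i] // ir; rewrite ?gc ?gd //; apply: rail.
- by case=> // i; apply: rung.
by move=> s k sk; case: r r0 last {cover rail rung} => // r _; apply.
Qed.

End Ends.

(* The case analysis behind end_bound: X and Y count the perfect matchings of a
   cubic graph on 2k vertices avoiding, respectively using, a given edge. *)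
Lemma end_numeric k j X Y : 2 <= k -> X + Y <= max_permat k ->
  (k <= 5 -> X <= 2 * fib k) ->
  fib j.+3 * X + fib j.+2 * Y <= 2 * fib (k + j).+2 /\
  (fib j.+3 * X + fib j.+2 * Y = 2 * fib (k + j).+2 -> k = 3 /\ X + Y = 6).
Proof.
move=> k2 XYm X2f.
have -> : (k + j).+2 = (k.-1 + j.+2).+1 by lia.
rewrite fib_add prednK ?(ltn_trans _ k2) //.
have FE := fibSS j.+1; have F'0 := fib_gt0 j.+1; have Fle := fib_le_double j.+1.
have FF' : fib j.+2 <= fib j.+3 by rewrite FE; lia.
move: (fib j.+3) (fib j.+2) {FE} F'0 Fle FF' => F F' F'0 Fle FF'.
have [k5|k5] := leqP k 5.
  (* Here X + Y <= m_k is not enough: for k = 3, j = 0 it allows 2 X + Y = 12 against the bound 10,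
     whereas X <= 4 gives exactly 10. *)
  have {X2f} := X2f k5.
  case: k k2 k5 XYm => [|[|[|[|[|[|k]]]]]] // _ _; rewrite /max_permat /=; nia.
rewrite max_permat_fib // in XYm.
case: k k2 k5 {X2f} XYm => [|[|[|[|m]]]] // _ k5.
rewrite [predn _]/= (fibSS m.+2) (fibSS m.+1).
have := @fib_lt m.+1 ltac:(lia).
move: (fib m.+2) (fib m.+1) => B C CB XYm.
(* For k >= 6 the worst case Y = 0 is still strict. It reduces to F C < F' (B + C), which follows
   from F <= 2 F' and C < B. *)
have FX : F * X + F' * Y <= F * (4 * (B + C)) by nia.
have FC : F * C < F' * (B + C) by nia.
have lt : F * X + F' * Y < 2 * (F' * (B + C) + F * (B + C + B)) by nia.
by rewrite mulnC [_ * F]mulnC; split; lia.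
Qed.

Section EndBound.

Variables (T : finType) (e : rel T) (S : {set T}) (n : nat).
Hypotheses (simp : simple e) (cub : cubic_on e S) (conn : connected_on e S).
Hypothesis bridge_free : bridgeless e S.
Hypothesis IH : forall k (e' : rel T) (S' : {set T}), 1 < k < n -> cubic_graph e' S' k ->
  pm e' S' <= max_permat k /\ (pm e' S' = max_permat k -> ext e' S' k).

(* S0 is attached to the rest of the graph by two edges, at c and d. *)
Definition end_at (S0 : {set T}) c d :=
  [/\ S0 \subset S, c \in S0, d \in S0, c != d &
      forall x, x \in S0 -> deg e S0 x + (x == c) + (x == d) = 3].

Lemma end_inner S0 c d x y : end_at S0 c d -> x \in S0 -> y \in S -> y \notin S0 ->
  e x y -> x = c \/ x = d.
Proof.
move=> [S0S cS0 dS0 cd dg] xS0 yS yS0 exy.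
have [|xc] := eqVneq x c; first by left.
have [|xd] := eqVneq x d; first by right.
have [a [b nx]] := nb_ex1 cub (subsetP S0S x xS0) yS exy.
have := dg x xS0; rewrite (negbTE xc) (negbTE xd) (deg_nb nx S0S) (negbTE yS0).
by case: (a \in S0); case: (b \in S0).
Qed.

Lemma end_nb S0 c d : end_at S0 c d -> e c d ->
  exists c' o, [/\ nb e S c d c' o, c' \in S0 & o \notin S0].
Proof.
move=> [S0S cS0 dS0 cd dg] ecd.
have [a [b nc]] := nb_ex1 cub (subsetP S0S c cS0) (subsetP S0S d dS0) ecd.
have := dg c cS0; rewrite eqxx (negbTE cd) (deg_nb nc S0S) dS0.
case aS0 : (a \in S0); case bS0 : (b \in S0) => // _.
  by exists a, b; rewrite aS0 bS0.
exists b, a; rewrite aS0 bS0; split=> //.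
by apply: nb_rot; apply: nb_swap.
Qed.

Lemma end_sym S0 c d : end_at S0 c d -> end_at S0 d c.
Proof.
move=> [S0S cS0 dS0 cd dg]; split=> //; first by rewrite eq_sym.
by move=> x /dg <-; rewrite addnAC.
Qed.

(** The edge c d restores both missing degrees. It also replaces the outside in connecting the
    piece, since the outside is reached only from [c] and [d]. *)
Lemma end_closure S0 c d k : end_at S0 c d -> ~~ e c d -> #|S0| = k.*2 ->
  cubic_graph (add c d e) S0 k.
Proof.
move=> En ecd S0k; have [S0S cS0 dS0 cd dg] := En.
have simp' := simple_add cd simp; split=> //.
  by move=> x xS0; rewrite (deg_add _ cd ecd simp.1 cS0 dS0) dg.
have SE : S0 = S :\: (S :\: S0).
  by rewrite setDDr setDv set0U; apply/esym/setIidPr.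
rewrite SE; apply: (connected_const simp.1 (subsetDl _ _) conn).
rewrite -SE => C cl; have [cle cdC] := closed_add cS0 dS0 cl; split=> //.
exists (c \in C) => x z xS0; rewrite inE => /andP [zS0 zS] exz.
by case: (end_inner En xS0 zS zS0 exz) => ->.
Qed.

Lemma q_nb2 (S0 : {set T}) l v a b o : nb e S v a b o -> S0 \subset S -> v \in S0 ->
  a \in S0 -> b \in S0 -> o \notin S0 -> v \notin l ->
  q e S0 l = q e S0 [:: v, a & l] + q e S0 [:: v, b & l].
Proof.
move=> nv S0S vS0 aS0 bS0 oS0 vl; have [_ _ u E] := nv; have [[_ _ _ ab _] _] := nb_neq simp nv.
rewrite (q_rec simp vS0 vl) (eq_bigl (fun x => x \in [:: a; b])) => [|x].
  by rewrite -big_uniq /= ?inE ?ab // !big_cons big_nil addn0.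
apply/andP/idP => [[xS0]|]; last first.
  by have [_ aS bS _] := nb_in nv; rewrite !inE => /orP [] /eqP ->; rewrite ?aS0 ?bS0 E // !inE eqxx ?orbT.
rewrite E ?(subsetP S0S) // !inE => /or3P [-> //|->|/eqP xo]; rewrite ?orbT //.
by rewrite -xo xS0 in oS0.
Qed.

(** If [c] and [d] are not adjacent, X and Y count the matchings of the closure that avoid or use c
    d, and [end_numeric] applies. If they are adjacent, removing this rung leaves a piece with
    numbers X1, Y1 such that X = X1 + Y1 and Y = X1. The weights (f_{j+3}, f_{j+2}) then become
    (f_{j+4}, f_{j+3}), which is why [j] is kept general. *)
Lemma end_bound k S0 c d j : k < n -> end_at S0 c d -> #|S0| = k.*2 ->
  let X := pm e S0 in let Y := pm e (S0 :\ c :\ d) in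
  fib j.+3 * X + fib j.+2 * Y <= 2 * fib (k + j).+2 /\
  (fib j.+3 * X + fib j.+2 * Y = 2 * fib (k + j).+2 -> 3 <= k /\ tail e S0 c d k.-2).
Proof.
elim: k S0 c d j => [|k IHk] S0 c d j kn En S0k X Y.
  have [_ cS0 _ _ _] := En; have /eqP := S0k; rewrite cards_eq0 => /eqP S00.
  by rewrite S00 inE in cS0.
have [S0S cS0 dS0 cd dg] := En; have [esym eirr] := simp.
have [ecd|ecd] := boolP (e c d); last first.
  have G := end_closure En ecd S0k.
  have k2 : 2 <= k.+1 by apply: (cubic_graph_ge2 G); apply/card_gt0P; exists c.
  have pmE : pm (add c d e) S0 = X + Y by apply: pm_add.
  have YE : pm (add c d e) (S0 :\ c :\ d) = Y.
    apply: pm_congr => x y; rewrite !inE /add => /and3P [/negbTE xd /negbTE xc _] _.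
    by rewrite xc xd !orbF.
  have [le_m eq_m] := IH (introT andP (conj k2 kn)) G; rewrite pmE in le_m eq_m.
  have X2 : k.+1 <= 5 -> X <= 2 * fib k.+1.
    move=> k5; have [|_ _ /(_ c d cS0 dS0)] := small_cases _ G; first by rewrite k2.
    by rewrite pmE YE /add !eqxx orbT => /(_ isT); lia.
  have [le1 eq1] := end_numeric j k2 le_m X2; split=> // /eq1 [k3 XY6].
  rewrite k3; split=> //; move: eq_m; rewrite k3 XY6 => /(_ erefl) [H extH iso].
  have {extH} HE : H = K33.
    by move: extH; move E : 3 => m extH; case: extH E => // m6 + m3; rewrite -m3.
  rewrite HE in iso.
  have [a [b [c' [d' [K KS]]]]] := K33_minus_edge simp cd ecd cS0 dS0 iso.
  exact: tail_K33e K KS.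
have [c' [o [nc c'S0 oS0]]] := end_nb En ecd.
have edc : e d c by rewrite esym.
have [d' [o' [nd d'S0 o'S0]]] := end_nb (end_sym En) edc.
have [cS _ c'S oS] := nb_in nc; have [dS _ d'S o'S] := nb_in nd.
have [[_ cc' co dc' do_] c'o] := nb_neq simp nc.
have [[_ dd' do' cd' co'] d'o'] := nb_neq simp nd.
have [_ ecc' eco] := nb_edges nc; have [_ edd' edo'] := nb_edges nd.
have cardS1 := cardsD2 simp cS0 dS0 ecd.
pose S1 := S0 :\ c :\ d.
have inS1 x : (x \in S1) = [&& x != d, x != c & x \in S0] by rewrite !inE.
have S1E : S1 = S0 :\: [set z in [:: c; d]].
  by apply/setP => x; rewrite inS1 !inE negb_or -andbA andbCA.
have S1S : S1 \subset S by rewrite S1E; apply: subset_trans (subsetDl _ _) S0S.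
have cS1 : c' \in S1 by rewrite inS1 (eq_sym c' d) (eq_sym c' c) dc' cc'.
have dS1 : d' \in S1 by rewrite inS1 (eq_sym d' c) (eq_sym d' d) dd' cd'.
have noS1 x y : x \in S1 -> y \notin S0 -> x != y.
  by rewrite inS1 => /and3P [_ _ xS0]; apply: contraNneq => <-.
(* A common further neighbour of [c] and [d] would have a third edge that cuts off the rest of the
   piece, a bridge. *)
have c'd' : c' != d'.
  apply/eqP => cdE; have [g nw] := nb_ex2 cub c'S cS dS cd
    ltac:(by rewrite esym) ltac:(by rewrite cdE esym).
  have [_ _ _ gS] := nb_in nw; have [[_ _ wg _ cg] dg'] := nb_neq simp nw.
  have [_ _ ewg] := nb_edges nw.
  have gS0 : g \in S0.
    have := dg c' c'S0; rewrite (deg_nb nw S0S) cS0 dS0.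
    by rewrite eq_sym (negbTE cc') eq_sym (negbTE dc'); case: (g \in S0).
  have := @bridge_free c' g (S1 :\ c') c'S gS ewg.
  rewrite !inE eqxx /= gS0 (eq_sym g c') wg (eq_sym g d) dg' (eq_sym g c) cg => H.
  suff : false = true by []; apply: H => x y.
  wlog : x y / x \in S1 :\ c' => [W|xC] xS yS exy n1 n2.
    have [xC|xC] := boolP (x \in S1 :\ c'); first by rewrite -(W x y) ?xC.
    have [yC|//] := boolP (y \in S1 :\ c').
    have {}W := W y x yC yS xS; rewrite yC (negbTE xC) esym in W.
    by symmetry; apply: W => // -[? ?]; [apply: n2 | apply: n1].
  rewrite xC; symmetry; have : x \in S1 by move: xC; rewrite !inE => /andP [].
  move=> xS1; have := xS1; rewrite inS1 => /and3P [xd xc xS0].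
  have yS0 : y \in S0.
    apply: contraT => yS0; have := end_inner En xS0 yS yS0 exy.
    by case=> E; [rewrite E eqxx in xc | rewrite E eqxx in xd].
  have [yc|yc] := eqVneq y c.
    move: exy; rewrite yc esym => /(nb_cases nc xS) [] E.
    - by rewrite E eqxx in xd.
    - by rewrite E !inE eqxx in xC.
    - by rewrite E (negbTE oS0) in xS0.
  have [yd|yd] := eqVneq y d.
    move: exy; rewrite yd esym => /(nb_cases nd xS) [] E.
    - by rewrite E eqxx in xc.
    - by rewrite E -cdE !inE eqxx in xC.
    - by rewrite E (negbTE o'S0) in xS0.
  have [yw|yw] := eqVneq y c'.
    move: exy; rewrite yw esym => /(nb_cases nw xS) [] E.
    - by rewrite E eqxx in xc.
    - by rewrite E eqxx in xd.
    - by case: n2.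
  by rewrite !inE yw yd yc yS0.
have En1 : end_at S1 c' d'.
  split=> // x xS1; have := xS1; rewrite inS1 => /and3P [xd xc xS0].
  have := dg x xS0; rewrite (negbTE xc) (negbTE xd) !addn0.
  rewrite (@deg_setD _ e S0 [:: c; d] x) /= ?inE ?cd ?cS0 ?dS0 //.
  rewrite -S1E !big_cons big_nil addn0 (nb_sum nc esym) ?(nb_sum nd esym);
    try by apply: (subsetP S0S).
  rewrite (negbTE xc) (negbTE xd) (negbTE (noS1 x o xS1 oS0)) (negbTE (noS1 x o' xS1 o'S0)).
  by rewrite !addn0 !add0n addnA.
have kn' : k < n by apply: ltn_trans kn.
have S1k : #|S1| = k.*2.
  by have := cardS1; rewrite S0k doubleS -/S1 => -[].
have YE : Y = pm e S1 by [].
have XE : X = pm e S1 + pm e (S1 :\ c' :\ d').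
  rewrite /X -q_nil (q_nb2 nc) // (@q_nb2 S0 [:: c; c'] d c d' o') //; last first.
    by rewrite !inE eq_sym (negbTE cd) (negbTE dc').
  have -> : q e S0 [:: d; c; c; c'] = 0 by rewrite /q /= !inE eqxx ?orbT ?andbF.
  rewrite add0n; congr (_ + _).
    rewrite /q /= inE cd cS0 dS0; congr pm; apply/setP => x.
    by rewrite inS1 !inE negb_or -andbA andbCA.
  rewrite /q ifT /=.
    congr pm; apply/setP => x; rewrite !inE !negb_or.
    by case: (x == d); case: (x == d'); case: (x == c); case: (x == c').
  rewrite cS0 dS0 c'S0 d'S0 /= !inE !negb_or (eq_sym d c) (eq_sym d' c) (eq_sym d' c').
  by rewrite dd' cc' dc' cd cd' c'd'.
have [le eq] := IHk S1 c' d' j.+1 kn' En1 S1k.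
have e1 : fib j.+3 * X + fib j.+2 * Y =
    fib j.+4 * pm e S1 + fib j.+3 * pm e (S1 :\ c' :\ d').
  by rewrite XE YE (fibSS j.+2) mulnDl mulnDr addnAC.
rewrite e1 addSnnS; split=> // /eq [k3 tl]; split; first exact: ltnW.
have -> : k.+1.-2 = k.-2.+1 by clear -k3; lia.
by apply: tail_step tl => //; clear -k3; lia.
Qed.

End EndBound.

(** * Deciding connectedness and bridgelessness *)

Section Swap.

Variable T : finType.
Implicit Types (e : rel T) (S C : {set T}).

Lemma closed_inP e S C : reflect (closed_in e S C)
  [forall x, forall y, [&& x \in S, y \in S & e x y] ==> ((x \in C) == (y \in C))].
Proof.
apply: (iffP forallP) => [H x y xS yS exy|H x].
  by have /forallP /(_ y) := H x; rewrite xS yS exy => /eqP.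
by apply/forallP => y; apply/implyP => /and3P [xS yS exy]; rewrite (H x y).
Qed.

Lemma connected_dec e S : connected_on e S \/
  exists C x y, [/\ closed_in e S C, x \in S, y \in S, x \in C & y \notin C].
Proof.
have [/existsP [C /and3P [/closed_inP cl /existsP [x /andP [xS xC]] /existsP [y /andP [yS yC]]]]|H]
  := boolP [exists C : {set T}, [&& [forall x, forall y, [&& x \in S, y \in S & e x y] ==>
    ((x \in C) == (y \in C))], [exists x, (x \in S) && (x \in C)]
    & [exists x, (x \in S) && (x \notin C)]]].
  by right; exists C, x, y.
left=> C /closed_inP cl; have := H => /existsPn /(_ C); rewrite cl /=.
move=> {}H x y xS yS; apply/idP/idP => [xC|yC]; apply: contraNT H => nC; apply/andP;
  split; apply/existsP; by [exists x; rewrite ?xS | exists y; rewrite ?yS].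
Qed.

Lemma bridgeless_dec e S : symmetric e -> bridgeless e S \/
  exists a b C, [/\ a \in S, b \in S, e a b, a \in C & b \notin C] /\
  forall x y, x \in S -> y \in S -> e x y -> x \in C -> y \notin C -> x = a /\ y = b.
Proof.
move=> esym.
pose P a b (C : {set T}) := [&& a \in S, b \in S, e a b, a \in C, b \notin C
  & [forall x, forall y, [&& x \in S, y \in S, e x y, x \in C & y \notin C] ==>
     ((x == a) && (y == b))]].
have [/existsP [a /existsP [b /existsP [C /and5P [aS bS eab aC /andP [bC /forallP H]]]]]|H] :=
  boolP [exists a, exists b, exists C, P a b C].
  right; exists a, b, C; split=> // x y xS yS exy xC yC.
  have /forallP /(_ y) := H x; rewrite xS yS exy xC yC => /andP [/eqP -> /eqP ->].
  by split.
left=> a b C aS bS eab cl; apply/eqP; apply: contraNT H => abC.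
have [aC|aC] := boolP (a \in C); have [bC|bC] := boolP (b \in C);
  try by rewrite ?aC ?bC ?(negbTE aC) ?(negbTE bC) in abC.
- apply/existsP; exists a; apply/existsP; exists b; apply/existsP; exists C.
  rewrite /P aS bS eab aC bC; apply/forallP => x; apply/forallP => y.
  apply/implyP => /and5P [xS yS exy xC yC]; apply: contraT => n1.
  have := cl x y xS yS exy; rewrite xC (negbTE yC) => {}cl; suff : true = false by []; apply: cl.
    by case=> xa yb; rewrite xa yb !eqxx in n1.
  by case=> xb _; rewrite xb (negbTE bC) in xC.
apply/existsP; exists b; apply/existsP; exists a; apply/existsP; exists C.
rewrite /P aS bS esym eab (negbTE aC) bC; apply/forallP => x; apply/forallP => y.
apply/implyP => /and5P [xS yS exy xC yC]; apply: contraT => n1.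
have := cl x y xS yS exy; rewrite xC (negbTE yC) => {}cl; suff : true = false by []; apply: cl.
  by case=> xa _; rewrite xa (negbTE aC) in xC.
by case=> xb ya; rewrite xb ya !eqxx in n1.
Qed.

End Swap.

(** * Bridges, and vertices on no 4-cycle *)

Lemma pred_range n : 6 <= n -> 1 < n.-1 < n.
Proof. by move=> n6; lia. Qed.

Section EdgeSwap.

Variables (T : finType) (e : rel T) (S : {set T}) (n : nat).
Hypotheses (simp : simple e) (cub : cubic_on e S) (conn : connected_on e S).
Hypothesis SN : #|S| = n.*2.

Lemma in_setD2 v x y : (y \in S :\: [set z in [:: v; x]]) = [&& y != v, y != x & y \in S].
Proof. by rewrite !inE negb_or andbA. Qed.

Lemma edge_swap v x a b s t : nb e S v x a b -> nb e S x v s t ->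
  uniq [:: a; b; s; t] -> ~~ e a s -> ~~ e b t ->
  let S' := S :\: [set z in [:: v; x]] in
  let e' := add b t (add a s e) in
  pm e' S' = q e S [:: v; x] + q e S [:: v; x; a; s] + q e S [:: v; x; b; t]
             + q e S [:: v; x; a; s; b; t] /\
  (cubic_graph e' S' n.-1 \/ exists C : {set T},
     [/\ closed_in e S' C, a \in C, s \in C, b \notin C & t \notin C]).
Proof.
move=> nv nx u eas ebt S' e'; have [esym eirr] := simp.
have [vS xS aS bS] := nb_in nv; have [_ _ sS tS] := nb_in nx.
have [[vx va vb xa xb] ab] := nb_neq simp nv.
have [[xv xs xt vs vt] st] := nb_neq simp nx.
move: u; rewrite /= !inE !negb_or => /and4P [/and3P [_ as_ at_] /andP [bs bt] _ _].
have ebt' : ~~ add a s e b t.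
  by rewrite /add (negbTE ebt) eq_sym (negbTE ab) (negbTE bs).
have uvx : uniq [:: v; x] by rewrite /= inE vx.
have vxS : all (mem S) [:: v; x] by rewrite /= vS xS.
have [aS' bS'] : a \in S' /\ b \in S'.
  by rewrite !in_setD2 aS bS !(eq_sym _ v) !(eq_sym _ x) va xa vb xb.
have [sS' tS'] : s \in S' /\ t \in S'.
  by rewrite !in_setD2 sS tS !(eq_sym _ v) !(eq_sym _ x) vs xs vt xt.
split; first by rewrite pm_add2.
have nbr y : y \in S' -> e y v = (y == a) || (y == b) /\ e y x = (y == s) || (y == t).
  rewrite in_setD2 => /and3P [/negbTE yv /negbTE yx yS].
  have [_ _ _ Ev] := nv; have [_ _ _ Ex] := nx.
  by rewrite !(esym y) Ev // Ex // !inE yv yx.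
have simp1 := simple_add as_ simp; have simp' := simple_add bt simp1.
have [cn|[C [y [z [cl yS' zS' yC zC]]]]] := connected_dec e' S'.
  left; split=> //.
    apply: cubic_add2 => // y yS'; rewrite !big_cons big_nil addn0.
    have yS : y \in S by move: yS'; rewrite in_setD2 => /and3P [].
    have [/negbTE yv /negbTE yx] : y != v /\ y != x by move: yS'; rewrite in_setD2 => /and3P [].
    by rewrite (nb_sum nv esym yS) (nb_sum nx esym yS) yv yx !add0n addnACA addnA addnAC.
  by rewrite card_setD_seq // SN -subn1 doubleB.
right; have [cl1 bt_C] := closed_add bS' tS' cl; have [cl0 as_C] := closed_add aS' sS' cl1.
have nbr' w u : w \in S' -> u \in [set u in [:: v; x]] -> e w u ->
    [\/ w = a, w = b, w = s | w = t].
  move=> /nbr [Ev Ex]; rewrite !inE => /orP [] /eqP ->.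
    by rewrite Ev => /orP [] /eqP ->; [constructor 1 | constructor 2].
  by rewrite Ex => /orP [] /eqP ->; [constructor 3 | constructor 4].
have [abC|abC] := eqVneq (a \in C) (b \in C).
  have H : {in S' &, forall w w', (w \in C) = (w' \in C)}.
    apply: (@closed_const _ e S _ C (a \in C) esym _ conn cl0).
      by apply/subsetP => w; rewrite !inE => /orP [] /eqP ->.
    by move=> w u wS' uR /(nbr' _ _ wS' uR) [] ->; rewrite -?as_C -?bt_C.
  by rewrite -(H y z yS' zS') yC in zC.
have [aC|aC] := boolP (a \in C); rewrite ?aC ?(negbTE aC) in abC as_C.
  exists C; rewrite aC -as_C -bt_C; split=> //; by apply: contraNN abC => ->.
have bC : b \in C by move: abC; case: (b \in C).
exists (~: C); rewrite !inE aC -as_C -bt_C bC; split=> //.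
by move=> w w' wS wS' eww; rewrite !inE (cl0 w w' wS wS' eww).
Qed.

Lemma edge_expand v x a b s t : nb e S v x a b -> nb e S x v s t ->
  pm e S = q e S [:: v; x] + q e S [:: v; x; a; s] + q e S [:: v; x; a; t]
           + q e S [:: v; x; b; s] + q e S [:: v; x; b; t].
Proof.
move=> nv nx; have [[vx va vb xa xb] ab] := nb_neq simp nv.
have expand y : v != y -> x != y ->
    q e S [:: v; y] = q e S [:: v; x; y; s] + q e S [:: v; x; y; t].
  move=> vy xy; rewrite (q_nb simp nx) ?inE ?negb_or ?(eq_sym x v) ?vx //.
  have -> : q e S [:: x; v; v; y] = 0 by rewrite /q /= !inE eqxx ?orbT ?andbF.
  rewrite add0n; congr (_ + _).
    exact: (@q_perm_idx _ e S v [:: v; x; y; s] [:: 1; 3; 0; 2]).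
  exact: (@q_perm_idx _ e S v [:: v; x; y; t] [:: 1; 3; 0; 2]).
by rewrite -q_nil (q_nb simp nv) // (expand a) // (expand b) // !addnA.
Qed.

Hypothesis n6 : 6 <= n.
Hypothesis IH : forall k (e' : rel T) (S' : {set T}), 1 < k < n -> cubic_graph e' S' k ->
  pm e' S' <= max_permat k /\ (pm e' S' = max_permat k -> ext e' S' k).

Lemma setD2 (A : {set T}) v x : A :\ v :\ x = A :\: [set z in [:: v; x]].
Proof. by apply/setP => z; rewrite !inE negb_or andbA [(z != x) && _]andbC. Qed.

Lemma q_pair v x : v \in S -> x \in S -> v != x ->
  q e S [:: v; x] = pm e (S :\: [set z in [:: v; x]]).
Proof. by move=> vS xS vx; rewrite pm_setD //= ?inE ?vx // vS xS. Qed.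

(** By parity both sides of the bridge have odd order, so every perfect matching contains the bridge
    and survives in the swapped graph on 2(n-1) vertices. *)
Lemma bridge_case a0 b0 (C : {set T}) : a0 \in S -> b0 \in S -> e a0 b0 ->
  a0 \in C -> b0 \notin C ->
  (forall x y, x \in S -> y \in S -> e x y -> x \in C -> y \notin C -> x = a0 /\ y = b0) ->
  pm e S <= max_permat n.-1.
Proof.
move=> vS xS evx vC xC cut; move: a0 b0 vS xS evx vC xC cut => v x vS xS evx vC xC cut.
have [esym eirr] := simp; have exv : e x v by rewrite esym.
have [a [b nv]] := nb_ex1 cub vS xS evx.
have [s [t nx]] := nb_ex1 cub xS vS exv.
have [_ _ aS bS] := nb_in nv; have [_ _ sS tS] := nb_in nx.
have [[vx va vb xa xb] ab] := nb_neq simp nv.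
have [[xv xs xt vs vt] st] := nb_neq simp nx.
have [_ eva evb] := nb_edges nv; have [_ exs ext_] := nb_edges nx.
have in_C y : y \in S -> e v y -> y != x -> y \in C.
  move=> yS evy; apply: contraNT => yC.
  by have [_ ->] := cut v y vS yS evy vC yC.
have notin_C y : y \in S -> e x y -> y != v -> y \notin C.
  move=> yS exy; apply: contraNN => yC.
  by have [-> _] := cut y x yS xS ltac:(by rewrite esym) yC xC.
have aC : a \in C by apply: in_C; rewrite // eq_sym.
have bC : b \in C by apply: in_C; rewrite // eq_sym.
have sC : s \notin C by apply: notin_C; rewrite // eq_sym.
have tC : t \notin C by apply: notin_C; rewrite // eq_sym.
have CnC y z : y \in C -> z \notin C -> y != z by move=> yC; apply: contraNneq => <-.
have nedge y z : y \in S -> z \in S -> y \in C -> z \notin C -> y != v -> ~~ e y z.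
  move=> yS zS yC zC; apply: contraNN => eyz.
  by have [-> _] := cut y z yS zS eyz yC zC.
pose A := S :&: C.
have AS : A \subset S by apply: subsetIl.
have degA y : y \in A -> deg e (S :\: A) y = (y == v).
  rewrite inE => /andP [yS yC]; have [->|yv] := eqVneq y v.
    by rewrite (deg_nb nv (subsetDl _ _)) !inE xS aS bS (negbTE xC) aC bC.
  apply/eqP; rewrite cards_eq0; apply/eqP/setP => z; rewrite !inE.
  by apply: contraNF yv => /andP [/andP [zC zS] eyz]; rewrite zS /= in zC;
     have [-> _] := cut y z yS zS eyz yC zC.
have oddA : odd #|A|.
  rewrite -(handshake simp cub AS) (eq_bigr _ degA).
  by rewrite (bigD1 v) ?inE ?vS //= eqxx big1 // => y /andP [_ /negbTE ->].
have q0 y : y \in S -> e v y -> y != x -> q e S [:: v; y] = 0.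
  move=> yS evy yx; have yv : v != y by apply: contraTneq evy => <-; rewrite eirr.
  rewrite q_pair // -setD2; have yC := in_C y yS evy yx.
  apply: (@pm_odd_closed _ e _ (A :\ v :\ y)) => //.
  - by apply: setSD; apply: setSD.
  - move=> z w; rewrite !inE => /and3P [zy zv zS] /and3P [wy wv wS] ezw.
    rewrite zy zv zS wy wv wS /=; apply/idP/idP => [zC|wC]; apply: contraT => nC.
      by have [zE _] := cut z w zS wS ezw zC nC; rewrite zE eqxx in zv.
    by have [wE _] := cut w z wS zS ltac:(by rewrite esym) wC nC; rewrite wE eqxx in wv.
  have vA : v \in A by rewrite inE vS.
  have yA : y \in A by rewrite inE yS.
  by move: oddA; rewrite (cardsD2 simp vA yA evy) /= negbK.
have pmE : pm e S = q e S [:: v; x].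
  have [ax bx] : a != x /\ b != x by rewrite !(eq_sym _ x).
  by rewrite -q_nil (q_nb simp nv) // (q0 a) // (q0 b) // !addn0.
have uabst : uniq [:: a; b; s; t] by rewrite /= !inE !negb_or ab st !CnC.
have eas : ~~ e a s by apply: nedge; rewrite // eq_sym.
have ebt : ~~ e b t by apply: nedge; rewrite // eq_sym.
have [pmE' [G|[C2 [cl aC2 sC2 bC2 tC2]]]] := edge_swap nv nx uabst eas ebt.
  have [le _] := IH (pred_range n6) G; apply: leq_trans le.
  by rewrite pmE pmE' -!addnA leq_addr.
(* If the swap disconnects the graph, the part [D] behind [a] is joined to the rest by the edge a v
   alone. It is therefore odd, and no perfect matching can contain v x. *)
suff -> : pm e S = 0 by [].
rewrite pmE q_pair //; pose D := A :&: C2 :\ v.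
have DE y : (y \in D) = [&& y != v, y \in S, y \in C & y \in C2] by rewrite !inE !andbA.
have DS : D \subset S by apply/subsetP => y; rewrite DE => /and4P [].
have clD y z : y \in D -> z \in S -> z \notin D -> e y z -> z = v.
  rewrite DE => /and4P [yv yS yC yC2] zS zD eyz; apply/eqP; apply: contraNT zD => zv.
  have yx : y != x by apply: CnC.
  have zC : z \in C.
    apply: contraT => zC; have [yE _] := cut y z yS zS eyz yC zC.
    by rewrite yE eqxx in yv.
  have zx : z != x by apply: CnC.
  by rewrite DE zv zS zC -(cl y z) // in_setD2 ?yv ?yx ?zv ?zx.
apply: (@pm_odd_closed _ e _ D) => //.
- by apply/subsetP => y; rewrite DE in_setD2 => /and4P [-> -> yC _]; rewrite CnC.
- move=> y z; rewrite !in_setD2 => /and3P [yv yx yS] /and3P [zv zx zS] eyz.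
  apply/idP/idP => [yD|zD]; apply: contraT => nD.
    by rewrite (clD y z yD zS nD eyz) eqxx in zv.
  by rewrite (clD z y zD yS nD ltac:(by rewrite esym)) eqxx in yv.
rewrite -(handshake simp cub DS) (eq_bigr (fun y => nat_of_bool (y == a))).
  rewrite (bigD1 a) /= ?DE ?aS ?aC ?aC2 ?(eq_sym a v) ?va // eqxx big1 //.
  by move=> y /andP [_ /negbTE ->].
move=> y yD; have [ya|ya] := eqVneq y a.
  have -> : deg e (S :\: D) y = #|[set v]|; last by rewrite cards1.
  apply: eq_card => z; rewrite inE [in LHS]inE inE; apply/andP/eqP => [[/andP [zD zS]]|->].
    exact: clD.
  by rewrite ya esym eva DE eqxx vS.
apply/eqP; rewrite cards_eq0; apply/eqP/setP => z; rewrite inE [z \in set0]inE in_setD.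
apply: contraNF ya => /andP [/andP [zD zS] eyz].
have zv := clD y z yD zS zD eyz; have := yD; rewrite DE => /and4P [yv yS yC yC2].
move: eyz; rewrite zv esym => /(nb_cases nv yS) [] E; last by rewrite -E yC2 in bC2.
  by rewrite -E yC in xC.
by rewrite E.
Qed.

(** A closure with the maximal number for k = 3 is K33, and removing the edge c d again would leave
    a K33 minus an edge inside G. *)
Lemma two_cut_closure A c d k : end_at e S A c d -> ~~ e c d -> #|A| = k.*2 -> k < n ->
  ~ K33e e S -> 2 <= k /\ pm e A + pm e (A :\ c :\ d) <= max_permat_noK33 k.
Proof.
move=> En ecd Ak kn noK; have [AS cA dA cd dg] := En.
have G := end_closure simp cub conn En ecd Ak.
have k2 : 2 <= k by apply: (cubic_graph_ge2 G); apply/card_gt0P; exists c.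
have [le eq] := IH (introT andP (conj k2 kn)) G; rewrite pm_add // in le eq; split=> //.
rewrite /max_permat_noK33; case: eqP => // k3; rewrite k3 /= in le eq.
rewrite leq_eqVlt in le; case/orP: le => [/eqP E|]; last by rewrite ltnS.
case: noK; have [H extH iso] := eq E.
have HE : H = K33.
  by move: extH; move E3 : 3 => m extH; case: extH E3 => // m6 + m3; rewrite -m3.
rewrite HE in iso; have [p [q' [r [s [K AE]]]]] := K33_minus_edge simp cd ecd cA dA iso.
exists c, d, p, q', r, s; split=> //.
by apply/allP => z zin; apply: (subsetP AS); rewrite AE inE.
Qed.

Hypothesis bridge_free : bridgeless e S.
Hypothesis noK : ~ K33e e S.

(** Without [v] and [x] the graph falls into two even pieces, attached at a, s and at b, t. Parity
    kills the matchings leaving through one vertex of each. With X, Y counting the matchings of a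
    piece with and without its attachment vertices, the total is X_A X_B + Y_A X_B + X_A Y_B, at
    most (X_A + Y_A)(X_B + Y_B), a product of bounds for the two closures. *)
Lemma swap_split v x a b s t (C : {set T}) : nb e S v x a b -> nb e S x v s t ->
  uniq [:: a; b; s; t] -> ~~ e a s -> ~~ e b t ->
  closed_in e (S :\: [set z in [:: v; x]]) C ->
  a \in C -> s \in C -> b \notin C -> t \notin C -> pm e S < max_permat n.
Proof.
move=> nv nx u eas ebt cl aC sC bC tC.
have [esym eirr] := simp.
have [vS xS aS bS] := nb_in nv; have [_ _ sS tS] := nb_in nx.
have [[vx va vb xa xb] ab] := nb_neq simp nv.
have [[xv xs xt vs vt] st] := nb_neq simp nx.
move: u; rewrite /= !inE !negb_or => /and4P [/and3P [_ as_ at_] /andP [bs bt] _ _].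
set S' := S :\: [set z in [:: v; x]] in cl.
have S'E : S' = S :\: [set z in [:: v; x]] by [].
have inS' y : (y \in S') = [&& y != v, y != x & y \in S] by apply: in_setD2.
have S'S : S' \subset S by apply: subsetDl.
clearbody S'.
have side (D : {set T}) c d c' d' : closed_in e S' D -> D \subset S' ->
    nb e S v x c c' -> nb e S x v d d' -> c \in D -> d \in D -> c' \notin D -> d' \notin D ->
    c != d -> end_at e S D c d /\ exists k, #|D| = k.*2.
  move=> clD DS' nvc nxd cD dD c'D d'D cd.
  have DS : D \subset S by apply: subset_trans DS' S'S.
  have dg y : y \in D -> deg e (S :\: D) y = (y == c) + (y == d).
    move=> yD; have := subsetP DS' y yD; rewrite inS' => /and3P [yv yx yS].
    have -> : deg e (S :\: D) y = (e y v) + (e y x).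
      have dSD : deg e (S :\: D) y = deg e [set v; x] y.
        apply: eq_card => z; rewrite !inE; apply/andP/andP => [[/andP [zD zS] eyz]|[vxz eyz]].
          split=> //; apply: contraT; rewrite negb_or => /andP [zv zx].
          by move: yD; rewrite (clD y z) ?(negbTE zD) // inS' ?yv ?yx ?zv ?zx.
        have zS : z \in S by case/orP: vxz => /eqP ->.
        rewrite zS andbT; split=> //; apply: contraL vxz => zD.
        by have := subsetP DS' z zD; rewrite inS' => /and3P [/negbTE -> /negbTE ->].
      rewrite dSD (@deg_setD _ e _ [:: v; x]) /= ?inE ?vx ?eqxx ?orbT //.
      rewrite !big_cons big_nil addn0 (_ : _ :\: _ = set0) ?/deg; last first.
        by apply/setP => z; rewrite !inE; case: (_ || _).
      rewrite (_ : [set _ in _ | _] = set0) ?cards0 //.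
      by apply/setP => z; rewrite !inE.
    rewrite (nb_sum nvc esym yS) (nb_sum nxd esym yS) (negbTE yv) (negbTE yx).
    have [/negbTE -> /negbTE ->] : y != c' /\ y != d'.
      by split; apply: contraTneq yD => ->.
    by rewrite !addn0 !add0n.
  split.
    split=> // y yD; have yS := subsetP DS y yD.
    rewrite -addnA -dg // -(cub yS) /deg -(cardsID D [set z in S | e y z]).
    congr (_ + _); apply: eq_card => z; rewrite !inE; last by rewrite -andbA.
    by rewrite [RHS]andbC; case: (boolP (z \in D)) => //= zD; rewrite (subsetP DS).
  have : ~~ odd #|D|.
    rewrite -(handshake simp cub DS) (eq_bigr _ dg) big_split /=.
    have one z : z \in D -> \sum_(y in D) (y == z) = 1.
      by move=> zD; rewrite (bigD1 z) //= eqxx big1 // => y /andP [_ /negbTE ->].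
    by rewrite !one.
  by move=> /even_halfK E; exists #|D|./2.
pose A := S' :&: C; pose B := S' :\: C.
have clA : closed_in e S' A.
  by move=> y z yS' zS' eyz; rewrite !inE yS' zS' /=; apply: cl.
have clB : closed_in e S' B.
  by move=> y z yS' zS' eyz; rewrite !inE yS' zS' !andbT (cl y z).
have [aS' bS'] : a \in S' /\ b \in S'.
  by rewrite !inS' aS bS !(eq_sym _ v) !(eq_sym _ x) va xa vb xb.
have [sS' tS'] : s \in S' /\ t \in S'.
  by rewrite !inS' sS tS !(eq_sym _ v) !(eq_sym _ x) vs xs vt xt.
have inA y : (y \in A) = (y \in S') && (y \in C) by rewrite inE.
have inB y : (y \in B) = (y \notin C) && (y \in S') by rewrite inE.
have [EnA [ka Ak]] : end_at e S A a s /\ exists k, #|A| = k.*2.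
  apply: (side A a s b t) => //; first exact: subsetIl.
  - by rewrite inA aS'.
  - by rewrite inA sS'.
  - by rewrite inA (negbTE bC) andbF.
  - by rewrite inA (negbTE tC) andbF.
have [EnB [kb Bk]] : end_at e S B b t /\ exists k, #|B| = k.*2.
  apply: (side B b t a s) => //; first exact: subsetDl.
  - exact: nb_rot (nb_swap nv).
  - exact: nb_rot (nb_swap nx).
  - by rewrite inB bC.
  - by rewrite inB tC.
  - by rewrite inB aC.
  - by rewrite inB sC.
have uvx : uniq [:: v; x] by rewrite /= inE vx.
have vxS : all (mem S) [:: v; x] by rewrite /= vS xS.
have cardS' : #|S'| = n.-1.*2 by rewrite S'E card_setD_seq // SN -subn1 doubleB.
have abn : (ka + kb).+1 = n.
  have := cardsID C S'; rewrite -/A -/B Ak Bk cardS'.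
  by rewrite -doubleD => /double_inj E; rewrite E prednK // (leq_trans _ n6).
have ka_n : ka < n by rewrite -abn ltnS leq_addr.
have kb_n : kb < n by rewrite -abn ltnS leq_addl.
have [ka2 leA] := two_cut_closure EnA eas Ak ka_n noK.
have [kb2 leB] := two_cut_closure EnB ebt Bk kb_n noK.
have pmD (D1 D2 : {set T}) : D1 \subset A -> D2 \subset B ->
    pm e (D1 :|: D2) = pm e D1 * pm e D2.
  move=> /subsetP D1A /subsetP D2B; rewrite (pm_closed simp (subsetUl D1 D2)).
    congr (_ * pm e _); apply/setP => z; rewrite !inE.
    case zD1 : (z \in D1) => //=; symmetry; apply/negbTE/negP => /D2B.
    by rewrite inB; have := D1A z zD1; rewrite inA => /andP [_ ->].
  have cross y z : y \in D1 -> z \in D2 -> e y z -> false.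
    move=> /D1A; rewrite inA => /andP [yS' yC] /D2B; rewrite inB => /andP [zC zS'] eyz.
    by rewrite -(cl y z yS' zS' eyz) yC in zC.
  move=> y z; rewrite !inE => /orP [yD|yD] /orP [zD|zD] eyz; rewrite ?yD ?zD //.
  - by have := cross y z yD zD eyz.
  - by have := cross z y zD yD; rewrite esym eyz => /(_ isT).
  apply/idP/idP => [/D1A|/D1A]; rewrite inA => /andP [_ C'].
    by have := D2B y yD; rewrite inB C'.
  by have := D2B z zD; rewrite inB C'.
have oddpm y z : y \in A -> z \in B -> pm e (S' :\ y :\ z) = 0.
  move=> yA zB; have -> : S' :\ y :\ z = (A :\ y) :|: (B :\ z).
    apply/setP => w; rewrite !inE.
    have := yA; have := zB; rewrite inA inB => /andP [zC zS'] /andP [yS' yC].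
    have [->|wz] := eqVneq w z; first by rewrite (negbTE zC) !andbF.
    have [->|wy] := eqVneq w y; first by rewrite yC.
    by rewrite /=; case: (w \in C); rewrite ?andbT ?andbF ?orbF.
  rewrite pmD ?subD1set // (@pm_odd _ e (A :\ y)) ?mul0n //.
  have : odd #|A| = ~~ odd #|A :\ y| by rewrite (cardsD1 y) yA.
  by rewrite Ak odd_double; case: (odd _).
have S'AB : S' = A :|: B by rewrite setID.
have SE y z : y \in S' -> z \in S' -> y != z ->
    q e S [:: v; x; y; z] = pm e (S' :\ y :\ z).
  rewrite !inS' => /and3P [yv yx yS] /and3P [zv zx zS] yz.
  rewrite /q /= !inE !negb_or vS xS yS zS vx yz !(eq_sym v) !(eq_sym x) yv yx zv zx /=.
  congr pm; apply/setP => w; rewrite !inE inS' !negb_or.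
  by case: (w == v); case: (w == x); case: (w == y); case: (w == z).
rewrite (edge_expand nv nx) q_pair // -S'E !SE //.
have aA : a \in A by rewrite inA aS'.
have sA : s \in A by rewrite inA sS'.
have bB : b \in B by rewrite inB bC.
have tB : t \in B by rewrite inB tC.
rewrite (oddpm a t) // [S' :\ b :\ s]setDDl setUC -setDDl (oddpm s b) // !addn0.
clearbody A B.
have -> : S' :\ a :\ s = (A :\ a :\ s) :|: B.
  apply/setP => w; rewrite !inE inB inA.
  have [->|wa] := eqVneq w a; first by rewrite aC !andbF.
  have [->|ws] := eqVneq w s; first by rewrite sC.
  by rewrite /=; case: (w \in C); rewrite ?andbT ?andbF ?orbF.
have -> : S' :\ b :\ t = A :|: (B :\ b :\ t).
  apply/setP => w; rewrite !inE inB inA.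
  have [->|wb] := eqVneq w b; first by rewrite (negbTE bC) !andbF.
  have [->|wt] := eqVneq w t; first by rewrite (negbTE tC) !andbF.
  by rewrite /=; case: (w \in C); rewrite ?andbT ?andbF ?orbF.
have subA : A :\ a :\ s \subset A by rewrite setD2 subsetDl.
have subB : B :\ b :\ t \subset B by rewrite setD2 subsetDl.
rewrite S'AB !pmD //.
apply: (@leq_ltn_trans (max_permat_noK33 ka * max_permat_noK33 kb)); last first.
  by rewrite -abn; apply: max_permat_mul => //; rewrite abn.
apply: leq_trans (leq_mul leA leB).
by rewrite mulnDl !mulnDr addnAC addnA leq_addr.
Qed.

(** Without triangles and 4-cycles at [v], both pairings of a, b with s, t give legitimate swaps.
    Each contains the term of matchings through v x, and their terms with one new edge are the four
    remaining terms of [edge_expand]. *)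
Lemma no_C4_edge v x a b : triangle_free e S -> ~ in_C4 e S v -> nb e S v x a b ->
  pm e S + q e S [:: v; x] <= 2 * max_permat n.-1 \/ pm e S < max_permat n.
Proof.
move=> tri noC4 nv; have [esym eirr] := simp.
have [vS xS aS bS] := nb_in nv; have [evx eva evb] := nb_edges nv.
have [s [t nx]] := nb_ex1 cub xS vS ltac:(by rewrite esym).
have [_ _ sS tS] := nb_in nx; have [_ exs ext_] := nb_edges nx.
have [[vx va vb xa xb] ab] := nb_neq simp nv.
have [[xv xs xt vs vt] st] := nb_neq simp nx.
have far y z : y \in S -> z \in S -> e v y -> e x z -> y != x -> z != v ->
    y != z /\ ~~ e y z.
  move=> yS zS evy exz yx zv; split.
    by apply: contraTneq exz => <-; apply: tri evx evy.
  apply/negP => eyz; apply: noC4; exists x, y, z; split=> //.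
  by split; rewrite // 1?eq_sym // exz.
have [ax bx] : a != x /\ b != x by rewrite !(eq_sym _ x).
have [sv tv] : s != v /\ t != v by rewrite !(eq_sym _ v).
have [as_ eas] := far a s aS sS eva exs ax sv.
have [at_ eat] := far a t aS tS eva ext_ ax tv.
have [bs ebs] := far b s bS sS evb exs bx sv.
have [bt ebt] := far b t bS tS evb ext_ bx tv.
have nx' := nb_rot (nb_swap nx).
have u : uniq [:: a; b; s; t] by rewrite /= !inE !negb_or ab as_ at_ bs bt st.
have u' : uniq [:: a; b; t; s] by rewrite /= !inE !negb_or ab as_ at_ bs bt eq_sym st.
have [pm1 [G1|[C [cl aC sC bC tC]]]] := edge_swap nv nx u eas ebt; last first.
  by right; apply: (swap_split nv nx u eas ebt cl).
have [pm2 [G2|[C [cl aC sC bC tC]]]] := edge_swap nv nx' u' eat ebs; last first.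
  by right; apply: (swap_split nv nx' u' eat ebs cl).
have [le1 _] := IH (pred_range n6) G1; have [le2 _] := IH (pred_range n6) G2.
left; rewrite pm1 in le1; rewrite pm2 in le2; rewrite (edge_expand nv nx).
have arith o p p' r r' w w' m : o + p + r' + w <= m -> o + p' + r + w' <= m ->
  o + p + p' + r + r' + o <= 2 * m by clear; lia.
exact: arith le1 le2.
Qed.

(** The matchings through the three edges at [v] add up to all matchings, so the three edge bounds
    sum to 4 PerMat <= 6 m_{n-1}. *)
Lemma no_C4_case v : v \in S -> triangle_free e S -> ~ in_C4 e S v ->
  pm e S < max_permat n.
Proof.
move=> vS tri noC4; have [x [y [z nv]]] := nb_ex cub vS.
have pmE : pm e S = q e S [:: v; x] + q e S [:: v; y] + q e S [:: v; z].
  by rewrite -q_nil (q_nb simp nv).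
have m := max_permat_pred n6.
have [lx|//] := no_C4_edge tri noC4 nv.
have [ly|//] := no_C4_edge tri noC4 (nb_rot nv).
have [lz|//] := no_C4_edge tri noC4 (nb_rot (nb_rot nv)).
have arith p o1 o2 o3 m' M : p = o1 + o2 + o3 -> 3 * m' < 2 * M ->
  p + o1 <= 2 * m' -> p + o2 <= 2 * m' -> p + o3 <= 2 * m' -> p < M by clear; lia.
exact: arith pmE m lx ly lz.
Qed.

End EdgeSwap.

Section Rest.

Variables (T : finType) (e : rel T) (S : {set T}).

Lemma nb_mem v a b c y (r : seq T) : nb e S v a b c -> y \in S -> e v y ->
  [&& a \in r, b \in r & c \in r] -> y \in r.
Proof. by move=> nv yS evy /and3P [ar br cr]; case: (nb_cases nv yS evy) => ->. Qed.

Lemma in_rest (r : seq T) x : x \in S -> x \notin r -> x \in S :\: [set z in r].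
Proof. by move=> xS xr; rewrite !inE xr. Qed.

Lemma rest_neq (r : seq T) x z : x \in S :\: [set z in r] -> z \in r -> (x == z) = false.
Proof. by rewrite !inE => /andP [xr _] zr; apply: contraNF xr => /eqP ->. Qed.

Lemma rest_all (r : seq T) x : x \in S :\: [set z in r] -> all (fun z => (x == z) == false) r.
Proof. by move=> xS; apply/allP => z zr; rewrite (rest_neq xS zr). Qed.

End Rest.

Ltac solve_closed yS :=
  let h := fresh "h" in
  rewrite /=; do ?[apply/andP; split] => //; apply/implyP; intro h;
  match goal with H : nb _ _ _ _ _ _ |- _ =>
    by apply: (nb_mem H yS h); rewrite !inE !eqxx ?orbT
  end.

Ltac split_ands H :=
  let h1 := fresh "N" in let h2 := fresh "N" in
  move: H => /andP [h1 h2]; (try split_ands h1); (try split_ands h2).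

Ltac neqs H := rewrite /= !inE !negb_or in H; split_ands H.

Ltac neq := first [assumption | by rewrite eq_sym].

Lemma ladder_adj n (u v : ladderK33 n) :
  edge u v = ladderK33_arc u v || ladderK33_arc v u.
Proof. by []. Qed.

Section ExtLadder.

Variables (T : finType).
Implicit Types (e : rel T) (S : {set T}).

Lemma ext_ladder e S m : 7 <= m -> ext e S m -> iso_onto e S (ladderK33 m).
Proof.
move=> m7 [H extH]; case: extH m7 => // m' _ _; exact.
Qed.

(* For 7 <= m no edge meets both ends of the ladder. *)
Lemma ladder_K33e e S m u v : 7 <= m -> iso_onto e S (ladderK33 m) ->
  u \in S -> v \in S -> e u v -> exists p q a b c d,
  K33e_on e p q a b c d /\ all (fun x => [&& x \in S, x != u & x != v]) [:: p; q; a; b; c; d].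
Proof.
move=> m7 [f [fI SE fE]] uS vS euv.
have lt0 t : (if t then m - 5 else 0) < m - 4 by case: t; lia.
pose k i : 'I_4 := inord i.
pose P t s : ladderK33 m := inl (s, Ordinal (lt0 t)).
pose A t i : ladderK33 m := inr (t, k i).
pose l t := [:: P t false; P t true; A t 0; A t 1; A t 2; A t 3].
pose near t (x : ladderK33 m) :=
  match x with inl (s, i) => i == (if t then m - 5 else 0) :> nat | inr (s, _) => s == t end.
have lE t : all (near t) (l t) by rewrite /= !eqxx.
have far x y : edge x y -> near false x -> ~~ near true x && ~~ near true y.
  rewrite ladder_adj; case: x => [[s i]|[s i]]; case: y => [[s' i']|[s' i']] //=.
  - by move: (ltn_ord i) (ltn_ord i'); case: ifP => _; case: ifP => _; lia.
  - by rewrite orbF eqb_id => /andP [+ _]; case: s' => /=; move: m7; clear; lia.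
  - by rewrite eqbF_neg eqb_id; case: s => //= + _; move: m7; clear; lia.
  by rewrite eqbF_neg !eqb_id; case: s; case: s'.
have [t ut vt] : exists2 t, u \notin map f (l t) & v \notin map f (l t).
  move: uS vS euv; rewrite SE => /imsetP [x _ ->] /imsetP [y _ ->]; rewrite fE => xy.
  have out t z : ~~ near t z -> f z \notin map f (l t).
    by rewrite mem_map //; apply: contraNN => /(allP (lE t)).
  have [nx|nx] := boolP (near false x).
    by have /andP [] := far x y xy nx; exists true; apply: out.
  have [ny|ny] := boolP (near false y); last by exists false; apply: out.
  by have /andP [] := far y x ltac:(by rewrite edge_sym) ny; exists true; apply: out.
exists (f (P t false)), (f (P t true)), (f (A t 0)), (f (A t 1)), (f (A t 2)), (f (A t 3)).
split; last first.
  apply/allP => x xl; apply/and3P; split.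
  - by rewrite SE; move: xl; rewrite !inE; do 5?[case/orP]; move=> /eqP ->; apply: imset_f.
  - by apply: contraNneq ut => <-.
  - by apply: contraNneq vt => <-.
split; last first.
  rewrite -[_ :: _]/(map f (l t)) map_inj_uniq //.
  pose lab (x : ladderK33 m) : nat :=
    match x with inl (s, _) => s | inr (_, i) => i.+2 end.
  by apply: (@map_uniq _ _ lab); rewrite /= !inordK.
all: split; rewrite fE ladder_adj /= ?eqxx ?inordK //.
all: by case: (t).
Qed.

End ExtLadder.

Lemma fib_pred2 n : 6 <= n -> 3 * fib n.-2 < 2 * fib n.-1.
Proof.
case: n => [|[|[|[|k]]]] // k4; have := @fib_lt k ltac:(move: k4; clear; lia).
by rewrite -[k.+4.-2]/k.+2 -[k.+4.-1]/k.+3 (fibSS k.+1) (fibSS k); clear; lia.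
Qed.

(** * Triangles, 4-cycles and K33 minus an edge *)

Section Configurations.

Variables (T : finType) (e : rel T) (S : {set T}) (n : nat).
Hypotheses (simp : simple e) (cub : cubic_on e S) (conn : connected_on e S).
Hypotheses (SN : #|S| = n.*2) (n6 : 6 <= n).
Hypothesis IH : forall k (e' : rel T) (S' : {set T}), 1 < k < n -> cubic_graph e' S' k ->
  pm e' S' <= max_permat k /\ (pm e' S' = max_permat k -> ext e' S' k).
Hypothesis bridge_free : bridgeless e S.

Lemma nb_ex3 v a b c : v \in S -> e v a -> e v b -> e v c -> a \in S -> b \in S -> c \in S ->
  uniq [:: a; b; c] -> nb e S v a b c.
Proof.
move=> vS eva evb evc aS bS cS; rewrite /= !inE negb_or => /and3P [/andP [ab ac] bc _].
have [z nv] := nb_ex2 cub vS aS bS ab eva evb.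
case: (nb_cases nv cS evc) => E; last by rewrite E.
  by rewrite E eqxx in ac.
by rewrite E eqxx in bc.
Qed.

Lemma nb_notin u a b c y : nb e S u a b c -> y \in S ->
  y != a -> y != b -> y != c -> ~~ e u y /\ ~~ e y u.
Proof.
move=> nu yS ya yb yc; rewrite (simp.1 y u).
have euy : ~~ e u y by apply/negP => /(nb_cases nu yS) [] E; rewrite E eqxx in ya yb yc.
by [].
Qed.

(** By connectedness no proper nonempty part is closed under adjacency. The conclusion is a
    contradiction for the explicit lists to which this is applied. *)
Lemma not_all_in (r : seq T) : uniq r -> size r < n.*2 -> all (mem S) r ->
  (forall y, y \in S -> all (fun x => e x y ==> (y \in r)) r) -> r = [::].
Proof.
move=> ur sz rS cl'; have cl x y : x \in r -> y \in S -> e x y -> y \in r.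
  by move=> xr yS exy; have /allP /(_ x xr) := cl' y yS; rewrite exy.
move: {cl'} cl; case: r ur sz rS => // x r ur sz rS cl.
have clr : closed_in e S [set z in x :: r].
  move=> y z yS zS eyz; rewrite !in_set; apply/idP/idP => H; apply: cl H _ _ => //.
  by rewrite simp.1.
have xS : x \in S by case/andP: rS.
suff : #|S| <= size (x :: r) by rewrite SN leqNgt sz.
rewrite -(card_uniqP ur); apply: subset_leq_card; apply/subsetP => y yS.
by have := conn clr xS yS; rewrite !in_set mem_head => <-.
Qed.

Lemma q_end (r : seq T) c d : uniq r -> all (mem S) r ->
  c \in S :\: [set z in r] -> d \in S :\: [set z in r] -> c != d ->
  q e S (r ++ [:: c; d]) = pm e (S :\: [set z in r] :\ c :\ d).
Proof.
move=> ur rS cS dS cd; rewrite -q_setD // /q /= inE cd cS dS /=.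
by congr pm; apply/setP => x; rewrite !inE !negb_or -!andbA andbCA.
Qed.

(* If c = d, then the third edge at c would be a bridge. *)
Lemma gadget_end (r : seq T) p c p' d : uniq r -> all (mem S) r ->
  p \in r -> p' \in r -> p != p' -> c \in S :\: [set z in r] -> d \in S :\: [set z in r] ->
  e p c -> e p' d ->
  (forall x, x \in S :\: [set z in r] -> \sum_(z <- r) e x z = (x == c) + (x == d)) ->
  end_at e S (S :\: [set z in r]) c d.
Proof.
move=> ur rS pr p'r pp' cS' dS' epc epd sumr; have [esym eirr] := simp.
have rSP z : z \in r -> z \in S by move=> zr; apply: (allP rS).
have edge_r x z : x \in S :\: [set z in r] -> z \in r -> e x z -> x = c \/ x = d.
  move=> xS zr exz; have := sumr x xS; rewrite (bigD1_seq z) //= exz.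
  by case: eqVneq => [->|_]; [left | case: eqVneq => [->|]; [right|]].
split=> //; first exact: subsetDl.
  apply/eqP => cdE; rewrite -cdE in dS' epd sumr edge_r.
  move: (cS'); rewrite !inE => /andP [cr cS].
  have [g nc] := nb_ex2 cub cS (rSP _ pr) (rSP _ p'r) pp'
    ltac:(by rewrite esym) ltac:(by rewrite esym).
  have [_ pS p'S gS] := nb_in nc; have [_ _ ecg] := nb_edges nc.
  have [[_ _ cg _ pg] p'g] := nb_neq simp nc.
  have gr : g \notin r.
    have := cub cS; rewrite (deg_setD e c ur rS) (sumr c cS') eqxx.
    rewrite (deg_nb nc (subsetDl _ _)) !inE pr p'r /= => gS'.
    by apply/negP => gr; rewrite gr in gS'.
  have := @bridge_free c g (S :\: [set z in r] :\ c) cS gS ecg.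
  rewrite !inE eqxx eq_sym cg gr gS /= => H; suff : false = true by []; apply: H => x y.
  have key x' y' : x' \in S -> y' \in S -> e x' y' -> ~ (x' = g /\ y' = c) ->
      x' \in S :\: [set z in r] :\ c -> y' \in S :\: [set z in r] :\ c.
    move=> xS yS exy n2; rewrite in_setD1 => /andP [xc xr]; rewrite in_setD1.
    have xr' := xr; rewrite !inE in xr'; case/andP: xr' => xr' _.
    have yr : y' \notin r.
      apply/negP => yr; case: (edge_r x' y' xr yr exy) => E; by rewrite E eqxx in xc.
    rewrite !inE yr yS !andbT; apply/negP => /eqP yc; case: n2; split=> //.
    move: exy; rewrite yc esym => /(nb_cases nc xS) [] // E.
      by rewrite E pr in xr'.
    by rewrite E p'r in xr'.
  move=> xS yS exy n1 n2; apply/idP/idP; first exact: key.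
  by apply: key => //; [rewrite esym | case=> yg xc; apply: n1].
move=> x xS'; have /setDP [xS _] := xS'.
by rewrite -addnA -sumr // -deg_setD ?cub.
Qed.

(** [end_bound] with j = 0 for what lies behind a gadget of 2k vertices with two outgoing edges; the
    weights are f_3 = 2 and f_2 = 1. *)
Lemma gadget_bound (r : seq T) k p c p' d : uniq r -> all (mem S) r ->
  p \in r -> p' \in r -> p != p' -> c \in S :\: [set z in r] -> d \in S :\: [set z in r] ->
  e p c -> e p' d -> size r = k.*2 -> k <= n ->
  (forall x, x \in S :\: [set z in r] -> \sum_(z <- r) e x z = (x == c) + (x == d)) ->
  2 * q e S r + q e S (r ++ [:: c; d]) <= 2 * fib (n - k).+2 /\
  (2 * q e S r + q e S (r ++ [:: c; d]) = 2 * fib (n - k).+2 ->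
   3 <= n - k /\ tail e (S :\: [set z in r]) c d (n - k).-2).
Proof.
move=> ur rS pr p'r pp' cS' dS' epc epd szr kn sumr.
have En := gadget_end ur rS pr p'r pp' cS' dS' epc epd sumr.
have [_ _ _ cd _] := En.
have k0 : 0 < k by rewrite -double_gt0 -szr; case: (r) pr.
have kn' : n - k < n by rewrite ltn_subrL k0 (leq_trans _ n6).
have SrN : #|S :\: [set z in r]| = (n - k).*2 by rewrite card_setD_seq // SN szr doubleB.
have := end_bound simp cub conn bridge_free IH 0 kn' En SrN; cbv zeta.
by rewrite -q_end // -(pm_setD e ur rS) addn0 -[fib 3]/2 -[fib 2]/1 mul1n.
Qed.

Definition K33_ends m := exists p q a b c d c0 d0 S0,
  [/\ K33e_on e p q a b c d, S0 = S :\: [set z in [:: p; q; a; b; c; d]],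
      e p c0, e q d0 & tail e S0 c0 d0 m].

(** K33 minus the edge p q has four perfect matchings, and two after removal of [p] and [q]. So the
    total is 4 X + 2 Y, twice the quantity 2 X + Y of [gadget_bound]. *)
Lemma K33e_case : K33e e S -> pm e S <= max_permat n /\
  (pm e S = max_permat n -> K33_ends (n - 5)).
Proof.
move=> [p [q' [a [b [c [d [K rS]]]]]]]; have [esym eirr] := simp.
have [[ab bc cd da] [pa pc qb qd] ur] := K.
have [[pS qS aS] [bS cS dS]] : [/\ p \in S, q' \in S & a \in S] /\
    [/\ b \in S, c \in S & d \in S].
  by move: rS => /= /and5P [-> -> -> -> /and3P [-> -> _]].
have := ur; rewrite /= !inE !negb_or.
move=> /and5P [/and5P [pq pa' pb pc' pd] /and4P [qa qb' qc qd'] /and3P [ab' ac ad] /andP [bc' bd] /andP [cd' _]].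
have na : nb e S a b d p by apply: nb_ex3; rewrite ?(esym a d) ?(esym a p) //= !inE !negb_or bd (eq_sym b) pb (eq_sym d) pd.
have nb' : nb e S b a c q' by apply: nb_ex3; rewrite ?(esym b a) ?(esym b q') //= !inE !negb_or ac (eq_sym a) qa (eq_sym c) qc.
have nc : nb e S c b d p by apply: nb_ex3; rewrite ?(esym c b) ?(esym c p) //= !inE !negb_or bd (eq_sym b) pb (eq_sym d) pd.
have nd : nb e S d a c q' by apply: nb_ex3; rewrite ?(esym d c) ?(esym d q') //= !inE !negb_or ac (eq_sym a) qa (eq_sym c) qc.
have [c0 np] := nb_ex2 cub pS aS cS ac pa pc.
have [d0 nq] := nb_ex2 cub qS bS dS bd qb qd.
have [_ _ _ c0S] := nb_in np; have [_ _ _ d0S] := nb_in nq.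
have [_ _ pc0] := nb_edges np; have [_ _ qd0] := nb_edges nq.
have [[_ _ pc0' _ ac0] cc0] := nb_neq simp np; have [[_ _ qd0' _ bd0] dd0] := nb_neq simp nq.
set r := [:: p; q'; a; b; c; d] in ur.
have sz : size r < n.*2 by rewrite /=; move: n6; clear; lia.
(* With this edge the six vertices would be a whole component, but the graph has at least twelve
   vertices. *)
have epq : ~~ e p q'.
  apply/negP => epq; suff : r = [::] by [].
  have np' : nb e S p a c q' by apply: nb_ex3; rewrite //= !inE !negb_or ac (eq_sym a) qa (eq_sym c) qc.
  have nq' : nb e S q' b d p by apply: nb_ex3; rewrite ?(esym q' p) //= !inE !negb_or bd (eq_sym b) pb (eq_sym d) pd.
  by apply: (not_all_in ur sz rS) => y yS; solve_closed yS.
have c0r : c0 \notin r.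
  rewrite !inE !negb_or !(eq_sym c0) pc0' ac0 cc0 /=.
  have n1 : q' != c0 by apply: contraNneq epq => ->.
  have n2 : b != c0 by apply: contraTneq pc0 => <-; case: (nb_notin nb' pS pa' pc' pq).
  have n3 : d != c0 by apply: contraTneq pc0 => <-; case: (nb_notin nd pS pa' pc' pq).
  by rewrite n1 n2 n3.
have d0r : d0 \notin r.
  have qp : q' != p by rewrite eq_sym.
  rewrite !inE !negb_or !(eq_sym d0) qd0' bd0 dd0 /=.
  have n1 : p != d0 by apply: contraNneq epq => ->; rewrite esym.
  have n2 : a != d0 by apply: contraTneq qd0 => <-; case: (nb_notin na qS qb' qd' qp).
  have n3 : c != d0 by apply: contraTneq qd0 => <-; case: (nb_notin nc qS qb' qd' qp).
  by rewrite n1 n2 n3.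
have E := @gadget_expand _ e S r c0 [:: c0; d0] [:: [:: 2; 4; 6]; [:: 3; 5; 7];
  [:: 3; 5; 0]; [:: 2; 4; 1]; [:: 3; 5; 0]; [:: 2; 4; 1]] [::] simp ur
  ltac:(by rewrite /= c0r d0r) isT
  (conj np (conj nq (conj na (conj nb' (conj nc (conj nd I)))))).
expand_gadget E.
have pr : p \in r by rewrite !inE eqxx.
have qr : q' \in r by rewrite !inE eqxx orbT.
have [le eq] := @gadget_bound r 3 p c0 q' d0 ur rS pr qr pq (in_rest c0S c0r) (in_rest d0S d0r)
  pc0 qd0 erefl (leq_trans (isT : 3 <= 6) n6) ltac:(
  move=> x xS; have /setDP [xS' _] := xS;
  rewrite !big_cons big_nil addn0 (nb_sum np esym xS') (nb_sum nq esym xS') (nb_sum na esym xS')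
   (nb_sum nb' esym xS') (nb_sum nc esym xS') (nb_sum nd esym xS');
  move: (rest_all xS); rewrite /=; do 6![case/andP=> /eqP ->];
  by rewrite !addn0 !add0n).
have pmE : pm e S = 2 * (2 * q e S r + q e S (r ++ [:: c0; d0])).
  by rewrite -q_nil E /=; move: (q e S r) (q e S _) => A B; clear; lia.
have n3 : (n - 3).+2 = n.-1 by move: n6; clear; lia.
rewrite n3 in le eq; rewrite max_permat_fib // pmE (_ : 4 = 2 * 2) // -mulnA leq_pmul2l //.
split=> // /eqP; rewrite eqn_pmul2l // => /eqP /eq [_ tl].
exists p, q', a, b, c, d, c0, d0, (S :\: [set z in r]); split=> //.
by rewrite (_ : n - 5 = (n - 3).-2) //; clear; lia.
Qed.

Lemma two_fib_lt : 2 * fib n < max_permat n.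
Proof.
rewrite max_permat_fib //; case: n n6 => [|[|m]] // m4.
by have := @fib_lt m ltac:(move: m4; clear; lia); rewrite (fibSS m) [_.-1]/=; clear; lia.
Qed.

(* w is joined to x and y, forming K4 minus the edge z w. *)
Lemma diamond_case x y z w : nb e S x y z w -> nb e S y x z w -> e x y -> z \in S -> e z x ->
  pm e S < max_permat n.
Proof.
move=> nx ny exy zS ezx; have [esym eirr] := simp.
have [xS yS _ wS] := nb_in nx; have [_ exz exw] := nb_edges nx; have [_ eyz eyw] := nb_edges ny.
have [[xy xz xw yz yw] zw] := nb_neq simp nx.
have [z' nz] : exists z', nb e S z x y z' by apply: nb_ex2; rewrite // 1?esym.
have [w' nw] : exists w', nb e S w x y w' by apply: nb_ex2; rewrite // 1?esym.
have [_ _ _ z'S] := nb_in nz; have [_ _ _ w'S] := nb_in nw.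
have [_ _ ezz'] := nb_edges nz; have [_ _ eww'] := nb_edges nw.
have [[_ _ zz' _ xz'] yz'] := nb_neq simp nz; have [[_ _ ww' _ xw'] yw'] := nb_neq simp nw.
set r := [:: x; y; z; w].
have ur : uniq r by rewrite /= !inE !negb_or xy xz xw yz yw zw.
have rS : all (mem S) r by rewrite /= xS yS zS wS.
have sz : size r < n.*2 by rewrite /=; move: n6; clear; lia.
have ezw : ~~ e z w.
  apply/negP => ezw; suff : r = [::] by [].
  have nz' : nb e S z x y w by apply: nb_ex3; rewrite // 1?esym //= !inE !negb_or xy xw yw.
  have nw2 : nb e S w x y z by apply: nb_ex3; rewrite // 1?esym //= !inE !negb_or xy xz yz.
  by apply: (not_all_in ur sz rS) => u uS; solve_closed uS.
have z'r : z' \notin r.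
  rewrite !inE !negb_or !(eq_sym z') xz' yz' zz' /=.
  by apply: contraNneq ezw => ->.
have w'r : w' \notin r.
  rewrite !inE !negb_or !(eq_sym w') xw' yw' ww' andbT /=.
  by apply: contraNneq ezw => ->; rewrite esym.
have E := @gadget_expand _ e S r z' [:: z'; w'] [:: [:: 1; 2; 3]; [:: 0; 2; 3];
  [:: 0; 1; 4]; [:: 0; 1; 5]] [::] simp ur
  ltac:(by rewrite /= z'r w'r) isT (conj nx (conj ny (conj nz (conj nw I)))).
expand_gadget E.
have zr : z \in r by rewrite !inE eqxx !orbT.
have wr : w \in r by rewrite !inE eqxx !orbT.
(* K4 minus z w has two perfect matchings, and one once [z] and [w] are matched outside; the total
   is 2 X + Y <= 2 f_n. *)
have [le _] := @gadget_bound r 2 z z' w w' ur rS zr wr zw (in_rest z'S z'r) (in_rest w'S w'r)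
  ezz' eww' erefl (leq_trans (isT : 2 <= 6) n6) ltac:(
  move=> u uS; have /setDP [uS' _] := uS;
  rewrite !big_cons big_nil addn0 (nb_sum nx esym uS') (nb_sum ny esym uS')
   (nb_sum nz esym uS') (nb_sum nw esym uS');
  move: (rest_all uS); rewrite /=; do 4![case/andP=> /eqP ->];
  by rewrite !addn0 !add0n).
rewrite -q_nil E; apply: leq_ltn_trans two_fib_lt.
have n2 : (n - 2).+2 = n by move: n6; clear; lia.
rewrite n2 in le; apply: leq_trans le => /=.
by move: (q e S r) (q e S _) => A B; clear; lia.
Qed.

(* The triangle x y z whose outer neighbours x', y', z' satisfy x' ~ y', z':
   the triangular prism without the edge y' z'. *)
Lemma prism_case x y z x' y' z' : nb e S x y z x' -> nb e S y x z y' -> nb e S z x y z' ->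
  nb e S x' x y' z' -> pm e S < max_permat n.
Proof.
move=> nx ny nz nx'; have [esym eirr] := simp.
have [xS yS zS x'S] := nb_in nx; have [_ _ _ y'S] := nb_in ny; have [_ _ _ z'S] := nb_in nz.
have [exy exz exx'] := nb_edges nx; have [_ _ eyy'] := nb_edges ny.
have [_ _ ezz'] := nb_edges nz; have [_ ex'y' ex'z'] := nb_edges nx'.
have [[xy xz xx' yz yx'] zx'] := nb_neq simp nx.
have [[_ _ yy' _ xy'] zy'] := nb_neq simp ny.
have [[_ _ zz' _ xz'] yz'] := nb_neq simp nz.
have [[_ x'y' x'z' _ _] y'z'] := nb_neq simp nx'.
have [y2 ny'] : exists y2, nb e S y' y x' y2 by apply: nb_ex2; rewrite // 1?esym.
have [z2 nz'] : exists z2, nb e S z' z x' z2 by apply: nb_ex2; rewrite // 1?esym.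
have [_ _ _ y2S] := nb_in ny'; have [_ _ _ z2S] := nb_in nz'.
have [_ _ ey2] := nb_edges ny'; have [_ _ ez2] := nb_edges nz'.
have [[_ _ y'y2 _ yy2] x'y2] := nb_neq simp ny'.
have [[_ _ z'z2 _ zz2] x'z2] := nb_neq simp nz'.
set r := [:: x; y; z; x'; y'; z'].
have ur : uniq r by rewrite /= !inE !negb_or xy xz xx' yz yx' zx' xy' yy' zy' xz' yz' zz' x'y' x'z' y'z'.
have rS : all (mem S) r by rewrite /= xS yS zS x'S y'S z'S.
have sz : size r < n.*2 by rewrite /=; move: n6; clear; lia.
have ey'z' : ~~ e y' z'.
  apply/negP => ey'z'; suff : r = [::] by [].
  have ny3 : nb e S y' y x' z' by apply: nb_ex3; rewrite // 1?esym //= !inE !negb_or yx' yz' x'z'.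
  have nz3 : nb e S z' z x' y' by apply: nb_ex3; rewrite // 1?esym //= !inE !negb_or zx' zy' x'y'.
  by apply: (not_all_in ur sz rS) => u uS; solve_closed uS.
have y2r : y2 \notin r.
  rewrite !inE !negb_or !(eq_sym y2) yy2 x'y2 y'y2 /=.
  have n1 : x != y2.
    by apply: contraTneq ey2 => <-; case: (nb_notin nx y'S); rewrite // eq_sym.
  have n2 : z != y2.
    by apply: contraTneq ey2 => <-; case: (nb_notin nz y'S); rewrite // eq_sym.
  by rewrite n1 n2 /=; apply: contraNneq ey'z' => ->.
have z2r : z2 \notin r.
  rewrite !inE !negb_or !(eq_sym z2) zz2 x'z2 z'z2 andbT /=.
  have n1 : x != z2.
    by apply: contraTneq ez2 => <-; case: (nb_notin nx z'S); rewrite // eq_sym.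
  have n2 : y != z2.
    by apply: contraTneq ez2 => <-; case: (nb_notin ny z'S); rewrite // eq_sym.
  by rewrite n1 n2 /=; apply: contraNneq ey'z' => ->; rewrite esym.
have E := @gadget_expand _ e S r y2 [:: y2; z2] [:: [:: 1; 2; 3]; [:: 0; 2; 4];
  [:: 0; 1; 5]; [:: 0; 4; 5]; [:: 1; 3; 6]; [:: 2; 3; 7]] [::] simp ur
  ltac:(by rewrite /= y2r z2r) isT
  (conj nx (conj ny (conj nz (conj nx' (conj ny' (conj nz' I)))))).
expand_gadget E.
have y'r : y' \in r by rewrite !inE eqxx !orbT.
have z'r : z' \in r by rewrite !inE eqxx !orbT.
have [le _] := @gadget_bound r 3 y' y2 z' z2 ur rS y'r z'r y'z' (in_rest y2S y2r)
  (in_rest z2S z2r) ey2 ez2 erefl (leq_trans (isT : 3 <= 6) n6) ltac:(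
  move=> u uS; have /setDP [uS' _] := uS;
  rewrite !big_cons big_nil addn0 (nb_sum nx esym uS') (nb_sum ny esym uS')
   (nb_sum nz esym uS') (nb_sum nx' esym uS') (nb_sum ny' esym uS') (nb_sum nz' esym uS');
  move: (rest_all uS); rewrite /=; do 6![case/andP=> /eqP ->];
  by rewrite !addn0 !add0n).
(* The prism minus an edge has three perfect matchings, and one without [y'] and [z']. Thus the
   total is 3 X + Y, at most 3/2 times 2 X + Y, hence at most 3 f_{n-1}. *)
have n3 : (n - 3).+2 = n.-1 by move: n6; clear; lia.
have f0 : 0 < fib n.-1 by move: n6; case: (n) => [|[|m]] // _; apply: fib_gt0.
rewrite n3 in le; rewrite -q_nil E max_permat_fib //.
move: le f0; rewrite /= -/r; move: (q e S r) (q e S _) (fib _) => A B F; clear; lia.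
Qed.

(* Swapping at the edge x x' in both ways and contracting the triangle. *)
Lemma triangle_swap x y z x' y' z' : nb e S x y z x' -> nb e S y x z y' ->
  nb e S z x y z' -> uniq [:: x'; y'; z'] -> ~~ e x' y' -> ~~ e x' z' ->
  pm e S < max_permat n.
Proof.
move=> nx ny nz; rewrite /= !inE negb_or => /and3P [/andP [x'y' x'z'] y'z' _] ex'y' ex'z'.
have [esym eirr] := simp.
have [xS yS zS x'S] := nb_in nx; have [_ _ _ y'S] := nb_in ny; have [_ _ _ z'S] := nb_in nz.
have [exy exz exx'] := nb_edges nx; have [_ eyz eyy'] := nb_edges ny.
have [_ _ ezz'] := nb_edges nz.
have [[xy xz xx' yz yx'] zx'] := nb_neq simp nx.
have [[_ _ yy' _ xy'] zy'] := nb_neq simp ny.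
have [[_ _ zz' _ xz'] yz'] := nb_neq simp nz.
have [s [t nx']] := nb_ex1 cub x'S xS ltac:(by rewrite esym).
have [_ _ sS tS] := nb_in nx'; have [_ ex's ex't] := nb_edges nx'.
have [[_ x's x't xs xt] st] := nb_neq simp nx'.
have neq_adj u w w' : e u w -> ~~ e u w' -> w != w'.
  by move=> euw; apply: contraNneq => <-.
have nex'y : ~~ e x' y by case: (nb_notin ny x'S); rewrite // eq_sym.
have nex'z : ~~ e x' z by case: (nb_notin nz x'S); rewrite // eq_sym.
have [sy sz sy' sz'] : [/\ s != y, s != z, s != y' & s != z'].
  by split; apply: neq_adj ex's _.
have [ty tz ty' tz'] : [/\ t != y, t != z, t != y' & t != z'].
  by split; apply: neq_adj ex't _.
have sx : s != x by rewrite eq_sym.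
have tx : t != x by rewrite eq_sym.
have eys : ~~ e y s by case: (nb_notin ny sS sx sz sy').
have eyt : ~~ e y t by case: (nb_notin ny tS tx tz ty').
have ezs : ~~ e z s by case: (nb_notin nz sS sx sy sz').
have ezt : ~~ e z t by case: (nb_notin nz tS tx ty tz').
have u1 : uniq [:: y; z; s; t] by rewrite /= !inE !negb_or yz !(eq_sym y) !(eq_sym z) sy ty sz tz st.
have u2 : uniq [:: y; z; t; s] by rewrite /= !inE !negb_or yz !(eq_sym y) !(eq_sym z) sy ty sz tz eq_sym st.
have n0 := pred_range n6.
(* The edge y z stays in the graph, so no cut separates [y] from [z] and both swaps are
   connected. *)
have nosplit (C : {set T}) : closed_in e (S :\: [set w in [:: x; x']]) C ->
    y \in C -> z \notin C -> False.
  move=> cl yC /negP []; rewrite -(cl y z) // in_setD2.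
    by rewrite yS eq_sym xy yx'.
  by rewrite zS eq_sym xz zx'.
have [pm1 [G1|[C [cl yC _ zC _]]]] := edge_swap simp cub conn SN (nb_rot (nb_rot nx)) nx' u1 eys ezt;
  last by case: (nosplit C).
have [pm2 [G2|[C [cl yC _ zC _]]]] := edge_swap simp cub conn SN (nb_rot (nb_rot nx)) (nb_rot (nb_swap nx')) u2 eyt ezs;
  last by case: (nosplit C).
have [le1 _] := IH n0 G1; have [le2 _] := IH n0 G2; rewrite pm1 in le1; rewrite pm2 in le2.
pose r := [:: y; z].
have ur : uniq r by rewrite /= inE yz.
have rS : all (mem S) r by rewrite /= yS zS.
have exy' : ~~ e x y' by case: (nb_notin nx y'S); rewrite // eq_sym.
have exz' : ~~ e x z' by case: (nb_notin nx z'S); rewrite // eq_sym.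
have exz'' : ~~ add x y' e x z'.
  by rewrite /add eqxx (negbTE exz') (negbTE xy') /= eq_sym (negbTE y'z').
have xr : x \in S :\: [set w in r] by apply: in_rest; rewrite // /r !inE negb_or xy xz.
have y'r : y' \in S :\: [set w in r].
  by apply: in_rest; rewrite // /r !inE negb_or !(eq_sym y') yy' zy'.
have z'r : z' \in S :\: [set w in r].
  by apply: in_rest; rewrite // /r !inE negb_or !(eq_sym z') yz' zz'.
have G3 : cubic_graph (add x z' (add x y' e)) (S :\: [set w in r]) n.-1.
  have simp1 := simple_add xy' simp; split.
  - exact: simple_add.
  - apply: cubic_add2 => // w wr; have /setDP [wS _] := wr.
    rewrite !big_cons big_nil addn0 (nb_sum ny esym wS) (nb_sum nz esym wS).
    move: (rest_all wr); rewrite /=; do 2![case/andP=> /eqP ->].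
    by rewrite !addn0 addnA.
  - apply: (connected_const esym _ conn); first by apply/subsetP => w; rewrite !inE => /orP [] /eqP ->.
    move=> C cl; have [cl1 xz'C] := closed_add xr z'r cl.
    have [cl0 xy'C] := closed_add xr y'r cl1; split=> //; exists (x \in C) => w w' wr.
    have /setDP [wS wr'] := wr; rewrite !inE negb_or in wr'; case/andP: wr' => wy wz.
    rewrite !inE => /orP [] /eqP ->; rewrite esym.
      by move=> /(nb_cases ny wS) [] E; rewrite E ?eqxx ?xy'C // in wy wz *.
    by move=> /(nb_cases nz wS) [] E; rewrite E ?eqxx ?xz'C // in wy wz *.
  by rewrite card_setD_seq // SN -subn1 doubleB.
have [le3 _] := IH n0 G3; rewrite pm_add2 // in le3.
pose gs := [:: x; y; z; x'].
have ugs : uniq gs by rewrite /= !inE !negb_or xy xz xx' yz yx' zx'.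
have tgs : all (fun w => w \notin gs) [:: y'; y'; z'; s; t].
  rewrite /= !inE !negb_or !(eq_sym y') !(eq_sym z') xy' yy' zy' x'y' xz' yz' zz' x'z'.
  by rewrite sx sy sz tx ty tz !(eq_sym _ x') x's x't.
have E l := @gadget_expand _ e S gs y' [:: y'; z'; s; t] [:: [:: 1; 2; 3]; [:: 0; 2; 4];
  [:: 0; 1; 5]; [:: 0; 6; 7]] l simp ugs tgs isT (conj nx (conj ny (conj nz (conj nx' I)))).
have E0 := E [::]; expand_gadget E0.
have Ea1 := E [:: 0; 3]; expand_gadget Ea1.
have Ea2 := E [:: 0; 3; 1; 6]; expand_gadget Ea2.
have Ea3 := E [:: 0; 3; 2; 7]; expand_gadget Ea3.
have Eb2 := E [:: 0; 3; 1; 7]; expand_gadget Eb2.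
have Eb3 := E [:: 0; 3; 2; 6]; expand_gadget Eb3.
have Ec1 := E [:: 1; 2]; expand_gadget Ec1.
have Ec2 := E [:: 1; 2; 0; 4]; expand_gadget Ec2.
have Ec3 := E [:: 1; 2; 0; 5]; expand_gadget Ec3.
rewrite Ea1 Ea2 Ea3 in le1; rewrite Ea1 Eb2 Eb3 in le2; rewrite /= Ec1 Ec2 Ec3 in le3.
(* Let Q count the matchings containing all of x x', y y', z z'. The swaps give PerMat + Q <= 2
   m_{n-1}; the contraction loses exactly these matchings, so PerMat - Q <= m_{n-1}. Adding yields 2
   PerMat <= 3 m_{n-1}. *)
have m := max_permat_pred n6.
rewrite -q_nil E0.
move: le1 le2 le3 m; move: (max_permat n) (max_permat n.-1) => M m.
by clear; lia.
Qed.

(** Equal outer neighbours give a diamond, two edges among the outer neighbours a prism without an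
    edge. Otherwise some outer neighbour is adjacent to neither of the others, and the swap is made
    there. *)
Lemma triangle_case x y z : x \in S -> y \in S -> z \in S -> e x y -> e x z -> e y z ->
  pm e S < max_permat n.
Proof.
move=> xS yS zS exy exz eyz; have [esym eirr] := simp.
have neq u w : e u w -> u != w by apply: contraTneq => ->; rewrite eirr.
have [x' nx] := nb_ex2 cub xS yS zS (neq _ _ eyz) exy exz.
have [y' ny] : exists y', nb e S y x z y' by apply: nb_ex2; rewrite // 1?esym // neq.
have [z' nz] : exists z', nb e S z x y z' by apply: nb_ex2; rewrite // 1?esym // neq.
have [_ _ _ x'S] := nb_in nx; have [_ _ _ y'S] := nb_in ny; have [_ _ _ z'S] := nb_in nz.
have [_ _ exx'] := nb_edges nx; have [_ _ eyy'] := nb_edges ny; have [_ _ ezz'] := nb_edges nz.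
have [xy|xy'] := eqVneq x' y'.
  rewrite -xy in ny; apply: (diamond_case nx ny exy zS).
  by rewrite esym.
have [xz|xz'] := eqVneq x' z'.
  rewrite -xz in nz; apply: (diamond_case
    (nb_swap nx) nz exz yS); by rewrite esym.
have [yz|yz'] := eqVneq y' z'.
  rewrite -yz in nz; apply: (diamond_case
    (nb_swap ny) (nb_swap nz) eyz xS exy).
have nv' v v' a b : v \in S -> v' \in S -> e v v' -> v != a -> v != b -> a != b ->
    a \in S -> b \in S -> e v' a -> e v' b -> nb e S v' v a b.
  move=> vS v'S evv va vb ab aS bS ea eb.
  by apply: nb_ex3; rewrite // 1?esym //= !inE !negb_or va vb ab.
have [[_ _ _ _ yx'] zx'] := nb_neq simp nx; have [[_ _ _ _ xy''] zy'] := nb_neq simp ny.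
have [[_ _ _ _ xz''] yz''] := nb_neq simp nz.
have [exy'|exy'] := boolP (e x' y'); have [exz'|exz'] := boolP (e x' z').
- apply: (prism_case nx ny nz).
  exact: nv'.
- have [eyz'|eyz'] := boolP (e y' z').
    apply: (prism_case ny nx (nb_swap nz)).
    by apply: nv'; rewrite // 1?esym.
  apply: (triangle_swap nz (nb_swap nx) (nb_swap ny)); rewrite 1?esym //.
  by rewrite /= !inE !negb_or !(eq_sym z') xz' xy' yz'.
- have [eyz'|eyz'] := boolP (e y' z').
    apply: (prism_case nz (nb_swap nx) (nb_swap ny)).
    by apply: nv'; rewrite // 1?esym.
  apply: (triangle_swap ny nx (nb_swap nz)) => //; last by rewrite esym.
  by rewrite /= !inE !negb_or (eq_sym y' x') yz' xy' xz'.
apply: (triangle_swap nx ny nz) => //.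
by rewrite /= !inE !negb_or yz' xy' xz'.
Qed.

Hypothesis tri : triangle_free e S.

(* The cube without one vertex: m_i is joined to z and to the t_j, j != i. *)
Definition cube_vertex z m1 m2 m3 t1 t2 t3 o1 o2 o3 :=
  [/\ nb e S z m1 m2 m3,
      [/\ nb e S m1 z t2 t3, nb e S m2 z t1 t3 & nb e S m3 z t1 t2],
      [/\ nb e S t1 m2 m3 o1, nb e S t2 m1 m3 o2 & nb e S t3 m1 m2 o3]
    & uniq [:: z; m1; m2; m3; t1; t2; t3]].

Lemma cube_rot z m1 m2 m3 t1 t2 t3 o1 o2 o3 :
  cube_vertex z m1 m2 m3 t1 t2 t3 o1 o2 o3 -> cube_vertex z m2 m3 m1 t2 t3 t1 o2 o3 o1.
Proof.
case=> nz [n1 n2 n3] [k1 k2 k3] u; split.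
- exact: nb_rot.
- by split=> //; apply: nb_rot (nb_swap _).
- by split=> //; apply: nb_swap.
by rewrite -(perm_uniq (s1 := [:: z; m1; m2; m3; t1; t2; t3])) //;
   apply/permP => p /=; clear; lia.
Qed.

Lemma nb_nadj u a b c y y' : nb e S u a b c -> y \in S -> e y y' ->
  y != a -> y != b -> y != c -> y' != u.
Proof.
move=> nu yS eyy' ya yb yc; apply: contraTneq eyy' => ->.
by case: (nb_notin nu yS ya yb yc).
Qed.

Lemma cube_out z m1 m2 m3 t1 t2 t3 o1 o2 o3 :
  cube_vertex z m1 m2 m3 t1 t2 t3 o1 o2 o3 -> o1 \notin [:: z; m1; m2; m3; t1; t2; t3].
Proof.
case=> nz [n1 n2 n3] [k1 k2 k3] u; have [esym eirr] := simp.
have [zS m1S m2S m3S] := nb_in nz; have [t1S _ _ o1S] := nb_in k1.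
have [_ _ t2S t3S] := nb_in n1; have [_ _ eto] := nb_edges k1.
have [[_ _ t1o _ m2o] m3o] := nb_neq simp k1.
have [_ e2 e2'] := nb_edges n2; have [_ e3 e3'] := nb_edges n3.
neqs u; rewrite !inE !negb_or; do ?[apply/andP; split]; try neq.
- by apply: (nb_nadj nz t1S eto); neq.
- by apply: (nb_nadj n1 t1S eto); neq.
- by apply: contraTneq eto => ->; apply: (tri m3S).
- by apply: contraTneq eto => ->; apply: (tri m2S).
Qed.

(* Two of the outer edges meet in w: the cube without the edge t1 w. *)
Lemma cube_edge_case z m1 m2 m3 t1 t2 t3 o1 w :
  cube_vertex z m1 m2 m3 t1 t2 t3 o1 w w -> pm e S < max_permat n.
Proof.
move=> K; have o1g := cube_out K; have wg := cube_out (cube_rot K).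
case: K => nz [n1 n2 n3] [k1 k2 k3] u; have [esym eirr] := simp.
have [zS m1S m2S m3S] := nb_in nz; have [t1S _ _ o1S] := nb_in k1.
have [t2S _ _ wS] := nb_in k2; have [t3S _ _ _] := nb_in k3.
have [_ _ eto] := nb_edges k1; have [_ _ et2w] := nb_edges k2; have [_ _ et3w] := nb_edges k3.
have ugs := u; neqs u; neqs o1g; neqs wg.
have [w' nw] : exists w', nb e S w t2 t3 w' by apply: nb_ex2; rewrite // 1?esym.
have [_ _ _ w'S] := nb_in nw; have [_ _ eww'] := nb_edges nw.
have [[_ _ ww' _ t2w'] t3w'] := nb_neq simp nw.
set r := [:: z; m1; m2; m3; t1; t2; t3; w].
have ur : uniq r.
  by rewrite /= !inE !negb_or; do ?[apply/andP; split] => //; neq.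
have rS : all (mem S) r by rewrite /= zS m1S m2S m3S t1S t2S t3S wS.
have sz : size r < n.*2 by rewrite /=; move: n6; clear; lia.
have ewt1 : ~~ e w t1.
  apply/negP => ewt1; suff : r = [::] by [].
  have nw' : nb e S w t1 t2 t3.
    by apply: nb_ex3; rewrite // 1?esym //= !inE !negb_or; do ?[apply/andP; split] => //; neq.
  have k1' : nb e S t1 m2 m3 w.
    by apply: nb_ex3 => //; rewrite ?(esym t1) //; try (first [by case: (nb_edges n2) | by case: (nb_edges n3)]);
      rewrite /= !inE !negb_or; do ?[apply/andP; split] => //; neq.
  by apply: (not_all_in ur sz rS) => y yS; solve_closed yS.
have o1w : o1 != w by apply: contraNneq ewt1 => <-; rewrite esym.
have o1r : o1 \notin r.
  by rewrite !inE !negb_or; do ?[apply/andP; split] => //; neq.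
have w't1 : w' != t1 by apply: contraNneq ewt1 => <-.
have w'r : w' \notin r.
  rewrite !inE !negb_or; do ?[apply/andP; split]; try neq.
  - by apply: (nb_nadj nz wS eww'); neq.
  - by apply: (nb_nadj n1 wS eww'); neq.
  - by apply: (nb_nadj n2 wS eww'); neq.
  - by apply: (nb_nadj n3 wS eww'); neq.
have E := @gadget_expand _ e S r o1 [:: o1; w'] [:: [:: 1; 2; 3]; [:: 0; 5; 6];
  [:: 0; 4; 6]; [:: 0; 4; 5]; [:: 2; 3; 8]; [:: 1; 3; 7]; [:: 1; 2; 7]; [:: 5; 6; 9]] [::] simp ur
  ltac:(by rewrite /= o1r w'r) isT
  (conj nz (conj n1 (conj n2 (conj n3 (conj k1 (conj k2 (conj k3 (conj nw I)))))))).
expand_gadget E.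
have t1r : t1 \in r by rewrite !inE eqxx !orbT.
have wr : w \in r by rewrite !inE eqxx !orbT.
have t1w : t1 != w by neq.
have [le _] := @gadget_bound r 4 t1 o1 w w' ur rS
  t1r wr t1w (in_rest o1S o1r) (in_rest w'S w'r) eto eww' erefl (leq_trans (isT : 4 <= 6) n6) ltac:(
  move=> y yS; have /setDP [yS' _] := yS;
  rewrite !big_cons big_nil addn0 (nb_sum nz esym yS') (nb_sum n1 esym yS') (nb_sum n2 esym yS')
   (nb_sum n3 esym yS') (nb_sum k1 esym yS') (nb_sum k2 esym yS') (nb_sum k3 esym yS')
   (nb_sum nw esym yS');
  move: (rest_all yS); rewrite /=; do 8![case/andP=> /eqP ->];
  by rewrite !addn0 !add0n).
(* The cube has nine perfect matchings, three through each edge. Without the edge t1 w six remain,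
   and three if both ends are matched outside: the total is 3 (2 X + Y) <= 6 f_{n-2}. *)
have n4 : (n - 4).+2 = n.-2 by move: n6; clear; lia.
rewrite n4 in le; rewrite -q_nil E max_permat_fib //.
have f2 := fib_pred2 n6.
move: le f2; rewrite /= -/r; move: (q e S r) (q e S _) (fib n.-1) (fib n.-2) => A B F F'.
by clear; lia.
Qed.

(** The seven vertices are contracted to [t1], adjacent to o1, o2, o3. By parity a matching leaves
    them through one or three of the t_i. Three is impossible, since then only the star at [z]
    remains; and after any single exit there are three completions. Hence PerMat(G) is three times
    the number of the contracted graph, at most 3 m_{n-3}. *)
Lemma cube_vertex_case z m1 m2 m3 t1 t2 t3 o1 o2 o3 :
  cube_vertex z m1 m2 m3 t1 t2 t3 o1 o2 o3 -> pm e S < max_permat n.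
Proof.
move=> K.
have [o23|o23] := eqVneq o2 o3.
  by rewrite -o23 in K; apply: (cube_edge_case K).
have [o13|o13] := eqVneq o3 o1.
  have K' := cube_rot K; rewrite o13 in K'.
  by apply: (cube_edge_case K').
have [o12|o12] := eqVneq o1 o2.
  have K' := cube_rot (cube_rot K); rewrite -o12 in K'.
  by apply: (cube_edge_case K').
have o1g := cube_out K; have o2g := cube_out (cube_rot K).
have o3g := cube_out (cube_rot (cube_rot K)).
case: K => nz [n1 n2 n3] [k1 k2 k3] u; have [esym eirr] := simp.
have [zS m1S m2S m3S] := nb_in nz; have [t1S _ _ o1S] := nb_in k1.
have [t2S _ _ o2S] := nb_in k2; have [t3S _ _ o3S] := nb_in k3.
have [_ _ et1] := nb_edges k1; have [_ _ et2] := nb_edges k2; have [_ _ et3] := nb_edges k3.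
have ugs := u; neqs u; neqs o1g; neqs o2g; neqs o3g.
pose r := [:: z; m1; m2; m3; t2; t3].
have ur : uniq r.
  by rewrite /= !inE !negb_or; do ?[apply/andP; split] => //; neq.
have rS : all (mem S) r by rewrite /= zS m1S m2S m3S t2S t3S.
have t1r : t1 \in S :\: [set w in r].
  by apply: in_rest => //; rewrite /r !inE !negb_or; do ?[apply/andP; split]; neq.
have o2r : o2 \in S :\: [set w in r].
  by apply: in_rest => //; rewrite /r !inE !negb_or; do ?[apply/andP; split]; neq.
have o3r : o3 \in S :\: [set w in r].
  by apply: in_rest => //; rewrite /r !inE !negb_or; do ?[apply/andP; split]; neq.
have t1o2 : t1 != o2 by neq.
have t1o3 : t1 != o3 by neq.
have [et1o2 _] : ~~ e t1 o2 /\ ~~ e o2 t1 by apply: (nb_notin k1 o2S); neq.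
have [et1o3 _] : ~~ e t1 o3 /\ ~~ e o3 t1 by apply: (nb_notin k1 o3S); neq.
have et1o3' : ~~ add t1 o2 e t1 o3.
  by rewrite /add eqxx (negbTE et1o3) (negbTE t1o2) /= eq_sym (negbTE o23).
have G : cubic_graph (add t1 o3 (add t1 o2 e)) (S :\: [set w in r]) (n - 3).
  have simp1 := simple_add t1o2 simp; split.
  - exact: simple_add.
  - apply: cubic_add2 => // w wr; have /setDP [wS _] := wr.
    rewrite !big_cons big_nil addn0 (nb_sum nz esym wS) (nb_sum n1 esym wS) (nb_sum n2 esym wS)
      (nb_sum n3 esym wS) (nb_sum k2 esym wS) (nb_sum k3 esym wS).
    move: (rest_all wr); rewrite /=; do 6![case/andP=> /eqP ->].
    by move: (w == t1 : nat) (w == o2 : nat) (w == o3 : nat); clear; lia.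
  - apply: (connected_const esym _ conn).
      by apply/subsetP => w; rewrite !inE; do 5?[case/orP]; move=> /eqP ->.
    move=> C cl; have [cl1 o3C] := closed_add t1r o3r cl.
    have [cl0 o2C] := closed_add t1r o2r cl1; split=> //; exists (t1 \in C) => w w' wr w'r eww'.
    have /setDP [wS _] := wr; have := rest_all wr; rewrite /=.
    do 5![case/andP => /eqP /negbT ?]; case/andP => /eqP /negbT ? _.
    have : [|| w == t1, w == o2 | w == o3].
      apply: contraT; rewrite !negb_or => /and3P [? ? ?]; move: w'r eww'; rewrite inE /r !in_cons orbF.
      by do 5?[case/orP]; move=> /eqP ->; rewrite esym => H;
        [have := nb_notin nz wS | have := nb_notin n1 wS | have := nb_notin n2 wS |
         have := nb_notin n3 wS | have := nb_notin k2 wS | have := nb_notin k3 wS];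
        case=> //; rewrite H.
    by case/or3P => /eqP ->.
  by rewrite card_setD_seq // SN doubleB.
have n3' : 1 < n - 3 < n by move: n6; clear; lia.
have [le _] := IH n3' G; rewrite pm_add2 // in le.
pose gs := [:: z; m1; m2; m3; t1; t2; t3].
have tgs : all (fun w => w \notin gs) [:: o1; o1; o2; o3].
  by rewrite /= /gs !inE !negb_or; do ?[apply/andP; split] => //; neq.
have E l := @gadget_expand _ e S gs o1 [:: o1; o2; o3] [:: [:: 1; 2; 3]; [:: 0; 5; 6];
  [:: 0; 4; 6]; [:: 0; 4; 5]; [:: 2; 3; 7]; [:: 1; 3; 8]; [:: 1; 2; 9]] l simp ugs tgs isT
  (conj nz (conj n1 (conj n2 (conj n3 (conj k1 (conj k2 (conj k3 I))))))).
have E0 := E [::]; expand_gadget E0.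
have Ea1 := E [:: 0; 1; 2; 3; 5; 6]; expand_gadget Ea1.
have Ea2 := E [:: 0; 1; 2; 3; 5; 6; 4; 8]; expand_gadget Ea2.
have Ea3 := E [:: 0; 1; 2; 3; 5; 6; 4; 9]; expand_gadget Ea3.
rewrite /= Ea1 Ea2 Ea3 in le.
have m := max_permat_pred3 n6.
rewrite -q_nil E0; move: le m; move: (max_permat n) (max_permat (n - 3)) => M m.
by clear; lia.
Qed.

Definition square x1 x2 x3 x4 y1 y2 y3 y4 :=
  [/\ nb e S x1 x2 x4 y1, nb e S x2 x1 x3 y2, nb e S x3 x2 x4 y3 & nb e S x4 x1 x3 y4].

Lemma square_rot x1 x2 x3 x4 y1 y2 y3 y4 : square x1 x2 x3 x4 y1 y2 y3 y4 ->
  square x2 x3 x4 x1 y2 y3 y4 y1.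
Proof. by case=> n1 n2 n3 n4; split=> //; apply: nb_swap. Qed.

Lemma square_neq x1 x2 x3 x4 y1 y2 y3 y4 : square x1 x2 x3 x4 y1 y2 y3 y4 ->
  [/\ uniq [:: x1; x2; x3; x4], all (fun y => y \notin [:: x1; x2; x3; x4]) [:: y1; y2; y3; y4],
      y1 != y2 /\ y2 != y3 & y3 != y4 /\ y4 != y1].
Proof.
case=> n1 n2 n3 n4; have [esym eirr] := simp.
have [x1S x2S x4S y1S] := nb_in n1; have [x3S _ _ y3S] := nb_in n3.
have [_ _ _ y2S] := nb_in n2; have [_ _ _ y4S] := nb_in n4.
have [e12 e14 e1y] := nb_edges n1; have [e21 e23 e2y] := nb_edges n2.
have [e32 e34 e3y] := nb_edges n3; have [e41 e43 e4y] := nb_edges n4.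
have [[x12 x14 x1y1 x24 x2y1] x4y1] := nb_neq simp n1.
have [[_ x23 x2y2 x13 x1y2] x3y2] := nb_neq simp n2.
have [[_ x34 x3y3 _ x2y3] x4y3] := nb_neq simp n3.
have [[_ _ x4y4 _ x1y4] x3y4] := nb_neq simp n4.
have far u v w : u \in S -> v \in S -> w \in S -> e u v -> e v w -> ~~ e u w.
  by move=> uS vS wS uv vw; apply: (tri vS) => //; rewrite esym.
have nadj u v w : e u v -> ~~ e u w -> v != w by move=> uv; apply: contraNneq => <-.
have x3y1 : x3 != y1 by rewrite eq_sym; apply: nadj e1y _; apply: (far x1 x2 x3).
have x4y2 : x4 != y2 by rewrite eq_sym; apply: nadj e2y _; apply: (far x2 x1 x4).
have x1y3 : x1 != y3 by rewrite eq_sym; apply: nadj e3y _; apply: (far x3 x2 x1).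
have x2y4 : x2 != y4 by rewrite eq_sym; apply: nadj e4y _; apply: (far x4 x1 x2).
have y12 : y1 != y2 by apply: nadj e1y _; apply: (far x1 x2 y2).
have y23 : y2 != y3 by apply: nadj e2y _; apply: (far x2 x3 y3).
have y34 : y3 != y4 by apply: nadj e3y _; apply: (far x3 x4 y4).
have y41 : y4 != y1 by apply: nadj e4y _; apply: (far x4 x1 y1).
split=> //; first by rewrite /= !inE !negb_or x12 x13 x14 x23 x24 x34.
rewrite /= !inE !negb_or; do ?[apply/andP; split]; rewrite // eq_sym //.
Qed.

(** The reduction that keeps [x1] and [x2] is always connected, because the edge x1 x2 ties both new
    edges together. Only the one deleting the whole square may fall apart. The last hypothesis
    prevents its two new edges from being parallel. *)
Lemma square_reduce x1 x2 x3 x4 y1 y2 y3 y4 : square x1 x2 x3 x4 y1 y2 y3 y4 ->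
  ~~ e y1 y4 -> ~~ e y2 y3 -> ~~ ((y1 == y3) && (y2 == y4)) ->
  (exists C : {set T}, [/\ closed_in e (S :\: [set w in [:: x1; x2; x3; x4]]) C,
     y1 \in C, y4 \in C, y2 \notin C & y3 \notin C]) \/
  pm e S <= max_permat n.-1 + max_permat n.-2 /\
  (pm e S = max_permat n.-1 + max_permat n.-2 ->
   ext (add x2 y3 (add x1 y4 e)) (S :\: [set w in [:: x3; x4]]) n.-1).
Proof.
move=> sq ey14 ey23 y1324; have [ugs tgs [y12 y23] [y34 y41]] := square_neq sq.
case: sq => n1 n2 n3 n4; have [esym eirr] := simp.
have [x1S x2S x4S y1S] := nb_in n1; have [x3S _ _ y3S] := nb_in n3.
have [_ _ _ y2S] := nb_in n2; have [_ _ _ y4S] := nb_in n4.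
have [e12 e14 e1y] := nb_edges n1; have [e21 e23 e2y] := nb_edges n2.
have [e32 e34 e3y] := nb_edges n3; have [e41 e43 e4y] := nb_edges n4.
have ugs' := ugs; neqs ugs'; have tgs' := tgs; neqs tgs'.
set gs := [:: x1; x2; x3; x4] in ugs tgs *.
have gsS : all (mem S) gs by rewrite /= x1S x2S x3S x4S.
have in_gs y : y \in S -> y \notin gs -> y \in S :\: [set w in gs] by apply: in_rest.
have tgsP y : y \in [:: y1; y2; y3; y4] -> y \notin gs by move=> yt; apply: (allP tgs).
have y1r : y1 \in S :\: [set w in gs] by apply: in_gs => //; apply: tgsP; rewrite !inE eqxx.
have y2r : y2 \in S :\: [set w in gs] by apply: in_gs => //; apply: tgsP; rewrite !inE eqxx ?orbT.
have y3r : y3 \in S :\: [set w in gs] by apply: in_gs => //; apply: tgsP; rewrite !inE eqxx ?orbT.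
have y4r : y4 \in S :\: [set w in gs] by apply: in_gs => //; apply: tgsP; rewrite !inE eqxx ?orbT.
have y14 : y1 != y4 by neq.
have ey23' : ~~ add y1 y4 e y2 y3.
  rewrite /add (negbTE ey23) (eq_sym y2 y1) (negbTE y12) /= andbC (eq_sym y3).
  exact: y1324.
have nbr w w' : w \in S :\: [set w in gs] -> w' \in [set w in gs] -> e w w' ->
    [\/ w = y1, w = y2, w = y3 | w = y4].
  move=> wr; have /setDP [wS _] := wr; have := rest_all wr; rewrite /=.
  case/and5P => /eqP /negbT w1 /eqP /negbT w2 /eqP /negbT w3 /eqP /negbT w4 _.
  rewrite inE /gs !in_cons orbF; do 3?[case/orP]; move=> /eqP ->; rewrite esym.
  - by case/(nb_cases n1 wS) => E; subst; rewrite ?eqxx // in w1 w2 w3 w4 *; constructor 1.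
  - by case/(nb_cases n2 wS) => E; subst; rewrite ?eqxx // in w1 w2 w3 w4 *; constructor 2.
  - by case/(nb_cases n3 wS) => E; subst; rewrite ?eqxx // in w1 w2 w3 w4 *; constructor 3.
  - by case/(nb_cases n4 wS) => E; subst; rewrite ?eqxx // in w1 w2 w3 w4 *; constructor 4.
have simp1 := simple_add y14 simp.
have G2deg : cubic_on (add y2 y3 (add y1 y4 e)) (S :\: [set w in gs]).
  apply: cubic_add2 => // w wr; have /setDP [wS _] := wr.
  rewrite !big_cons big_nil addn0 (nb_sum n1 esym wS) (nb_sum n2 esym wS) (nb_sum n3 esym wS)
    (nb_sum n4 esym wS).
  move: (rest_all wr); rewrite /=; do 4![case/andP=> /eqP ->].
  by move: (w == y1 : nat) (w == y2 : nat) (w == y3 : nat) (w == y4 : nat); clear; lia.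
have [cn|[C [y [z [cl yr zr yC zC]]]]] :=
  connected_dec (add y2 y3 (add y1 y4 e)) (S :\: [set w in gs]); last first.
  have [cl1 y23C] := closed_add y2r y3r cl; have [cl0 y14C] := closed_add y1r y4r cl1.
  left; have [y12C|y12C] := eqVneq (y1 \in C) (y2 \in C).
    have H : {in S :\: [set w in gs] &, forall w w', (w \in C) = (w' \in C)}.
      apply: (@closed_const _ e S _ C (y1 \in C) esym _ conn cl0).
        by apply/subsetP => w; rewrite inE => /(allP gsS).
      by move=> w w' wr w'r /(nbr _ _ wr w'r) [] ->; rewrite -?y14C -?y23C.
    by rewrite -(H y z yr zr) yC in zC.
  have [y1C|y1C] := boolP (y1 \in C); rewrite ?y1C ?(negbTE y1C) in y12C y14C.
    exists C; rewrite y1C -y14C -y23C; split=> //; by apply: contraNN y12C => ->.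
  have y2C : y2 \in C by move: y12C; case: (y2 \in C).
  exists (~: C); rewrite !inE y1C -y14C -y23C y2C; split=> //.
  by move=> w w' wr w'r eww'; rewrite !inE (cl0 w w' wr w'r eww').
right.
have G2 : cubic_graph (add y2 y3 (add y1 y4 e)) (S :\: [set w in gs]) n.-2.
  split=> //; first exact: simple_add.
  by rewrite card_setD_seq // SN -subn2 doubleB.
pose r := [:: x3; x4].
have x1y4 : x1 != y4 by neq.
have x2y3 : x2 != y3 by neq.
have ur : uniq r by rewrite /= inE andbT; neq.
have rS : all (mem S) r by rewrite /= x3S x4S.
have x1r : x1 \in S :\: [set w in r].
  by apply: in_rest => //; rewrite /r !inE !negb_or; do ?[apply/andP; split]; neq.
have x2r : x2 \in S :\: [set w in r].
  by apply: in_rest => //; rewrite /r !inE !negb_or; do ?[apply/andP; split]; neq.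
have y3r' : y3 \in S :\: [set w in r].
  by apply: in_rest => //; rewrite /r !inE !negb_or; do ?[apply/andP; split]; neq.
have y4r' : y4 \in S :\: [set w in r].
  by apply: in_rest => //; rewrite /r !inE !negb_or; do ?[apply/andP; split]; neq.
have [ex1y4 _] : ~~ e x1 y4 /\ ~~ e y4 x1 by apply: (nb_notin n1 y4S); neq.
have [ex2y3 _] : ~~ e x2 y3 /\ ~~ e y3 x2 by apply: (nb_notin n2 y3S); neq.
have ex2y3' : ~~ add x1 y4 e x2 y3.
  have [x21 x2y4] : x2 != x1 /\ x2 != y4 by split; neq.
  by rewrite /add (negbTE ex2y3) (negbTE x21) (negbTE x2y4).
have G1 : cubic_graph (add x2 y3 (add x1 y4 e)) (S :\: [set w in r]) n.-1.
  have simp2 := simple_add x1y4 simp; split.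
  - exact: simple_add.
  - apply: cubic_add2 => // w wr; have /setDP [wS _] := wr.
    rewrite !big_cons big_nil addn0 (nb_sum n3 esym wS) (nb_sum n4 esym wS).
    move: (rest_all wr); rewrite /=; do 2![case/andP=> /eqP ->].
    by move: (w == x1 : nat) (w == x2 : nat) (w == y3 : nat) (w == y4 : nat); clear; lia.
  - apply: (connected_const esym _ conn).
      by apply/subsetP => w; rewrite inE => /(allP rS).
    move=> C cl; have [cl1 x2C] := closed_add x2r y3r' cl.
    have [cl0 x1C] := closed_add x1r y4r' cl1; split=> //; exists (x1 \in C) => w w' wr w'r eww'.
    have x12C := cl0 x1 x2 x1r x2r e12.
    have /setDP [wS _] := wr; have := rest_all wr; rewrite /=.
    case/and3P => /eqP /negbT w3 /eqP /negbT w4 _; move: w'r eww'; rewrite inE /r !in_cons orbF.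
    case/orP => /eqP ->; rewrite esym.
      by case/(nb_cases n3 wS) => E; [rewrite E -x12C | rewrite E eqxx in w4 | rewrite E -x2C -x12C].
    by case/(nb_cases n4 wS) => E; [rewrite E | rewrite E eqxx in w3 | rewrite E -x1C].
  by rewrite card_setD_seq // SN -subn1 doubleB.
have n1' := pred_range n6.
have n2' : 1 < n.-2 < n by move: n6; clear; lia.
have [le1 eq1] := IH n1' G1; have [le2 _] := IH n2' G2.
have E l := @gadget_expand _ e S gs y1 [:: y1; y2; y3; y4]
  [:: [:: 1;3;4]; [:: 0;2;5]; [:: 1;3;6]; [:: 0;2;7]] l simp ugs
  ltac:(by rewrite /= in tgs *; rewrite tgs; case/andP: tgs => ->) isT
  (conj n1 (conj n2 (conj n3 (conj n4 I)))).
have E0 := E [::]; expand_gadget E0.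
have Ea1 := E [:: 2; 3]; expand_gadget Ea1.
have Ea2 := E [:: 2; 3; 0; 7]; expand_gadget Ea2.
have Ea3 := E [:: 2; 3; 1; 6]; expand_gadget Ea3.
have Ea4 := E [:: 2; 3; 0; 7; 1; 6]; expand_gadget Ea4.
have Eb4 := E [:: 0; 1; 2; 3; 4; 7; 5; 6]; expand_gadget Eb4.
(* Sort matchings by the y_i that are matched into the square. The first reduction accounts for
   none, {1,2} and {3,4}; the second for none, {1,4}, {2,3} and all four. The empty case occurs
   twice on both sides. *)
have le : pm e S <= pm (add x2 y3 (add x1 y4 e)) (S :\: [set w in r]) +
                    pm (add y2 y3 (add y1 y4 e)) (S :\: [set w in gs]).
  rewrite !pm_add2 //= -q_nil E0 Ea1 Ea2 Ea3 Ea4 Eb4 /gs.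
  by clear; lia.
split; first exact: leq_trans le (leq_add le1 le2).
move=> pmE; apply: eq1; apply/eqP; rewrite eqn_leq le1 -(leq_add2r (max_permat n.-2)) -pmE.
by apply: leq_trans le _; rewrite leq_add2l.
Qed.

Hypothesis noK : ~ K33e e S.

(** Three 4-cycles meet in [x1], which is the centre of a cube without a vertex; if [y2] equals
    [y4], the six vertices form K33 minus an edge instead. *)
Lemma square_cube x1 x2 x3 x4 y1 y2 y3 y4 : square x1 x2 x3 x4 y1 y2 y3 y4 ->
  e y1 y2 -> e y1 y4 -> pm e S < max_permat n.
Proof.
move=> sq e12 e14; have [ugs tgs [y12 y23] [y34 y41]] := square_neq sq.
case: sq => n1 n2 n3 n4; have [esym eirr] := simp.
have [x1S x2S x4S y1S] := nb_in n1; have [x3S _ _ y3S] := nb_in n3.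
have [_ _ _ y2S] := nb_in n2; have [_ _ _ y4S] := nb_in n4.
have [ex12 ex14 e1y] := nb_edges n1; have [ex21 ex23 e2y] := nb_edges n2.
have [ex32 ex34 e3y] := nb_edges n3; have [ex41 ex43 e4y] := nb_edges n4.
neqs ugs; neqs tgs.
have [E|y24] := eqVneq y2 y4.
  case: noK; rewrite -E in e4y; exists y1, x3, x1, x2, y2, x4; split; last first.
    by rewrite /= y1S x3S x1S x2S y2S x4S.
  split; [by split; rewrite // esym | by split; rewrite // esym|].
  by rewrite /= !inE !negb_or; do ?[apply/andP; split] => //; neq.
have [o1 k1] : exists o, nb e S y4 x4 y1 o.
  by apply: nb_ex2; rewrite // 1?esym //; neq.
have [o2 k2] : exists o, nb e S y2 x2 y1 o.
  by apply: nb_ex2; rewrite // 1?esym //; neq.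
have n1' : nb e S y1 x1 y4 y2.
  by apply: nb_ex3; rewrite // 1?esym //= !inE !negb_or; do ?[apply/andP; split] => //; neq.
apply: (@cube_vertex_case
  x1 x2 x4 y1 y4 y2 x3 o1 o2 y3).
split=> //.
- by split; [apply: nb_rot (nb_rot (nb_swap (nb_rot n2)))| apply: nb_rot (nb_rot (nb_swap (nb_rot n4))) |].
by rewrite /= !inE !negb_or; do ?[apply/andP; split] => //; neq.
Qed.

Lemma square_oriented x1 x2 x3 x4 y1 y2 y3 y4 : 8 <= n ->
  square x1 x2 x3 x4 y1 y2 y3 y4 -> ~~ e y1 y4 -> ~~ e y2 y3 ->
  pm e S < max_permat n \/ exists C : {set T},
  [/\ closed_in e (S :\: [set w in [:: x1; x2; x3; x4]]) C,
     y1 \in C, y4 \in C, y2 \notin C & y3 \notin C].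
Proof.
move=> n8 sq e14 e23; have [ugs tgs [y12 y23] [y34 y41]] := square_neq sq.
have [esym eirr] := simp.
have ny : ~~ ((y1 == y3) && (y2 == y4)).
  apply/negP => /andP [/eqP E1 /eqP E2]; case: sq => n1 n2 n3 n4; case: noK.
  have [x1S x2S x4S y1S] := nb_in n1; have [x3S _ _ y3S] := nb_in n3.
  have [_ _ _ y2S] := nb_in n2.
  have [ex12 ex14 e1y] := nb_edges n1; have [ex21 ex23 e2y] := nb_edges n2.
  have [ex32 ex34 e3y] := nb_edges n3; have [ex41 ex43 e4y] := nb_edges n4.
  rewrite -E1 in e3y; rewrite -E2 in e4y.
  neqs ugs; neqs tgs; exists y1, y2, x1, x2, x3, x4; split; last first.
    by rewrite /= y1S y2S x1S x2S x3S x4S.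
  split; [by split; rewrite // esym | by split; rewrite // esym|].
  by rewrite /= !inE !negb_or; do ?[apply/andP; split] => //; neq.
have [?|[le eq]] := square_reduce sq e14 e23 ny; [by right | left].
have mE : max_permat n.-1 + max_permat n.-2 = max_permat n.
  have nE : n = n.-2.+2 by move: n8; clear; lia.
  rewrite [in RHS]nE max_permatD; last by move: n8; clear; lia.
  by congr (max_permat _ + _); move: n8; clear; lia.
rewrite mE leq_eqVlt in le; case/orP: le => [/eqP pmE|//]; case: noK.
rewrite mE in eq; have n7 : 7 <= n.-1 by move: n8; clear; lia.
have iso := ext_ladder n7 (eq pmE).
case: sq => n1 n2 n3 n4; have [x1S x2S x4S y1S] := nb_in n1.
have [ex12 _ _] := nb_edges n1; neqs ugs.
have inr x : x \in S -> x != x3 -> x != x4 -> x \in S :\: [set w in [:: x3; x4]].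
  by move=> xS x3' x4'; rewrite !inE negb_or x3' x4'.
have [p [q' [a [b [c [d [K allK]]]]]]] := ladder_K33e n7 iso
  (u := x1) (v := x2) ltac:(by apply: inr) ltac:(by apply: inr) ltac:(by rewrite /add ex12).
exists p, q', a, b, c, d; split; last first.
  by apply/allP => x /(allP allK); rewrite !inE => /and3P [/andP [_ ->]].
(* Each new edge meets [x1] or [x2], which this end avoids, so all its edges are old ones. *)
have eE x y : x \in [:: p; q'; a; b; c; d] -> y \in [:: p; q'; a; b; c; d] ->
    add x2 y3 (add x1 y4 e) x y -> e x y.
  move=> /(allP allK) /and3P [_ /negbTE xx1 /negbTE xx2] /(allP allK) /and3P [_ /negbTE yx1 /negbTE yx2].
  by rewrite /add xx1 xx2 yx1 yx2 !andbF !orbF.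
case: K => [[? ? ? ?] [? ? ? ?] u].
by split; [split; apply: eE | split; apply: eE | ]; rewrite // !inE !eqxx ?orbT.
Qed.

(** A cut separating y1, y4 from y2, y3 excludes edges y1 y2 and y3 y4, so the rotated square can be
    reduced too. If this also fails, a second cut separates y1, y2 from y3, y4. The intersection of
    the two sides containing [y1] is left only through x1 y1, a bridge. *)
Lemma square_separated x1 x2 x3 x4 y1 y2 y3 y4 : 8 <= n ->
  square x1 x2 x3 x4 y1 y2 y3 y4 -> ~~ e y1 y4 -> ~~ e y2 y3 ->
  pm e S < max_permat n.
Proof.
move=> n8 sq e14 e23; have [//|[C [cl C1 C4 C2 C3]]] := square_oriented n8 sq e14 e23.
have [ugs tgs _ _] := square_neq sq; have [esym eirr] := simp.
have sq0 := sq; case: sq0 => n1 n2 n3 n4.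
have [x1S x2S x4S y1S] := nb_in n1; have [x3S _ _ y3S] := nb_in n3.
have [_ _ _ y2S] := nb_in n2; have [_ _ _ y4S] := nb_in n4.
have [_ _ e1y] := nb_edges n1.
set gs := [:: x1; x2; x3; x4] in ugs tgs cl.
have tgsP y : y \in S -> y \in [:: y1; y2; y3; y4] -> y \in S :\: [set w in gs].
  by move=> yS yt; apply: in_rest => //; apply: (allP tgs).
have [y1r y2r y3r y4r] : [/\ y1 \in S :\: [set w in gs], y2 \in S :\: [set w in gs],
    y3 \in S :\: [set w in gs] & y4 \in S :\: [set w in gs]].
  by split; apply: tgsP => //; rewrite !inE eqxx ?orbT.
have e21 : ~~ e y2 y1 by apply: contraNN C2 => h; rewrite (cl y2 y1).
have e34 : ~~ e y3 y4 by apply: contraNN C3 => h; rewrite (cl y3 y4).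
have [//|[C' [cl' C'2 C'1 C'3 C'4]]] := square_oriented n8 (square_rot sq) e21 e34.
have gsE : [set w in [:: x2; x3; x4; x1]] = [set w in gs].
  apply/setP => w; rewrite !inE.
  by case: (w == x1); case: (w == x2); case: (w == x3); case: (w == x4).
rewrite gsE in cl'.
have /setDP [_ y1gs] := y1r.
have := bridge_free (C := C :&: C' :\: [set w in gs]) x1S y1S e1y.
rewrite !in_setD !in_setI C1 C'1 y1gs (_ : x1 \in [set w in gs]) ?inE ?eqxx //= => H.
suff : false = true by []; apply: H => x y xS yS exy m1 m2.
wlog xC : x y xS yS exy m1 m2 / x \in C :&: C' :\: [set w in gs].
  move=> W; have [xC|xC] := boolP (x \in C :&: C' :\: [set w in gs]); first by rewrite -(W x y) ?xC.
  have [yC|yC] := boolP (y \in C :&: C' :\: [set w in gs]) => //.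
  have := W y x yS xS; rewrite yC (negbTE xC) esym => -> //.
    by case=> ? ?; apply: m2.
  by case=> ? ?; apply: m1.
rewrite xC; symmetry; move: xC; rewrite !in_setD !in_setI => /andP [xgs /andP [xC xC']].
have xr : x \in S :\: [set w in gs] by rewrite in_setD xgs.
have [ygs|ygs] := boolP (y \in [set w in gs]); last first.
  have yr : y \in S :\: [set w in gs] by rewrite in_setD ygs.
  by rewrite -(cl x y) // -(cl' x y) // xC xC'.
move: ygs exy xgs m1 m2; rewrite inE /gs !in_cons orbF => ygs exy xgs m1 m2.
rewrite !in_set /gs !in_cons orbF !negb_or in xgs; case/and4P: xgs => x1' x2' x3' x4'.
move: ygs exy; do 3?[case/orP]; move=> /eqP yE; rewrite yE esym.
- by case/(nb_cases n1 xS) => E; subst; rewrite ?eqxx // in x1' x2' x3' x4' *; case: m2.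
- by case/(nb_cases n2 xS) => E; subst; rewrite ?eqxx // in x1' x2' x3' x4' *; rewrite xC in C2.
- by case/(nb_cases n3 xS) => E; subst; rewrite ?eqxx // in x1' x2' x3' x4' *; rewrite xC in C3.
- by case/(nb_cases n4 xS) => E; subst; rewrite ?eqxx // in x1' x2' x3' x4' *; rewrite xC' in C'4.
Qed.

(** Reduction needs an opposite pair of sides, y1 y4 and y2 y3 or y1 y2 and y3 y4, without edges. If
    neither pair qualifies, two edges share some y_i, and [square_cube] applies. *)
Lemma square_case x1 x2 x3 x4 y1 y2 y3 y4 : 8 <= n ->
  square x1 x2 x3 x4 y1 y2 y3 y4 -> pm e S < max_permat n.
Proof.
move=> n8 sq; have [esym _] := simp.
have sq2 := square_rot sq; have sq3 := square_rot sq2; have sq4 := square_rot sq3.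
have [e14|e14] := boolP (e y1 y4); have [e12|e12] := boolP (e y1 y2).
- exact: (square_cube sq).
- have [e34|e34] := boolP (e y3 y4).
    by apply: (square_cube sq4); rewrite esym.
  by apply: (square_separated n8 sq2); rewrite // esym.
- have [e23|e23] := boolP (e y2 y3); first by apply: (square_cube sq2); rewrite // esym.
  exact: (square_separated n8 sq).
have [e23|e23] := boolP (e y2 y3); last exact: (square_separated n8 sq).
have [e34|e34] := boolP (e y3 y4); first by apply: (square_cube sq3); rewrite // esym.
by apply: (square_separated n8 sq2); rewrite // esym.
Qed.

End Configurations.

(** * The ladders L_n *)

Section Ladder.

Variable n : nat.
Hypothesis n6 : 6 <= n.
Local Notation L := (ladderK33 n).
Implicit Types (i j : nat) (s t : bool).

Lemma rail_gt0 : 0 < n - 4. Proof. by clear -n6; lia. Qed.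

(** Natural numbers as indices, so that i + 1 and i - 1 can be written freely; an index out of range
    denotes 0. *)
Definition rail s i : L := inl (s, insubd (Ordinal rail_gt0) i).
Definition knot t i : L := inr (t, inord i).

Lemma eq_rail s i s' (j : 'I_(n - 4)) : i < n - 4 ->
  ((inl (s', j) : L) == rail s i) = (s' == s) && (j == i :> nat).
Proof.
move=> iN; rewrite /rail -[LHS]/((s', j) == _) xpair_eqE; congr (_ && _).
by rewrite -val_eqE val_insubd iN.
Qed.

Lemma eq_knot t i t' (k : 'I_4) : i < 4 ->
  ((inr (t', k) : L) == knot t i) = (t' == t) && (k == i :> nat).
Proof.
move=> i4; rewrite /knot -[LHS]/((t', k) == _) xpair_eqE; congr (_ && _).
by rewrite -val_eqE /= inordK.
Qed.

Definition ladder_nb (x : L) : seq L :=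
  match x with
  | inl (s, i) =>
    if i == 0 :> nat then [:: rail s 1; knot false s; knot false (2 + s)]
    else if i == n - 5 :> nat then [:: rail s (n - 6); knot true s; knot true (2 + s)]
    else [:: rail (~~ s) i; rail s i.-1; rail s i.+1]
  | inr (t, k) => [:: knot t (k.+1 %% 4); knot t (k.+3 %% 4); rail (odd k) (if t then n - 5 else 0)]
  end.

Lemma rail_knot s i t k : (rail s i == knot t k) = false. Proof. by []. Qed.

Lemma knot_rail s i t k : (knot t k == rail s i) = false. Proof. by []. Qed.

Lemma eq_rails s i s' j : i < n - 4 -> j < n - 4 ->
  (rail s' j == rail s i) = (s' == s) && (j == i).
Proof. by move=> iN jN; rewrite eq_rail // val_insubd jN. Qed.

Lemma eq_knots t i t' k : i < 4 -> k < 4 -> (knot t' k == knot t i) = (t' == t) && (k == i).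
Proof. by move=> i4 k4; rewrite eq_knot // inordK. Qed.

Lemma uniq_ladder_nb x : uniq (ladder_nb x) /\ size (ladder_nb x) = 3.
Proof.
case: x => [[s i]|[t k]]; last first.
  by case: k => [[|[|[|[|k]]]] // ?]; rewrite /= !inE knot_rail eq_knots // eqxx.
rewrite /=; have iN := ltn_ord i.
case: ifP => i0; [|case: ifP => iL]; split=> //=; rewrite !inE ?rail_knot ?knot_rail.
- by case: s; rewrite eq_knots.
- by case: s; rewrite eq_knots.
by rewrite !eq_rails //; case: s; lia.
Qed.

Lemma inl_knot u t k : ((inl u : L) == knot t k) = false. Proof. by []. Qed.

Lemma inr_rail u s i : ((inr u : L) == rail s i) = false. Proof. by []. Qed.

Lemma ladder_nbE x y : edge x y = (y \in ladder_nb x).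
Proof.
rewrite ladder_adj; have N1 : 1 < n - 4 by clear -n6; lia.
have N5 : n - 5 < n - 4 by clear -n6; lia.
have N6 : n - 6 < n - 4 by clear -n6; lia.
case: x => [[s i]|[t k]]; case: y => [[s' j]|[t' l]].
- have iN := ltn_ord i; have jN := ltn_ord j; rewrite [RHS]/=.
  case: ifP => i0; [|case: ifP => iL]; rewrite !inE ?eq_rail // ?inl_knot;
    by case: s; case: s' => /=; rewrite -?val_eqE /=; lia.
- have iN := ltn_ord i; rewrite [RHS]/=.
  case: ifP => i0; [|case: ifP => iL]; rewrite !inE ?inr_rail ?eq_knot /=; try by case: (s).
  1,2: case: l => [[|[|[|[|l]]]] // ?]; case: s; case: t'; rewrite /= ?inr_rail ?eq_knot //; lia.
  by case: t'; rewrite /= ?inr_rail ?eq_knot //; lia.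
- have jN := ltn_ord j; rewrite [RHS]/= !inE !inl_knot eq_rail; last by case: (t); lia.
  by rewrite /= (eq_sym s') andbC.
case: k => [[|[|[|[|k]]]] // ?]; rewrite !inE inr_rail !eq_knot //= orbF (eq_sym t t');
  by case: (t' == t); case: l => [[|[|[|[|l]]]] // ?].
Qed.

End Ladder.

(** * Lower bounds, and the matchings of L_n *)

Section LowerBounds.

Variables (T : finType) (e : rel T).
Hypothesis simp : simple e.
Implicit Types (S : {set T}).

Lemma pm_ge S v (l : seq T) : v \in S -> uniq l ->
  all (fun u => (u \in S) && e v u) l -> \sum_(u <- l) pm e (S :\ v :\ u) <= pm e S.
Proof.
move=> vS ul /allP lP; rewrite (pm_rec simp vS) big_uniq //=.
rewrite [X in _ <= X](bigID (mem l)) /=; apply: leq_trans (leq_addr _ _).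
rewrite leq_eqVlt; apply/orP; left; apply/eqP/eq_bigl => u.
by rewrite andbC; apply/esym/andb_idr/lP.
Qed.

Lemma pm_ge1 S v u : v \in S -> u \in S -> e v u -> pm e (S :\ v :\ u) <= pm e S.
Proof.
move=> vS uS evu; have := @pm_ge S v [:: u] vS isT.
by rewrite /= uS evu big_seq1; apply.
Qed.

Lemma pm_ge2 S v u w : v \in S -> u \in S -> w \in S -> u != w -> e v u -> e v w ->
  pm e (S :\ v :\ u) + pm e (S :\ v :\ w) <= pm e S.
Proof.
move=> vS uS wS uw evu evw; have := @pm_ge S v [:: u; w] vS.
by rewrite /= !inE uS wS uw evu evw !big_cons big_nil addn0; apply.
Qed.

Lemma pm_C4 S a b c d : uniq [:: a; b; c; d] -> all (mem S) [:: a; b; c; d] ->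
  e a b -> e b c -> e c d -> e d a -> 2 * pm e (S :\: [set z in [:: a; b; c; d]]) <= pm e S.
Proof.
move=> u /and5P [/= aS bS cS dS _] ab bc cd da; neqs u; have [esym eirr] := simp.
have bd : b != d by neq.
apply: leq_trans (pm_ge2 aS bS dS bd ab _); last by rewrite esym.
rewrite mul2n -addnn; apply: leq_add.
  apply: leq_trans (@pm_ge1 _ c d _ _ cd); first by
    apply: eq_leq; congr pm; apply/setP => z; rewrite !inE;
    case: (z == a); case: (z == b); case: (z == c); case: (z == d).
  - by rewrite !inE cS !andbT; apply/andP; split; neq.
  - by rewrite !inE dS !andbT; apply/andP; split; neq.
apply: leq_trans (@pm_ge1 _ b c _ _ bc); first by
  apply: eq_leq; congr pm; apply/setP => z; rewrite !inE;
  case: (z == a); case: (z == b); case: (z == c); case: (z == d).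
- by rewrite !inE bS !andbT; apply/andP; split; neq.
by rewrite !inE cS !andbT; apply/andP; split; neq.
Qed.

Lemma pm_K33e S p q a b c d : K33e_on e p q a b c d ->
  all (mem S) [:: p; q; a; b; c; d] ->
  2 * pm e (S :\: [set z in [:: p; q; a; b; c; d]]) <= pm e (S :\ p :\ a) /\
  2 * pm e (S :\: [set z in [:: p; q; a; b; c; d]]) <= pm e (S :\ p :\ c).
Proof.
move=> [[ab bc cd da] [pa pc qb qd] u] /= /and5P [pS qS aS bS /and3P [cS dS _]].
neqs u; have [esym eirr] := simp; split.
  apply: leq_trans (@pm_C4 _ q b c d _ _ qb bc cd _).
  - apply: eq_leq; congr (_ * pm _ _); apply/setP => z; rewrite !inE.
    by case: (z == p); case: (z == q); case: (z == a); case: (z == b); case: (z == c); case: (z == d).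
  - by rewrite /= !inE !negb_or; do ?[apply/andP; split] => //; neq.
  - by rewrite /= !inE qS bS cS dS !andbT; do ?[apply/andP; split] => //; neq.
  by rewrite esym.
apply: leq_trans (@pm_C4 _ q b a d _ _ qb _ _ _).
- apply: eq_leq; congr (_ * pm _ _); apply/setP => z; rewrite !inE.
  by case: (z == p); case: (z == q); case: (z == a); case: (z == b); case: (z == c); case: (z == d).
- by rewrite /= !inE !negb_or; do ?[apply/andP; split] => //; neq.
- by rewrite /= !inE qS bS aS dS !andbT; do ?[apply/andP; split] => //; neq.
- by rewrite esym.
- by rewrite esym.
by rewrite esym.
Qed.

End LowerBounds.
Lemma simple_edge (G : sgraph) : simple (@edge G).
Proof. by split; [apply: edge_sym | apply: edge_irr]. Qed.

Section LadderFacts.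

Variable n : nat.
Hypothesis n6 : 6 <= n.
Local Notation L := (ladderK33 n).
Implicit Types (i j : nat) (s t : bool).
Local Notation rail := (rail n6).
Local Notation knot := (knot n).

Lemma card_ladder : #|L| = 2 * n.
Proof. by rewrite card_sum !card_prod card_bool !card_ord; lia. Qed.

Lemma ladder_cubic : cubic L.
Proof.
move=> x; have [u sz] := uniq_ladder_nb n6 x.
rewrite -sz -(card_uniqP u); apply: eq_card => y.
by rewrite inE (ladder_nbE n6).
Qed.

Lemma rail_val s (i : 'I_(n - 4)) : (inl (s, i) : L) = rail s i.
Proof. by apply/eqP; rewrite eq_rail // !eqxx. Qed.

Lemma knot_val t (k : 'I_4) : (inr (t, k) : L) = knot t k.
Proof. by apply/eqP; rewrite eq_knot // !eqxx. Qed.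

Lemma edge_rails s i : i.+1 < n - 4 -> edge (rail s i) (rail s i.+1).
Proof.
move=> iN; rewrite ladder_adj /= eqxx !val_insubd iN (ltnW iN) eqxx //.
Qed.

Lemma edge_rung i : 0 < i < n - 5 -> edge (rail false i) (rail true i).
Proof.
move=> iN; have i4 : i < n - 4 by lia.
by rewrite ladder_adj /= -val_eqE !val_insubd i4 eqxx iN.
Qed.

Lemma edge_end t k : k < 4 -> edge (rail (odd k) (if t then n - 5 else 0)) (knot t k).
Proof.
move=> k4; have tN : (if t then n - 5 else 0) < n - 4 by case: t; lia.
by rewrite ladder_adj /= val_insubd tN inordK // !eqxx.
Qed.

Lemma edge_knots t k : k < 4 -> edge (knot t k) (knot t (k.+1 %% 4)).
Proof. by move=> k4; rewrite ladder_adj /= !inordK ?ltn_mod // !eqxx. Qed.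

Lemma ladder_connected : connected L.
Proof.
split; first by rewrite card_ladder; lia.
pose r0 := rail false 0; have csym := sym_connect_sym (@edge_sym L).
have fi i : i < n - 4 -> connect edge r0 (rail false i).
  elim: i => [|i IH] iN; first exact: connect0.
  exact: connect_trans (IH (ltnW iN)) (connect1 (edge_rails false iN)).
have t0 : connect edge r0 (rail true 0).
  apply: connect_trans (connect1 (edge_end false (k := 0) isT)) _.
  apply: connect_trans (connect1 (edge_knots false (k := 0) isT)) _.
  by rewrite csym; apply: connect1; apply: (edge_end false (k := 1)).
have ti i : i < n - 4 -> connect edge r0 (rail true i).
  elim: i => [|i IH] iN; first exact: t0.
  exact: connect_trans (IH (ltnW iN)) (connect1 (edge_rails true iN)).
have all0 x : connect edge r0 x.
  case: x => [[s i]|[t k]]; first by rewrite rail_val; case: s; auto.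
  rewrite knot_val; apply: connect_trans (connect1 (edge_end t (ltn_ord k))).
  by case: (odd k); [apply: ti | apply: fi]; case: t; lia.
by move=> x y; apply: connect_trans (all0 y); rewrite csym.
Qed.

Lemma ladder_K33e_on t (i := if t then n - 5 else 0) :
  K33e_on edge (rail false i) (rail true i) (knot t 0) (knot t 1) (knot t 2) (knot t 3).
Proof.
split; first by split; exact: (edge_knots t (k := _)).
  by split; exact: (edge_end t (k := _)).
have iN : i < n - 4 by rewrite /i; case: (t); lia.
by rewrite /= !inE !eq_knots // eqxx.
Qed.

Definition right_part j : {set L} :=
  [set x : L | match x with inl (_, i) => j <= i | inr (t, _) => t end].

Lemma right_partS j : j < n - 4 ->
  right_part j :\ rail false j :\ rail true j = right_part j.+1.
Proof.
move=> jN; apply/setP => -[[s i]|[t k]]; rewrite !inE ?inr_rail // !eq_rail //.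
by case: s => /=; lia.
Qed.

Lemma rail_right s i j : i < n - 4 -> (rail s i \in right_part j) = (j <= i).
Proof. by move=> iN; rewrite inE /= val_insubd iN. Qed.

(** Fibonacci recursion: use the rung at [j], or the two rail edges from [j] to j + 1. *)
Lemma pm_right_step j : 0 < j -> j.+1 < n - 4 ->
  pm edge (right_part j.+1) + pm edge (right_part j.+2) <= pm edge (right_part j).
Proof.
move=> j0 jN; have jN' := ltnW jN; have simp := simple_edge L.
have le := @pm_ge2 _ _ simp (right_part j) (rail false j) (rail true j) (rail false j.+1).
apply: leq_trans (le _ _ _ _ _ _); rewrite ?rail_right ?leqnn //.
- rewrite right_partS // leq_add2l.
  apply: leq_trans (@pm_ge1 _ _ simp _ (rail true j) (rail true j.+1) _ _ (edge_rails _ jN)).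
  + apply: eq_leq; rewrite -!right_partS //; congr pm; apply/setP => x; rewrite !inE.
    by case: (x == _); case: (x == _); case: (x == _); case: (x == _).
  + by rewrite !in_setD1 rail_right // !eq_rails // leqnn.
  by rewrite !in_setD1 rail_right // !eq_rails // leqnSn !andbT; lia.
- by apply: edge_rung; lia.
exact: edge_rails.
Qed.

Lemma pm_right_knots : 2 <= pm edge (right_part (n - 4)).
Proof.
apply: leq_trans (@pm_C4 _ _ (simple_edge L) _ (knot true 0) (knot true 1) (knot true 2)
  (knot true 3) _ _ _ _ _ _).
- rewrite (_ : _ :\: _ = set0) ?pm_set0 //; apply/setP => -[[s i]|[t k]]; rewrite !inE.
    by rewrite /= leqNgt ltn_ord ?andbF.
  rewrite !eq_knot //; case: t => //=.
  by case: k => [[|[|[|[|k]]]] // ?].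
- by rewrite /= !inE !eq_knots.
- by rewrite /= !inE.
all: exact: (edge_knots true (k := _)).
Qed.

Lemma pm_right_K33e : 4 <= pm edge (right_part (n - 5)).
Proof.
have iN : n - 5 < n - 4 by lia.
have K := ladder_K33e_on true; have [_ [pa pc _ _] _] := K.
have allS : all (mem (right_part (n - 5)))
   [:: rail false (n - 5); rail true (n - 5); knot true 0; knot true 1; knot true 2; knot true 3].
  by rewrite /= !rail_right // !inE leqnn.
have [le1 le2] := pm_K33e (simple_edge L) K allS.
apply: leq_trans (pm_ge2 (simple_edge L) _ _ _ _ pa pc).
- apply: leq_trans (leq_add le1 le2).
  rewrite (_ : _ :\: _ = set0) ?pm_set0 //; apply/setP => -[[s i]|[t k]]; rewrite !inE.
    by rewrite !eq_rail // !inl_knot /=; have := ltn_ord i; case: s; lia.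
  by rewrite !inr_rail !eq_knot //; case: t => //=; case: k => [[|[|[|[|k]]]] // ?].
- by rewrite rail_right.
- by rewrite inE.
- by rewrite inE.
by rewrite eq_knots.
Qed.

(** The starting values are 2 for the final 4-cycle and 4 for K33 minus an edge, that is 2 f_2 and 2
    f_3. *)
Lemma pm_right k : k < n - 4 -> 2 * fib k.+2 <= pm edge (right_part (n - 4 - k)).
Proof.
have [m] := ubnP k; elim: m k => // m IH [|[|k]] /= km kN.
- by rewrite subn0; apply: pm_right_knots.
- by rewrite (_ : n - 4 - 1 = n - 5); [apply: pm_right_K33e | lia].
have step := @pm_right_step (n - 4 - k.+2) ltac:(lia) ltac:(lia).
apply: leq_trans step; rewrite -/(fib k.+3) -/(fib k.+2).
have -> : (n - 4 - k.+2).+1 = n - 4 - k.+1 by lia.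
have -> : (n - 4 - k.+1).+1 = n - 4 - k by lia.
by rewrite fibSS mulnDr; apply: leq_add; apply: IH; lia.
Qed.

(** At the left end p_1 has two partners in the 4-cycle, each with two completions there, or the
    next rail vertex p_2. The latter forces q_1 q_2 and leaves the two matchings of the 4-cycle.
    This gives 4 * 2 f_{n-3} + 2 * 2 f_{n-4} = 4 f_{n-1}. *)
Lemma pm_ladder_ge : 4 * fib n.-1 <= pm edge [set: L].
Proof.
have K := ladder_K33e_on false; have [[_ _ _ _] [pa pc _ _] _] := K.
have simp := simple_edge L; have [esym _] := simp.
have N1 : 1 < n - 4 by lia.
have [le1 le2] := pm_K33e simp K (S := setT) ltac:(by rewrite /= !inE).
have := @pm_ge _ _ simp setT (rail false 0) [:: knot false 0; knot false 2; rail false 1].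
have -> : uniq [:: knot false 0; knot false 2; rail false 1] by rewrite /= !inE !eq_knots.
have -> : all (fun u => (u \in [set: L]) && edge (rail false 0) u)
    [:: knot false 0; knot false 2; rail false 1].
  by apply/and4P; split; rewrite // in_setT //=; apply: edge_rails.
rewrite in_setT !big_cons big_nil addn0 => /(_ isT isT isT); apply: leq_trans.
have R1E : setT :\: [set z in [:: rail false 0; rail true 0; knot false 0; knot false 1;
    knot false 2; knot false 3]] = right_part 1.
  apply/setP => -[[s i]|[t k]]; rewrite !inE andbT.
    by rewrite !eq_rail // ?inl_knot //=; [case: s; lia | lia | lia].
  by rewrite !inr_rail !eq_knot //; case: t; case: k => [[|[|[|[|k]]]] // ?].
rewrite R1E in le1 le2.
have le3 : 2 * pm edge (right_part 2) <= pm edge (setT :\ rail false 0 :\ rail false 1).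
  apply: leq_trans (pm_ge1 simp (u := rail true 1) _ _ (edge_rails true _)); last first.
  - by lia.
  - by rewrite !inE !eq_rails //; lia.
  - by rewrite !inE !eq_rails //; lia.
  apply: leq_trans (@pm_C4 _ _ simp _ (knot false 0) (knot false 1) (knot false 2)
    (knot false 3) _ _ _ _ _ _); try exact: (edge_knots false (k := _)).
  - apply: eq_leq; congr (_ * pm _ _); apply/setP => -[[s i]|[t k]]; rewrite !inE ?andbT.
      by rewrite !eq_rail //=; case: s; lia.
    by rewrite ?inr_rail !eq_knot //; case: t; case: k => [[|[|[|[|k]]]] // ?].
  - by rewrite /= !inE !eq_knots.
  - by rewrite /= !inE.
have r1 := @pm_right (n - 5) ltac:(lia); have r2 := @pm_right (n - 6) ltac:(lia).
rewrite (_ : n - 4 - (n - 5) = 1) in r1; last by lia.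
rewrite (_ : n - 4 - (n - 6) = 2) in r2; last by lia.
have -> : fib n.-1 = 2 * fib (n - 5).+2 + fib (n - 6).+2.
  have -> : n.-1 = (n - 5).+4 by lia.
  by have -> : n - 5 = (n - 6).+1; [lia | rewrite !fibSS; lia].
clear -le1 le2 le3 r1 r2; lia.
Qed.

End LadderFacts.

(** * Recognising L_n from its two ends *)

Section Recognition.

Variables (T : finType) (e : rel T) (S : {set T}).

(** Equal orders make the surjection injective. It then maps the three neighbours of a vertex onto
    all three neighbours of the image, so edges are also reflected. *)
Lemma iso_onto_hom (H : sgraph) (f : H -> T) : cubic_on e S -> cubic H -> #|S| = #|H| ->
  (forall y, y \in S -> exists x, y = f x) ->
  (forall x y, edge x y -> e (f x) (f y)) -> iso_onto e S H.
Proof.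
move=> cub cubH SH surj hom.
have SE : S = [set f x | x in H].
  apply/eqP; rewrite eqEcard SH leq_imset_card andbT; apply/subsetP => y /surj [x ->].
  exact: imset_f.
have fI : injective f.
  have inj : {in H &, injective f} by apply/imset_injP; rewrite -SE SH.
  by move=> x y; apply: inj.
exists f; split=> // x y; apply/idP/idP => [exy|]; last exact: hom.
have fS z : f z \in S by rewrite SE imset_f.
have NE : f @: [set z | edge x z] = [set z in S | e (f x) z].
  apply/eqP; rewrite eqEcard card_imset // cubH -/(deg e S (f x)) cub // leqnn andbT.
  by apply/subsetP => _ /imsetP [z + ->]; rewrite !inE fS => /hom.
have : f y \in [set z in S | e (f x) z] by rewrite inE fS.
by rewrite -NE mem_imset // inE.
Qed.

Lemma K33_ends_ladder n : 6 <= n -> cubic_graph e S n -> K33_ends e S (n - 5) ->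
  ext e S n.
Proof.
move=> n6 [[esym eirr] cub _ SN] [p [q' [a [b [c [d [c0 [d0 [S0 [K S0E pc0 qd0 tl]]]]]]]]]].
case: K => [[ab bc cd da] [pa pc qb qd] _].
have [g [h [gc gd cover [rail_e rung last cyc]]]] := tl.
exists (ladderK33 n); first exact: extremal_ladder.
(* Rail index 0 is the end vertex p or q of the K33 minus an edge; index i > 0 is position i - 1 of
   the tail. *)
pose f (x : ladderK33 n) := match x with
  | inl (s, i) => if i == 0 :> nat then (if s then q' else p) else g s i.-1
  | inr (false, k) => nth p [:: a; b; c; d] k
  | inr (true, k) => h k end.
apply: (@iso_onto_hom _ f) => //.
- exact: ladder_cubic.
- by rewrite card_ladder // SN mul2n.
- move=> y yS; have [yr|yr] := boolP (y \in [:: p; q'; a; b; c; d]).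
    have knotf k (k4 : k < 4) : y = nth p [:: a; b; c; d] k -> exists x, y = f x.
      by move=> ->; exists (inr (false, Ordinal k4)).
    move: yr; rewrite !inE; do 5?[case/orP]; move=> /eqP yE.
    + exists (inl (false, Ordinal (rail_gt0 n6))); exact: yE.
    + exists (inl (true, Ordinal (rail_gt0 n6))); exact: yE.
    + exact: (@knotf 0).
    + exact: (@knotf 1).
    + exact: (@knotf 2).
    + exact: (@knotf 3).
  have [|[s [i [ir ->]]]|[k ->]] := cover y; first by rewrite S0E !inE in yr *; rewrite yr.
    have iN : i.+1 < n - 4 by clear -ir; lia.
    by exists (inl (s, Ordinal iN)).
  by exists (inr (true, k)).
suff arc_e x y : ladderK33_arc x y -> e (f x) (f y).
  by move=> x y; rewrite ladder_adj => /orP [/arc_e|/arc_e]; rewrite // esym.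
case: x => [[s i]|[t k]]; case: y => [[s' j]|[t' l]] //=.
- have jN := ltn_ord j; case: eqVneq => [<-|ss] ij.
    have [i0|i0] := eqVneq (i : nat) 0.
      by rewrite (eqP ij) i0 /=; case: s; rewrite ?gc ?gd.
    rewrite (eqP ij) /= -[in X in e _ X](prednK (n := i)) ?lt0n //.
    by apply: rail_e; clear -jN ij i0; lia.
  case/andP: ij => /eqP <- /andP [i0 iN].
  have -> : (i == 0 :> nat) = false by clear -i0; lia.
  have R : e (g false i.-1) (g true i.-1) by apply: rung; clear -i0 iN; lia.
  by case: s ss; case: s' => // _; rewrite 1?esym.
- case/andP => /eqP iE /eqP kE; rewrite iE; case: t' iE => iE.
    rewrite ifF; last by clear -n6; lia.
    exact: last.
  rewrite /= -kE; case: l kE => [[|[|[|[|l]]]] // ?] /= _ //.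
case/andP => /eqP <- kl; case: t; first by apply: cyc; apply/eqP.
by move: kl; case: k => [[|[|[|[|k]]]] // ?]; case: l => [[|[|[|[|l]]]] // ?].
Qed.

End Recognition.

(** * The bound *)

Section PerMat.

Variable G : sgraph.

(** Exactly one edge of [M] at every vertex means that the edges cover the vertices and are
    disjoint; blocks are nonempty because they are edges. *)
Lemma PerMat_pm : PerMat G = pm edge [set: G].
Proof.
apply: eq_card => M; rewrite !inE /perfect_matching.
have edgeE B : (B \in edge_set G) = is_edge edge B.
  apply/imset2P/is_edgeP => [[x y _ + ->]|[x [y [exy ->]]]].
    by rewrite inE => /andP [_ exy]; exists x, y.
  by exists x y; rewrite // inE exy.
have -> : (M \subset edge_set G) = [forall B in M, is_edge edge B].
  apply/subsetP/forall_inP => H B BM; first by rewrite -edgeE H.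
  by rewrite edgeE H.
rewrite andbC; apply: andb_id2r => /forall_inP edgM.
apply/forallP/idP => [one|partM v].
  have uni v B B' : B \in M -> B' \in M -> v \in B -> v \in B' -> B = B'.
    have /cards1P [D DE] := one v.
    move=> BM B'M vB vB'; have := in_set1 B D; have := in_set1 B' D.
    by rewrite -DE !inE BM B'M vB vB' => /esym /eqP -> /esym /eqP ->.
  apply/and3P; split.
  - apply/eqP/setP => v; rewrite inE; have /cards1P [D DE] := one v.
    have := set11 D; rewrite -DE inE => /andP [DM vD].
    by apply/bigcupP; exists D.
  - apply/trivIsetP => B B' BM B'M; apply: contraNT => /pred0Pn [v /andP [vB vB']].
    by apply/eqP; apply: uni vB vB'.
  apply/negP => /edgM /is_edgeP [x [y [_ /setP /(_ x)]]].
  by rewrite !inE eqxx.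
have vc : v \in cover M by rewrite (cover_partition partM) inE.
have [_ triv _] := and3P partM.
apply/cards1P; exists (pblock M v); apply/setP => B; rewrite !inE.
apply/andP/eqP => [[BM vB]|->]; first by rewrite (def_pblock triv BM vB).
by rewrite pblock_mem // mem_pblock.
Qed.

Lemma connected_on_setT : connected G -> connected_on edge [set: G].
Proof.
move=> [_ conn] C cl x y _ _; have := conn x y.
have cl' : closed edge (mem C) by move=> u v euv; apply: cl.
by move=> /(closed_connect cl').
Qed.

Lemma cubic_graph_setT n : connected G -> cubic G -> #|G| = 2 * n ->
  cubic_graph edge [set: G] n.
Proof.
move=> conn cub Gn; split.
- exact: simple_edge.
- by move=> x _; rewrite -(cub x); apply: eq_card => y; rewrite !inE.
- exact: connected_on_setT.
by rewrite cardsT Gn mul2n.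
Qed.

Lemma iso_onto_setT (H : sgraph) : iso_onto edge [set: G] H -> isomorphic G H.
Proof.
move=> [f [fI GE fE]].
have sz : #|G| <= #|H| by rewrite -cardsT GE leq_imset_card.
have [g fK gK] := inj_card_bij fI sz.
exists g; split; first by exists f.
by move=> x y; rewrite -fE !gK.
Qed.

End PerMat.

Lemma isomorphic_pm (G H : sgraph) : isomorphic G H ->
  pm edge [set: G] = pm edge [set: H].
Proof.
move=> [f [[g fK gK] fE]].
rewrite -(pm_imset [set: G] (simple_edge H) (simple_edge G) (can_inj fK) fE).
by congr pm; apply/setP => y; rewrite [RHS]inE; apply/imsetP; exists (g y).
Qed.
Section Bound.

Variable T : finType.
Implicit Types (e : rel T) (S : {set T}).

Lemma K33e_dec e S : K33e e S \/ ~ K33e e S.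
Proof.
pose P p q a b c d := [&& [&& e a b, e b c, e c d & e d a], [&& e p a, e p c, e q b & e q d],
  uniq [:: p; q; a; b; c; d] & all (mem S) [:: p; q; a; b; c; d]].
have PP p q a b c d : reflect (K33e_on e p q a b c d /\ all (mem S) [:: p; q; a; b; c; d])
    (P p q a b c d).
  apply: (iffP and4P) => [[/and4P [? ? ? ?] /and4P [? ? ? ?] ? ?]|]; first by split.
  by move=> [[[? ? ? ?] [? ? ? ?] ?] ?]; split=> //; apply/and4P.
have [/existsP [[[p q] [[a b] [c d]]] /PP K]|/existsPn H] :=
  boolP [exists u : (T * T) * ((T * T) * (T * T)),
         P u.1.1 u.1.2 u.2.1.1 u.2.1.2 u.2.2.1 u.2.2.2].
  by left; exists p, q, a, b, c, d.
right=> -[p [q [a [b [c [d /PP K]]]]]].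
by have := H ((p, q), ((a, b), (c, d))); rewrite K.
Qed.

Lemma triangle_free_dec e S : triangle_free e S \/
  exists x y z, [/\ x \in S, y \in S & z \in S] /\ [/\ e x y, e x z & e y z].
Proof.
have [/existsP [[x [y z]] /and5P [/= xS yS zS exy /andP [exz eyz]]]|/existsPn H] :=
  boolP [exists u : T * (T * T), [&& u.1 \in S, u.2.1 \in S, u.2.2 \in S, e u.1 u.2.1
    & e u.1 u.2.2 && e u.2.1 u.2.2]].
  by right; exists x, y, z.
left=> x y z xS yS zS exy exz; have := H (x, (y, z)).
by rewrite /= xS yS zS exy exz.
Qed.

Lemma in_C4_dec e S v : in_C4 e S v \/ ~ in_C4 e S v.
Proof.
pose P x y w := [&& x \in S, y \in S, w \in S, x != y
  & [&& w != v, e v x, e v y, e x w & e y w]].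
have PP x y w : reflect ([/\ x \in S, y \in S & w \in S] /\
    [/\ x != y, w != v, e v x, e v y & e x w && e y w]) (P x y w).
  apply: (iffP and5P) => [[? ? ? ? /and5P [? ? ? ? ?]]|[[? ? ?] [? ? ? ? /andP [? ?]]]].
    by split=> //; split=> //; apply/andP.
  by split=> //; apply/and5P.
have [/existsP [[x [y w]] /PP K]|/existsPn H] :=
  boolP [exists u : T * (T * T), P u.1 u.2.1 u.2.2].
  by left; exists x, y, w.
by right=> -[x [y [w /PP K]]]; have := H (x, (y, w)); rewrite K.
Qed.

Lemma in_C4_square e S v : simple e -> cubic_on e S -> v \in S -> in_C4 e S v ->
  exists x2 x3 x4 y1 y2 y3 y4, square e S v x2 x3 x4 y1 y2 y3 y4.
Proof.
move=> [esym _] cub vS [x [y [w [[xS yS wS] [xy wv evx evy /andP [exw eyw]]]]]].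
have vw : v != w by rewrite eq_sym.
have [y1 n1] := nb_ex2 cub vS xS yS xy evx evy.
have [y2 n2] : exists y2, nb e S x v w y2 by apply: nb_ex2; rewrite // esym.
have [y3 n3] : exists y3, nb e S w x y y3 by apply: nb_ex2; rewrite // esym.
have [y4 n4] : exists y4, nb e S y v w y4 by apply: nb_ex2; rewrite // esym.
by exists x, w, y, y1, y2, y3, y4.
Qed.

(** The order of the cases matters: [end_bound] requires that there are no bridges; the splitting of
    a swap and the equality case at a square need K33 minus an edge to be excluded; and the
    arguments at 4-cycles rely on the absence of triangles. *)
Lemma cubic_bound n e S : 1 < n -> cubic_graph e S n ->
  pm e S <= max_permat n /\ (pm e S = max_permat n -> ext e S n).
Proof.
have [m] := ubnP n; elim: m n e S => // m IHm n e S nm n2 G.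
have IH k (e' : rel T) (S' : {set T}) : 1 < k < n -> cubic_graph e' S' k ->
    pm e' S' <= max_permat k /\ (pm e' S' = max_permat k -> ext e' S' k).
  by move=> /andP [k2 kn]; apply: IHm => //; apply: leq_trans kn _; rewrite -ltnS.
have [n5|n6] := leqP n 5.
  by have [|le eq _] := small_cases _ G; first by rewrite n2.
have [simp cub conn SN] := G; have [esym eirr] := simp.
have strict : pm e S < max_permat n ->
    pm e S <= max_permat n /\ (pm e S = max_permat n -> ext e S n).
  by move=> lt; split=> [|E]; [apply: ltnW | rewrite E ltnn in lt].
have [bf|[a [b [C [[aS bS eab aC bC] cut]]]]] := bridgeless_dec S esym; last first.
  apply: strict; apply: leq_ltn_trans (bridge_case simp cub conn SN n6 IH aS bS eab aC bC cut) _.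
  by have := max_permat_pred n6; lia.
have [K|noK] := K33e_dec e S.
  have [le eq] := K33e_case simp cub conn SN n6 IH bf K.
  by split=> // /eq; apply: K33_ends_ladder.
have [tri|[x [y [z [[xS yS zS] [exy exz eyz]]]]]] := triangle_free_dec e S; last first.
  exact: strict (triangle_case simp cub conn SN n6 IH bf xS yS zS exy exz eyz).
have C4v v : v \in S -> in_C4 e S v \/ pm e S < max_permat n.
  move=> vS; have [?|noC4] := in_C4_dec e S v; [by left | right].
  exact: (no_C4_case simp cub conn SN n6 IH noK vS tri noC4).
have [lt|ge] := ltnP (pm e S) (max_permat n); first exact: strict.
have {}C4v : {in S, forall v, in_C4 e S v}.
  by move=> v /C4v [//|]; rewrite ltnNge ge.
have [n7|n8] := leqP n 7; first by apply: C4_case67 => //; rewrite n6.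
have /card_gt0P [v vS] : 0 < #|S| by rewrite SN double_gt0 ltnW.
have [x2 [x3 [x4 [y1 [y2 [y3 [y4 sq]]]]]]] := in_C4_square simp cub vS (C4v v vS).
exact: strict (square_case simp cub conn SN n6 IH bf tri noK n8 sq).
Qed.

End Bound.

(** The ladders need only an explicit lower bound, since [cubic_bound] applies to them as well. *)
Lemma pm_extremal n (H : sgraph) : extremal n H -> pm edge [set: H] = max_permat n.
Proof.
move=> extH; have [n5|n5] := leqP n 5; first exact: pm_small.
case: extH n5 => // [_|m m6 _]; first exact: pm_circular.
have conn := ladder_connected m6; have cub := ladder_cubic m6.
have G := cubic_graph_setT conn cub (card_ladder m6).
have [le _] := cubic_bound ltac:(by apply: leq_trans m6) G.
by apply/eqP; rewrite eqn_leq le max_permat_fib // pm_ladder_ge.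
Qed.

Theorem theorem1p4 (n : nat) :
  (forall G : sgraph, connected G -> cubic G -> #|G| = 2 * n ->
     PerMat G <= max_permat n /\
     (PerMat G = max_permat n <->
        exists2 H : sgraph, extremal n H & isomorphic G H)) /\
  (6 <= n ->
     (forall G : sgraph, connected G -> cubic G -> #|G| = 2 * n ->
        PerMat G <= 4 * fib n.-1) /\
     (exists G : sgraph, [/\ connected G, cubic G, #|G| = 2 * n
                           & PerMat G = 4 * fib n.-1])).
Proof.
have bound (G : sgraph) : connected G -> cubic G -> #|G| = 2 * n ->
    PerMat G <= max_permat n /\ (PerMat G = max_permat n -> ext edge [set: G] n).
  move=> conn cub Gn; have cG := cubic_graph_setT conn cub Gn.
  rewrite PerMat_pm; apply: cubic_bound (cG).
  by apply: (cubic_graph_ge2 cG); rewrite cardsT; case: conn.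
split=> [G conn cub Gn|n6].
  have [le eq] := bound G conn cub Gn; split=> //; split=> [/eq [H extH iso]|[H extH iso]].
    by exists H => //; apply: iso_onto_setT.
  by rewrite PerMat_pm (isomorphic_pm iso) (pm_extremal extH).
rewrite -max_permat_fib //; split=> [G conn cub Gn|].
  by have [] := bound G conn cub Gn.
exists (ladderK33 n); split.
- exact: ladder_connected.
- exact: ladder_cubic.
- exact: card_ladder.
by rewrite PerMat_pm (pm_extremal (extremal_ladder n6)).
Qed.
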